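(* Let $k\ge2$. Then the sequence $$\mathcal{RM} \xrightarrow{\ \subseteq\ } \boldsymbol X_h \xrightarrow{\operatorname{sym}\operatorname{grad}} \boldsymbol\Phi_h \xrightarrow{\operatorname{curl}\operatorname{curl}^{\mathsf T}} \widetilde{\boldsymbol\Gamma}_h \xrightarrow{\operatorname{div}} \widetilde{\boldsymbol Z}_h \longrightarrow 0$$ is an exact complex; that is, each operator maps its space into the next one, the kernel of $\operatorname{sym}\operatorname{grad}$ on $\boldsymbol X_h$ is $\mathcal{RM}$, $\ker(\operatorname{curl}\operatorname{curl}^{\mathsf T}|_{\boldsymbol\Phi_h})=\operatorname{sym}\operatorname{grad}\boldsymbol X_h$, $\ker(\operatorname{div}|_{\widetilde{\boldsymbol\Gamma}_h})=\operatorname{curl}\operatorname{curl}^{\mathsf T}\boldsymbol\Phi_h$, and $\operatorname{div}\widetilde{\boldsymbol\Gamma}_h=\widetilde{\boldsymbol Z}_h$.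
   Context: Notation. Coordinates are $(x_1,x_2,x_3)=(x,y,z)$, $\partial_i=\partial/\partial x_i$. Whenever indices $i,j,l$ occur together they are pairwise distinct, i.e. $\{i,j,l\}=\{1,2,3\}$. $\mathcal Q(i{:}a,j{:}b,l{:}c)$ is the space of polynomials of degree at most $a$ in $x_i$, at most $b$ in $x_j$ and at most $c$ in $x_l$ (separately); similarly with fewer variables on faces and edges; it is the zero space if some bound is negative. $\mathcal Q_{a,b,c}=\mathcal Q(1{:}a,2{:}b,3{:}c)$. $\mathbb S$ is the space of symmetric real $3\times3$ matrices. $\operatorname{curl}$ and $\operatorname{div}$ act row-wise on matrix fields, $\operatorname{curl}^{\mathsf T}\boldsymbol\sigma=(\operatorname{curl}\boldsymbol\sigma^{\mathsf T})^{\mathsf T}$ (column-wise curl), $\operatorname{sym}\boldsymbol\sigma=\frac12(\boldsymbol\sigma+\boldsymbol\sigma^{\mathsf T})$. $\mathcal{RM}=\{\boldsymbol a+\boldsymbol b\times\boldsymbol x:\boldsymbol a,\boldsymbol b\in\mathbb R^3\}$. Mesh. $\Omega\subset\mathbb R^3$ is a contractible domain with Lipschitz boundary, partitioned by a (face-to-face) mesh $\mathcal T_h$ of axis-parallel cuboids. $e_i$ denotes an edge parallel to the $x_i$-axis; $F_{ij}=F_{ji}$ denotes a face parallel to the $x_i$- and $x_j$-axes (normal to the $x_l$-direction). A finite element space given by a shape function space on each cell $T$ and degrees of freedom (DOFs) on $T$ consists of all piecewise polynomial fields whose restriction to each cell is in the shape function space and such that each DOF attached to a vertex, edge or face has the same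 value from all cells containing that vertex, edge or face. ''Moments of $f$ on $G$ against $P$'' means the functionals $\int_G f\,p$ for all $p\in P$. $\boldsymbol X_h$ (values in $\mathbb R^3$): shape functions $u_i\in\mathcal Q(i{:}k,j{:}k+1,l{:}k+1)$. DOFs of $u_i$: $u_i,\partial_ju_i,\partial_lu_i,\partial_j\partial_lu_i$ at each vertex; moments of these same four functions on each $e_i$ against $\mathcal Q(i{:}k-2)$; for each $j\neq i$, moments of $u_i,\partial_lu_i$ on each $e_j$ against $\mathcal Q(j{:}k-3)$; moments of $u_i$ on each $F_{jl}$ against $\mathcal Q(j{:}k-3,l{:}k-3)$; for each $j\neq i$, moments of $u_i,\partial_lu_i$ on each $F_{ij}$ against $\mathcal Q(i{:}k-2,j{:}k-3)$; moments of $u_i$ on $T$ against $\mathcal Q(i{:}k-2,j{:}k-3,l{:}k-3)$. $\boldsymbol\Phi_h$ (values in $\mathbb S$): shape functions: symmetric $\boldsymbol\sigma$ with $\sigma_{ii}\in\mathcal Q(i{:}k-1,j{:}k+1,l{:}k+1)$ and, for $i\ne j$, $\sigma_{ij}=\sigma_{ji}\in\mathcal Q(i{:}k,j{:}k,l{:}k+1)$. DOFs of $\sigma_{ii}$: moments of $\sigma_{ii},\partial_j\sigma_{ii},\partial_l\sigma_{ii},\partial_j\partial_l\sigma_{ii}$ on each $e_i$ against $\mathcal Q(i{:}k-1)$; for each $j\ne i$, moments of $\sigma_{ii},\partial_l\sigma_{ii}$ on each $F_{ij}$ against $\mathcal Q(i{:}k-1,j{:}k-3)$; moments of $\sigma_{ii}$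 on $T$ against $\mathcal Q(i{:}k-1,j{:}k-3,l{:}k-3)$. DOFs of $\sigma_{ij}$ ($i<j$): $\sigma_{ij},\partial_l\sigma_{ij}$ at each vertex; moments of $\sigma_{ij},\partial_l\sigma_{ij}$ on each $e_i$ against $\mathcal Q(i{:}k-2)$ and on each $e_j$ against $\mathcal Q(j{:}k-2)$; moments of $\sigma_{ij}$ on each $e_l$ against $\mathcal Q(l{:}k-3)$; moments of $\sigma_{ij},\partial_l\sigma_{ij}$ on each $F_{ij}$ against $\mathcal Q(i{:}k-2,j{:}k-2)$; moments of $\sigma_{ij}$ on each $F_{il}$ against $\mathcal Q(i{:}k-2,l{:}k-3)$ and on each $F_{jl}$ against $\mathcal Q(j{:}k-2,l{:}k-3)$; moments of $\sigma_{ij}$ on $T$ against $\mathcal Q(i{:}k-2,j{:}k-2,l{:}k-3)$. $\widetilde{\boldsymbol\Gamma}_h$ (values in $\mathbb S$): shape functions: symmetric $\boldsymbol\sigma$ with $\sigma_{ii}\in\mathcal Q(i{:}k+1,j{:}k-1,l{:}k-1)$ and, for $i\neq j$, $\sigma_{ij}=\sigma_{ji}\in\mathcal Q(i{:}k,j{:}k,l{:}k-1)$. DOFs of $\sigma_{ii}$: moments of $\sigma_{ii}$ on each $F_{jl}$ against $\mathcal Q(j{:}k-1,l{:}k-1)$; moments of $\sigma_{ii}$ on $T$ against $\mathcal Q_{k-1,k-1,k-1}$. DOFs of $\sigma_{ij}$ ($i<j$): moments on each $e_l$ against $\mathcal Q(l{:}k-1)$, on each $F_{il}$ against $\mathcal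 Q(i{:}k-2,l{:}k-1)$, on each $F_{jl}$ against $\mathcal Q(j{:}k-2,l{:}k-1)$, and on $T$ against $\mathcal Q(i{:}k-2,j{:}k-2,l{:}k-1)$. $\widetilde{\boldsymbol Z}_h$: all $\boldsymbol q\in L^2(\Omega;\mathbb R^3)$ with $q_i|_T\in\mathcal Q(i{:}k,j{:}k-1,l{:}k-1)$ on each cell $T$ (no interelement continuity). *)

(* Defs.v *)
From HB Require Import structures.
From mathcomp Require Import all_boot all_order all_algebra.
From mathcomp Require Import all_classical all_reals all_analysis.
(* The notations of mpoly clash with those of mathcomp-analysis; only its
   canonical structures and coercions are imported. *)
From mathcomp.multinomials Require Import (canonicals, coercions) mpoly.
Import numFieldNormedType.Exports.
Import Order.TTheory GRing.Theory Num.Theory.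

Set Implicit Arguments.
Unset Strict Implicit.
Unset Printing Implicit Defensive.

Local Open Scope classical_set_scope.
Local Open Scope ring_scope.

Notation poly3 R := (mpoly.mpoly 3 R).
(* Points, vector fields and the rows of matrix fields are row vectors. *)
Notation pt3 R := 'rV[R]_3.
Notation vec3 R := 'rV[poly3 R]_3.
Notation mat3 R := 'M[poly3 R]_3.

(** * Domains *)

Section Domains.
Variable R : realType.
Implicit Type Omega : set (pt3 R).

Definition contractible Omega : Prop :=
  exists2 p : pt3 R, Omega p &
  exists H : R * pt3 R -> pt3 R,
    let D := [set z : R * pt3 R | 0 <= z.1 <= 1 /\ Omega z.2] in
    [/\ {within D, continuous H},
        forall z, D z -> Omega (H z),
        forall x, Omega x -> H (0, x) = x
      & forall x, Omega x -> H (1, x) = p].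

(* Near each boundary point and in suitable orthonormal coordinates [x *m A],
   Omega is the set of the points below the graph of a Lipschitz function. *)
Definition lipschitz_boundary Omega : Prop :=
  forall x, (closure Omega `\` Omega^°) x ->
  exists (A : 'M[R]_3) (g : R * R -> R),
    [/\ A *m A^T = 1%:M, lipschitz g
      & \forall y \near x,
          Omega y <-> (y *m A) 0 2 < g ((y *m A) 0 0, (y *m A) 0 1)].

End Domains.

(** * Cuboid meshes *)

Record cuboid (R : realType) := Cuboid {
  lo : 'I_3 -> R;
  hi : 'I_3 -> R;
  lo_lt_hi : forall i, lo i < hi i }.

Section Mesh.
Variable R : realType.
Implicit Types (T : cuboid R) (i : 'I_3) (s : 'I_3 -> option bool).

Definition endpoint T i (b : bool) : R := if b then hi T i else lo T i.

(* The vertices, edges, faces of T and T itself are indexed by s: they extend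
   over the whole width of T in the directions where [s i = None], and lie at
   the lower or upper end of T in the directions where [s i = Some b]. *)
Definition subcell T s : set (pt3 R) :=
  [set x | forall i, match s i with
                     | None => lo T i <= x 0 i <= hi T i
                     | Some b => x 0 i = endpoint T i b
                     end].

Definition cell T : set (pt3 R) := subcell T (fun=> None).

Definition vertex T (b : 'I_3 -> bool) : pt3 R :=
  \row_i endpoint T i (b i).

Record cuboid_mesh (I : finType) (Omega : set (pt3 R)) (M : I -> cuboid R)
    : Prop := CuboidMesh {
  mesh_cover : closure Omega = \bigcup_t cell (M t);
  mesh_disjoint : forall t t', t != t' ->
    (cell (M t))^° `&` (cell (M t'))^° = set0;
  mesh_face_to_face : forall t t', t != t' ->
    cell (M t) `&` cell (M t') = set0 \/
    exists s s', cell (M t) `&` cell (M t') = subcell (M t) s /\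
                 cell (M t) `&` cell (M t') = subcell (M t') s' }.

Definition integral_dir T s i (g : R -> R) : R :=
  match s i with
  | None => \int[lebesgue_measure]_(x in `[lo T i, hi T i]) g x
  | Some b => g (endpoint T i b)
  end.

(* The integral of p over the edge, face or cell [subcell T s], as an iterated
   integral over its free directions. *)
Definition subcell_integral T s (p : poly3 R) : R :=
  integral_dir T s 0 (fun x =>
  integral_dir T s 1 (fun y =>
  integral_dir T s 2 (fun z =>
    mpoly.meval (fun i : 'I_3 => nth 0 [:: x; y; z] i) p))).

End Mesh.

(** * Polynomial spaces with separate degree bounds *)

(* [Q [:: (i, a); (j, b); (l, c)]] is the space Q(i:a, j:b, l:c).  A direction
   that is not listed gets the bound 0, i.e. the polynomials do not depend on
   that variable, so that Q [:: (i, a); (j, b)] and Q [:: (i, a)] are the spaces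
   on faces and edges.  The bounds are integers: when one of them is negative
   no monomial is allowed, and the space is zero. *)
Definition degree_bound (a : seq ('I_3 * int)) (i : 'I_3) : int :=
  nth 0 (unzip2 a) (index i (unzip1 a)).

Definition Q (R : realType) (a : seq ('I_3 * int)) : set (poly3 R) :=
  [set p | forall m, m \in mpoly.msupp p ->
           forall i : 'I_3, (m i)%:Z <= degree_bound a i].
Arguments Q {R} a.

(** * Differential operators *)

Section Operators.
Variable R : realType.

(* Indices are computed modulo 3 in the ring 'I_3. *)
Definition curl_row (v : vec3 R) : vec3 R :=
  \row_i (mpoly.mderiv (i + 1) (v 0 (i + 2))
          - mpoly.mderiv (i + 2) (v 0 (i + 1))).

Definition curl (s : mat3 R) : mat3 R :=
  \matrix_(i, j) curl_row (row i s) 0 j.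

Definition curlT (s : mat3 R) : mat3 R := (curl s^T)^T.

Definition div (s : mat3 R) : vec3 R :=
  \row_i \sum_j mpoly.mderiv j (s i j).

Definition grad (u : vec3 R) : mat3 R :=
  \matrix_(i, j) mpoly.mderiv j (u 0 i).

Definition sym (s : mat3 R) : mat3 R :=
  mpoly.mpolyC 3 (2^-1 : R) *: (s + s^T).

Definition symgrad (u : vec3 R) : mat3 R := sym (grad u).

Definition curlcurlT (s : mat3 R) : mat3 R := curl (curlT s).

(* a + b x (x, y, z) *)
Definition rigid_motion (a b : 'I_3 -> R) : vec3 R :=
  let X (i : 'I_3) : poly3 R := mpoly.mpolyX R (mpoly.mnm1 i) in
  \row_i (mpoly.mpolyC 3 (a i)
          + (b (i + 1) *: X (i + 2) - b (i + 2) *: X (i + 1))).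

End Operators.

(** * Finite element spaces *)

(* A piecewise polynomial field on a mesh M indexed by I is the family of its
   polynomial restrictions to the cells; operators act cell by cell. *)
Definition cellwise (I : finType) (U V : Type) (op : U -> V) (u : I -> U)
    : I -> V := fun t => op (u t).

Section Spaces.
Variables (R : realType) (I : finType) (M : I -> cuboid R).
Implicit Types (v : I -> poly3 R) (i j l : 'I_3).

(* The value at each vertex is the same from all cells containing it. *)
Definition vertex_values v : Prop :=
  forall t t' b, cell (M t') (vertex (M t) b) ->
    mpoly.meval (vertex (M t) b 0) (v t)
    = mpoly.meval (vertex (M t) b 0) (v t').

(* The moments against Q a on each edge or face whose directions are those
   listed in a are the same from all cells containing that edge or face. *)
Definition moments (a : seq ('I_3 * int)) v : Prop :=
  forall t t' s, (forall i, s i = None <-> i \in unzip1 a) ->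
    subcell (M t) s `<=` cell (M t') ->
    forall q, Q a q ->
      subcell_integral (M t) s (v t * q) = subcell_integral (M t) s (v t' * q).

Definition D i v : I -> poly3 R := cellwise (mpoly.mderiv i) v.

Definition with_D l (P : (I -> poly3 R) -> Prop) v : Prop :=
  P v /\ P (D l v).

Definition with_DD j l (P : (I -> poly3 R) -> Prop) v : Prop :=
  [/\ P v, P (D j v), P (D l v) & P (D j (D l v))].

Definition distinct i j l : bool := uniq [:: i; j; l].

(* In the following definitions [i, j, l] ranges over all permutations of the
   three directions.  Only degrees of freedom on vertices, edges and faces
   appear: those interior to a cell involve that cell alone, and impose no
   condition. *)

Definition RM : set (I -> vec3 R) :=
  [set u | exists a b, forall t, u t = rigid_motion a b].

Variable k : nat.
Let K : int := k%:Z.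

Definition Xh : set (I -> vec3 R) :=
  [set u | forall i j l, distinct i j l ->
    let ui := fun t => u t 0 i in
    (forall t, Q [:: (i, K); (j, K + 1); (l, K + 1)] (ui t)) /\
    [/\ with_DD j l vertex_values ui,
        with_DD j l (moments [:: (i, K - 2)]) ui,
        with_D l (moments [:: (j, K - 3)]) ui,
        moments [:: (j, K - 3); (l, K - 3)] ui
      & with_D l (moments [:: (i, K - 2); (j, K - 3)]) ui]].

Definition Phih : set (I -> mat3 R) :=
  [set s |
    [/\ forall t, (s t)^T = s t,
        forall i j l, distinct i j l ->
          let sii := fun t => s t i i in
          [/\ forall t, Q [:: (i, K - 1); (j, K + 1); (l, K + 1)] (sii t),
              with_DD j l (moments [:: (i, K - 1)]) sii
            & with_D l (moments [:: (i, K - 1); (j, K - 3)]) sii]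
      & forall i j l, distinct i j l -> (i < j)%N ->
          let sij := fun t => s t i j in
          (forall t, Q [:: (i, K); (j, K); (l, K + 1)] (sij t)) /\
          [/\ with_D l vertex_values sij,
              with_D l (moments [:: (i, K - 2)]) sij /\
              with_D l (moments [:: (j, K - 2)]) sij,
              moments [:: (l, K - 3)] sij,
              with_D l (moments [:: (i, K - 2); (j, K - 2)]) sij
            & moments [:: (i, K - 2); (l, K - 3)] sij /\
              moments [:: (j, K - 2); (l, K - 3)] sij]]].

Definition Gammah : set (I -> mat3 R) :=
  [set s |
    [/\ forall t, (s t)^T = s t,
        forall i j l, distinct i j l ->
          let sii := fun t => s t i i in
          (forall t, Q [:: (i, K + 1); (j, K - 1); (l, K - 1)] (sii t)) /\
          moments [:: (j, K - 1); (l, K - 1)] sii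
      & forall i j l, distinct i j l -> (i < j)%N ->
          let sij := fun t => s t i j in
          [/\ forall t, Q [:: (i, K); (j, K); (l, K - 1)] (sij t),
              moments [:: (l, K - 1)] sij,
              moments [:: (i, K - 2); (l, K - 1)] sij
            & moments [:: (j, K - 2); (l, K - 1)] sij]]].

Definition Zh : set (I -> vec3 R) :=
  [set q | forall i j l, distinct i j l ->
    forall t, Q [:: (i, K); (j, K - 1); (l, K - 1)] (q t 0 i)].

End Spaces.
Arguments RM : clear implicits.
Arguments Zh : clear implicits.

(* Main.v *)
(* The degrees of freedom say that every component of every field lies in a space
   V(b) of piecewise polynomials, b in {0,1,2}^3: degree less than k + b_i in x_i,
   and derivatives of order less than b_i in x_i matched across the faces normal
   to x_i.  With e_i the i-th unit vector, u_i is in V(2 - e_i) for X_h, sigma_ij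
   in V(2 - e_i - e_j) for Phi_h and, off the diagonal, in V(e_i + e_j) for
   Gamma_h; on the diagonal this holds in Gamma_h once div sigma = 0, because
   D_i sigma_ii = - sum_{j <> i} D_j sigma_ij is then matched too.

   For every b in {1,2}^3 the sequence grad : V(b) -> (V(b - e_i))_i, curl, div is
   exact.  Antiderivatives corrected by a profile of mass one, taken one direction
   at a time, replace a closed field by a cubical cocycle made of its integrals
   over edges or faces.  Rounding points to vertices turns it into an
   Alexander-Spanier cocycle on the closure of Omega, which is a coboundary at a
   small scale: a collar pushes the closure into Omega, where the contraction
   acts.  Integrating the potential along finely subdivided edges and faces makes
   it cubical again.

   The elasticity complex then follows from the de Rham complexes with
   b = 2 - e_i and b = 1 + e_i: if curl curl^T sigma = 0 then the rows of
   curl^T sigma are gradients of the components of some omega, and the columns of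
   sigma + skw omega are gradients of the components of u; if div sigma = 0 then
   the rows of sigma are curls of those of some tau, and the columns of
   tau - tr tau are curls.  The divergence is already onto on diagonal matrices. *)
Require Import Defs.
From HB Require Import structures.
From mathcomp Require Import all_boot all_order all_algebra.
From mathcomp Require Import all_classical all_reals all_analysis.
From mathcomp.multinomials Require Import (canonicals, coercions) mpoly.
From mathcomp.real_closed Require Import polyrcf.
From mathcomp Require Import ring lra zify.
Import numFieldNormedType.Exports.
Import Order.TTheory GRing.Theory Num.Theory.

Set Implicit Arguments.
Unset Strict Implicit.
Unset Printing Implicit Defensive.

Local Open Scope classical_set_scope.
Local Open Scope ring_scope.

Local Notation mon3 := (mpoly.multinom 3).
Local Notation mpX := (mpoly.mpolyX _).
Local Notation mderiv := mpoly.mderiv.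
Local Notation meval := mpoly.meval.
Local Notation mpolyC := mpoly.mpolyC.
Local Notation mnm1 := mpoly.mnm1.
Local Notation mcoeff := mpoly.mcoeff.
Local Notation mpolyX := mpoly.mpolyX.
Local Notation msupp := mpoly.msupp.

(** The degrees of freedom are tensor products of end derivatives and moments, so unisolvence on
    each common face reduces to one dimension: a polynomial of degree less than k + b is determined
    by b derivatives at each end and k - b moments. The hypothesis 2 <= k leaves room for the C^1
    profile, a quadratic bump whose antiderivative is cubic and so has degree less than k + 2.

    The contraction of Omega ignores the mesh and is merely continuous, so it cannot act on cubical
    cochains, let alone on polynomials. Functions of tuples of nearby points need no regularity and
    can be pulled back along any finite sequence of small moves. These moves must be uniformly
    small, which compactness gives on the closure; but the contraction exists only on Omega and
    nothing controls it near the boundary, hence the collar. The return to the mesh is a matter of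
    scale: the potential found this way controls only pairs of points much closer than the vertices
    of a cell. *)

Section MonomialExtension.
Variable R : realFieldType.
Local Notation P3 := (mpoly.mpoly 3 R).
Implicit Types (p q : P3) (u : {poly R}) (i j : 'I_3).

Definition upd (A : Type) j (a : A) (f : 'I_3 -> A) : 'I_3 -> A :=
  fun i => if i == j then a else f i.
Arguments upd : simpl never.

Lemma upd_eq (A : Type) j (a : A) f : upd j a f j = a.
Proof. by rewrite /upd eqxx. Qed.

Lemma upd_neq (A : Type) i j (a : A) f : i != j -> upd j a f i = f i.
Proof. by rewrite /upd => /negbTE->. Qed.

(** The coordinatewise operators and functionals below are prescribed on monomials through this
    linear extension; their identities then follow by [mpoly_lin_ind]. *)
Definition mext (V : lmodType R) (F : mon3 -> V) p : V :=
  \sum_(m <- msupp p) mcoeff m p *: F m.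

Lemma mext_wide (V : lmodType R) (F : mon3 -> V) p (r : seq mon3) :
  uniq r -> {subset msupp p <= r} ->
  mext F p = \sum_(m <- r) mcoeff m p *: F m.
Proof.
move=> ur sr; rewrite (bigID (fun m => m \in msupp p)) /= addrC big1 ?add0r.
  rewrite -big_filter; apply: perm_big; apply: uniq_perm.
  - exact: mpoly.msupp_uniq.
  - exact: filter_uniq.
  move=> m; rewrite mem_filter; case: (boolP (m \in msupp p)) => //= h.
  by rewrite sr.
by move=> m /mpoly.memN_msupp_eq0->; rewrite scale0r.
Qed.

Lemma mext_is_linear (V : lmodType R) (F : mon3 -> V) : linear (mext F).
Proof.
move=> a p q.
pose r := undup (msupp p ++ msupp q ++ msupp (a *: p + q)).
have ur : uniq r by exact: undup_uniq.
rewrite !(@mext_wide _ _ _ r) //.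
- rewrite scaler_sumr -big_split /=; apply: eq_bigr => m _.
  by rewrite mpoly.mcoeffD mpoly.mcoeffZ scalerDl scalerA.
all: by move=> m h; rewrite mem_undup !mem_cat h ?orbT.
Qed.

HB.instance Definition _ (V : lmodType R) (F : mon3 -> V) :=
  GRing.isLinear.Build R P3 V _ (mext F) (mext_is_linear F).

Lemma mextX (V : lmodType R) (F : mon3 -> V) m : mext F (mpX m) = F m.
Proof. by rewrite /mext mpoly.msuppX big_seq1 mpoly.mcoeffX eqxx scale1r. Qed.

Lemma mpoly_lin_ind (Pr : P3 -> Prop) :
  Pr 0 -> (forall a p q, Pr p -> Pr q -> Pr (a *: p + q)) ->
  (forall m, Pr (mpX m)) -> forall p, Pr p.
Proof.
move=> h0 hl hX p; rewrite [p]mpoly.mpolyE.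
by elim: (msupp p) => [|m r IH]; rewrite ?big_nil ?big_cons //; apply: hl.
Qed.

Lemma poly_lin_ind (Pr : {poly R} -> Prop) :
  Pr 0 -> (forall a u v, Pr u -> Pr v -> Pr (a *: u + v)) ->
  (forall n, Pr 'X^n) -> forall u, Pr u.
Proof.
move=> h0 hl hX u; rewrite -[u]coefK poly_def.
elim/big_ind: _ => //.
- by move=> x y hx hy; rewrite -[x]scale1r; apply: hl.
- by move=> i _; rewrite -[X in Pr X]addr0; apply: hl.
Qed.

(** * Polynomials in one coordinate and tensor products *)

Definition emb j u : P3 := (map_poly (@mpoly.mpolyC 3 R) u).[mpX (mnm1 j)].

Lemma emb_is_linear j : linear (emb j).
Proof.
move=> a u v.
by rewrite /emb rmorphD /= -mul_polyC rmorphM /= map_polyC /= hornerD hornerCM mpoly.mul_mpolyC.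
Qed.
HB.instance Definition _ j :=
  GRing.isLinear.Build R {poly R} P3 _ (emb j) (emb_is_linear j).

Lemma embP j a u v : emb j (a *: u + v) = a *: emb j u + emb j v.
Proof. exact: linearP. Qed.

Lemma emb_is_monoid j : monoid_morphism (emb j).
Proof.
by split=> [|u v]; rewrite /emb ?rmorph1 ?hornerC // rmorphM hornerM.
Qed.
HB.instance Definition _ j :=
  GRing.isMonoidMorphism.Build {poly R} P3 (emb j) (emb_is_monoid j).

Lemma embX j : emb j 'X = mpX (mnm1 j).
Proof. by rewrite /emb map_polyX hornerX. Qed.

Lemma embXn j n : emb j 'X^n = mpX (mpoly.mnm_muln (mnm1 j) n).
Proof. by rewrite rmorphXn /= embX mpoly.mpolyXn. Qed.

Definition tens (u : 'I_3 -> {poly R}) : P3 := \prod_i emb i (u i).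

Lemma eq_tens (u v : 'I_3 -> {poly R}) : u =1 v -> tens u = tens v.
Proof. by move=> h; apply: eq_bigr => i _; rewrite h. Qed.

Lemma mpX_tens m : mpX m = tens (fun i => 'X^(m i)) :> P3.
Proof.
rewrite mpoly.mpolyXE_id; apply: eq_bigr => i _.
by rewrite rmorphXn /= embX.
Qed.

Definition toff j (u : 'I_3 -> {poly R}) : P3 := \prod_(i < 3 | i != j) emb i (u i).

Lemma eq_toff j (u v : 'I_3 -> {poly R}) :
  (forall i, i != j -> u i = v i) -> toff j u = toff j v.
Proof. by move=> h; apply: eq_bigr => i ij; rewrite h. Qed.

Lemma tensD1 j (u : 'I_3 -> {poly R}) : tens u = emb j (u j) * toff j u.
Proof. by rewrite /tens (bigD1 j). Qed.

Lemma tens_upd j v (u : 'I_3 -> {poly R}) : tens (upd j v u) = emb j v * toff j u.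
Proof.
by rewrite (tensD1 j) upd_eq; congr (_ * _); apply: eq_toff => i ij; rewrite upd_neq.
Qed.

Lemma tens_updP j a v w (u : 'I_3 -> {poly R}) :
  tens (upd j (a *: v + w) u) = a *: tens (upd j v u) + tens (upd j w u).
Proof. by rewrite !tens_upd linearP mulrDl scalerAl. Qed.

Lemma embXnM j n m :
  emb j 'X^n * mpX m = tens (upd j 'X^(n + m j) (fun i => 'X^(m i))).
Proof. by rewrite mpX_tens (tensD1 j) tens_upd mulrA -rmorphM -exprD. Qed.

(** The operator that is L in direction j and the identity in the other two. It reads L only on
    powers of X, so most of its laws ask for a linear L. *)
Definition along j (L : {poly R} -> {poly R}) : P3 -> P3 :=
  mext (fun m => tens (upd j (L 'X^(m j)) (fun i => 'X^(m i)))).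
HB.instance Definition _ j L := GRing.Linear.on (along j L).

Lemma alongP j L a p q : along j L (a *: p + q) = a *: along j L p + along j L q.
Proof. exact: linearP. Qed.

Lemma alongX j L m :
  along j L (mpX m) = tens (upd j (L 'X^(m j)) (fun i => 'X^(m i))).
Proof. exact: mextX. Qed.

Definition mon (n : 'I_3 -> nat) : mon3 := mpoly.Multinom (mktuple n).

Lemma monE n i : mon n i = n i.
Proof. by rewrite /mon mpoly.multinomE tnth_mktuple. Qed.

Lemma mpX_mon n : mpX (mon n) = tens (fun i => 'X^(n i)) :> P3.
Proof. by rewrite mpX_tens; apply: eq_tens => i; rewrite monE. Qed.

Lemma along_mon j L n :
  along j L (tens (fun i => 'X^(n i))) = tens (upd j (L 'X^(n j)) (fun i => 'X^(n i))).
Proof.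
rewrite -mpX_mon alongX monE; apply: eq_tens => i.
by rewrite /upd; case: eqP => //; rewrite monE.
Qed.

Lemma along_updX j (L : {linear {poly R} -> {poly R}}) v n :
  along j L (tens (upd j v (fun i => 'X^(n i)))) = tens (upd j (L v) (fun i => 'X^(n i))).
Proof.
elim/poly_lin_ind: v => [|a v w hv hw|m].
- by rewrite !tens_upd !linear0 !mul0r linear0.
- by rewrite tens_updP alongP hv hw (linearP L) tens_updP.
- rewrite (_ : tens _ = tens (fun i => 'X^(upd j m n i))); last first.
    by apply: eq_tens => i; rewrite /upd; case: eqP.
  rewrite along_mon upd_eq; apply: eq_tens => i; rewrite /upd.
  by case: (eqVneq i j). 
Qed.

Lemma along_embM i j L v p : i != j -> along j L (emb i v * p) = emb i v * along j L p.
Proof.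
move=> ij; elim/poly_lin_ind: v => [|a v w hv hw|n].
- by rewrite !linear0 !mul0r linear0.
- by rewrite embP !mulrDl -!scalerAl alongP hv hw.
elim/mpoly_lin_ind: p => [|a p q hp hq|m].
- by rewrite !linear0 mulr0 linear0.
- by rewrite alongP !mulrDr -!scalerAr alongP hp hq.
rewrite alongX embXnM.
rewrite (_ : tens (upd i _ _) = tens (fun l => 'X^(upd i (n + m i) m l)%N)); last first.
  by apply: eq_tens => l; rewrite /upd; case: eqP.
rewrite along_mon upd_neq 1?eq_sym // (tensD1 i) [in RHS](tensD1 i) mulrA.
rewrite ![upd j _ _ i]upd_neq // upd_eq -rmorphM -exprD; congr (_ * _).
by apply: eq_toff => k ki; rewrite /upd; case: eqP => // _; rewrite (negbTE ki).
Qed.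

Lemma along_tens j (L : {linear {poly R} -> {poly R}}) (u : 'I_3 -> {poly R}) :
  along j L (tens u) = tens (upd j (L (u j)) u).
Proof.
have aux v : along j L (emb j v) = emb j (L v).
  have h w : emb j w = tens (upd j w (fun i => 'X^0)).
    by rewrite tens_upd /toff big1 ?mulr1 // => i _; rewrite expr0 rmorph1.
  by rewrite h (along_updX j L v (fun=> 0%N)) -h.
rewrite (tensD1 j) mulrC tens_upd mulrC [RHS]mulrC /toff.
have h (r : seq 'I_3) v : along j L ((\prod_(i <- r | i != j) emb i (u i)) * emb j v)
   = (\prod_(i <- r | i != j) emb i (u i)) * emb j (L v).
  elim: r => [|i r IH]; first by rewrite !big_nil !mul1r aux.
  rewrite !big_cons; case: ifP => // ij.
  by rewrite -!mulrA along_embM // IH.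
by rewrite mulrC h.
Qed.

Lemma along_comp j (L L' : {linear {poly R} -> {poly R}}) p :
  along j L (along j L' p) = along j (L \o L') p.
Proof.
elim/mpoly_lin_ind: p => [|a p q hp hq|m]; first by rewrite !linear0.
  by rewrite !alongP hp hq.
rewrite mpX_tens !along_tens; apply: eq_tens => i.
by rewrite /upd eqxx; case: eqP.
Qed.

Lemma along_comm i j (L L' : {linear {poly R} -> {poly R}}) p : i != j ->
  along i L (along j L' p) = along j L' (along i L p).
Proof.
move=> ij; elim/mpoly_lin_ind: p => [|a p q hp hq|m]; first by rewrite !linear0.
  by rewrite !alongP hp hq.
rewrite mpX_tens !along_tens; apply: eq_tens => l.
have ji : j != i by rewrite eq_sym.
rewrite [upd j _ _ i]upd_neq // [upd i _ _ j]upd_neq // /upd.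
by case: (eqVneq l i) => // ->; rewrite (negbTE ij).
Qed.

Lemma eq_along j (L L' : {poly R} -> {poly R}) : L =1 L' -> along j L =1 along j L'.
Proof.
move=> h p; rewrite /along /mext; apply: eq_bigr => m _; congr (_ *: _).
by apply: eq_tens => i; rewrite /upd h.
Qed.

Lemma along_id j p : along j idfun p = p.
Proof.
elim/mpoly_lin_ind: p => [|a p q hp hq|m]; first by rewrite !linear0.
  by rewrite !alongP hp hq.
rewrite mpX_tens along_tens; apply: eq_tens => i; rewrite /upd /=.
by case: eqP => // ->.
Qed.

Lemma along_add j (L L' : {poly R} -> {poly R}) p :
  along j (fun u => L u + L' u) p = along j L p + along j L' p.
Proof.
elim/mpoly_lin_ind: p => [|a p q hp hq|m]; first by rewrite !linear0 ?addr0.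
  by rewrite !alongP hp hq scalerDr addrACA.
by rewrite !alongX !tens_upd linearD mulrDl.
Qed.

Lemma along_opp j (L : {poly R} -> {poly R}) p :
  along j (fun u => - L u) p = - along j L p.
Proof.
elim/mpoly_lin_ind: p => [|a p q hp hq|m]; first by rewrite !linear0 ?oppr0.
  by rewrite !alongP hp hq opprD scalerN.
by rewrite !alongX !tens_upd linearN mulNr.
Qed.

Lemma along_sub j (L L' : {poly R} -> {poly R}) p :
  along j (fun u => L u - L' u) p = along j L p - along j L' p.
Proof. by rewrite along_add along_opp. Qed.

Lemma along_embl j (L : {poly R} -> {poly R}) v p :
  along j (fun u => v * L u) p = emb j v * along j L p.
Proof.
elim/mpoly_lin_ind: p => [|a p q hp hq|m]; first by rewrite !linear0 ?mulr0.
  by rewrite !alongP hp hq mulrDr scalerAr.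
by rewrite !alongX !tens_upd rmorphM mulrA.
Qed.

Lemma mderiv_along j p : mderiv j p = along j (@deriv R) p.
Proof.
elim/mpoly_lin_ind: p => [|a p q hp hq|m]; first by rewrite !linear0.
  by rewrite (linearP (mderiv j)) /= alongP hp hq.
rewrite mpoly.mderivX alongX derivXn tens_upd linearMn /= mulrnAl scaler_nat.
congr (_ *+ _); rewrite mpX_tens (tensD1 j) mpoly.mnmBE mpoly.mnm1E eqxx subn1.
congr (_ * _); apply: eq_toff => i ij.
by rewrite mpoly.mnmBE mpoly.mnm1E eq_sym (negbTE ij) subn0.
Qed.

Lemma mderiv_tens j (u : 'I_3 -> {poly R}) : mderiv j (tens u) = tens (upd j (u j)^`() u).
Proof. by rewrite mderiv_along along_tens. Qed.

Lemma mderivC i j p :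
  mderiv i (mderiv j p) = mderiv j (mderiv i p).
Proof.
case: (eqVneq i j) => [-> //|ij]; rewrite !mderiv_along; exact: along_comm.
Qed.

Lemma meval_emb (y : 'I_3 -> R) j u : meval y (emb j u) = u.[y j].
Proof.
elim/poly_lin_ind: u => [|a u v hu hv|n].
- by rewrite linear0 horner0 rmorph0.
- by rewrite embP hornerD hornerZ mpoly.mevalD mpoly.mevalZ hu hv.
by rewrite rmorphXn /= rmorphXn /= embX mpoly.mevalXU hornerXn.
Qed.

Lemma meval_tens (y : 'I_3 -> R) (u : 'I_3 -> {poly R}) : meval y (tens u) = \prod_i (u i).[y i].
Proof. by rewrite /tens rmorph_prod /=; apply: eq_bigr => i _; rewrite meval_emb. Qed.

(** The restriction of a polynomial to the line through y parallel to the j-th axis (see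
    [horner_uni]). *)
Definition uni j (y : 'I_3 -> R) : P3 -> {poly R} :=
  mext (fun m => (\prod_(i < 3 | i != j) y i ^+ m i) *: 'X^(m j)).
HB.instance Definition _ j y := GRing.Linear.on (uni j y).

Lemma uniP j y a p q : uni j y (a *: p + q) = a *: uni j y p + uni j y q.
Proof. exact: linearP. Qed.

Lemma uni_along j y (L : {linear {poly R} -> {poly R}}) p :
  uni j y (along j L p) = L (uni j y p).
Proof.
elim/mpoly_lin_ind: p => [|a p q hp hq|m]; first by rewrite !linear0.
  by rewrite alongP !uniP (linearP L) hp hq.
rewrite {2}/uni mextX alongX linearZ /=; move: (L _) => v.
elim/poly_lin_ind: v => [|a u v hu hv|n].
- by rewrite scaler0 tens_upd linear0 mul0r linear0.
- by rewrite tens_updP uniP hu hv scalerDr !scalerA mulrC.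
rewrite (_ : tens _ = mpX (mon (upd j n m))); last first.
  by rewrite mpX_mon; apply: eq_tens => i; rewrite /upd; case: eqP.
rewrite /uni mextX monE upd_eq; congr (_ *: _); apply: eq_bigr => i ij.
by rewrite monE upd_neq.
Qed.

Lemma horner_uni j y p c : (uni j y p).[c] = meval (upd j c y) p.
Proof.
elim/mpoly_lin_ind: p => [|a p q hp hq|m]; first by rewrite !linear0 horner0 ?rmorph0.
  by rewrite uniP hornerD hornerZ mpoly.mevalD mpoly.mevalZ hp hq.
rewrite /uni mextX hornerZ hornerXn mpoly.mevalX [RHS](bigD1 j) //= upd_eq mulrC.
by congr (_ * _); apply: eq_bigr => i ij; rewrite upd_neq.
Qed.

Lemma meval_ext (y z : 'I_3 -> R) p : y =1 z -> meval y p = meval z p.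
Proof. exact: mpoly.meval_eq. Qed.

Lemma meval_uni j y p : meval y p = (uni j y p).[y j].
Proof.
by rewrite horner_uni; apply: meval_ext => i; rewrite /upd; case: eqP => [->|].
Qed.

Lemma meval_along j y (L : {linear {poly R} -> {poly R}}) p :
  meval y (along j L p) = (L (uni j y p)).[y j].
Proof. by rewrite (meval_uni j) uni_along. Qed.

(** In characteristic zero the natural numbers supply more roots than the degree allows. *)
Lemma poly_ext (u v : {poly R}) : (forall c, u.[c] = v.[c]) -> u = v.
Proof.
move=> h; apply/eqP; rewrite -subr_eq0; apply/eqP.
apply: (@roots_geq_poly_eq0 _ _ [seq n%:R | n <- iota 0 (size (u - v))]).
- by apply/allP => _ /mapP[i _ ->]; rewrite rootE hornerD hornerN h subrr.
- by rewrite map_inj_uniq ?iota_uniq // => x y /eqP; rewrite eqr_nat => /eqP.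
- by rewrite size_map size_iota.
Qed.
End MonomialExtension.

(** * Products of univariate functionals *)

Section TensorFunctionals.
Variable R : realFieldType.
Local Notation P3 := (mpoly.mpoly 3 R).
Local Notation fnl := {scalar {poly R}}.
Implicit Types (p q : P3) (i j : 'I_3) (l : 'I_3 -> fnl).

Lemma ord3 i : [\/ i = 0, i = 1 | i = 2].
Proof.
by case: i => [[|[|[|]]]] hi //; [constructor 1|constructor 2|constructor 3]; exact: val_inj.
Qed.

Lemma prod3 (A : comNzRingType) (F : 'I_3 -> A) : \prod_i F i = F 0 * (F 1 * F 2).
Proof.
rewrite !big_ord_recl big_ord0 mulr1; congr (F _ * (F _ * F _)); exact: val_inj.
Qed.

Lemma sum3 (A : nmodType) (F : 'I_3 -> A) : \sum_i F i = F 0 + (F 1 + F 2).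
Proof.
rewrite !big_ord_recl big_ord0 addr0; congr (F _ + (F _ + F _)); exact: val_inj.
Qed.

Lemma tensM (u v : 'I_3 -> {poly R}) : tens u * tens v = tens (fun i => u i * v i).
Proof. by rewrite /tens -big_split /=; apply: eq_bigr => i _; rewrite rmorphM. Qed.

Lemma upd_id (A : Type) j (f : 'I_3 -> A) : upd j (f j) f =1 f.
Proof. by move=> i; rewrite /upd; case: eqP => [->|]. Qed.

(** The tensor product of three functionals. Point values and integrals over edges, faces and cells
    are all of this form. *)
Definition T3 l : P3 -> R := @mext R R^o (fun m => \prod_i l i 'X^(m i)).
Lemma T3_is_linear l : scalar (T3 l).
Proof. exact: (@mext_is_linear R R^o). Qed.
HB.instance Definition _ l := GRing.isLinear.Build R P3 R _ (T3 l) (T3_is_linear l).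

Lemma T3P l a p q : T3 l (a *: p + q) = a * T3 l p + T3 l q.
Proof. exact: linearP. Qed.

Lemma T3X l (m : mon3) : T3 l (mpX m) = \prod_i l i 'X^(m i).
Proof. exact: (@mextX R R^o). Qed.

Lemma T3_tens l (u : 'I_3 -> {poly R}) : T3 l (tens u) = \prod_i l i (u i).
Proof.
(* One factor is freed at a time: an identity known for every power of X in place j holds for every
   polynomial there, by linearity. *)
have step j (w : 'I_3 -> {poly R}) :
    (forall n, T3 l (tens (upd j 'X^n w)) = \prod_i l i (upd j 'X^n w i)) ->
    forall v, T3 l (tens (upd j v w)) = \prod_i l i (upd j v w i).
  have prodE (z : {poly R}) :
      \prod_i l i (upd j z w i) = l j z * \prod_(i < 3 | i != j) l i (w i).
    rewrite (bigD1 j) //= upd_eq; congr (_ * _).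
    by apply: eq_bigr => i ij; rewrite upd_neq.
  move=> h; elim/poly_lin_ind => [|a v v' hv hv'|n]; last exact: h.
    by rewrite tens_upd linear0 mul0r linear0 prodE linear0 mul0r.
  by rewrite tens_updP T3P hv hv' !prodE linearP mulrDl mulrA.
have h2 n0 n1 v2 : T3 l (tens (upd 2 v2 (upd 0 'X^n0 (upd 1 'X^n1 (fun=> 1))))) =
    \prod_i l i (upd 2 v2 (upd 0 'X^n0 (upd 1 'X^n1 (fun=> 1))) i).
  apply: step => n2; pose n i := nth 0%N [:: n0; n1; n2] (i : 'I_3).
  rewrite (_ : tens _ = mpX (mon n)).
    rewrite T3X; apply: eq_bigr => i _; rewrite monE; congr (l i _).
    by case: (ord3 i) => ->.
  by rewrite mpX_mon; apply: eq_tens => i; case: (ord3 i) => ->.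
have h1 n0 v1 v2 : T3 l (tens (upd 1 v1 (upd 0 'X^n0 (upd 2 v2 (fun=> 1))))) =
    \prod_i l i (upd 1 v1 (upd 0 'X^n0 (upd 2 v2 (fun=> 1))) i).
  apply: step => n1; have := h2 n0 n1 v2; set f := upd 2 _ _; set g := upd 1 _ _.
  have fg : f =1 g by move=> i; case: (ord3 i) => ->.
  by rewrite (eq_tens fg) => ->; apply: eq_bigr => i _; rewrite fg.
have h0 v0 v1 v2 : T3 l (tens (upd 0 v0 (upd 1 v1 (upd 2 v2 (fun=> 1))))) =
    \prod_i l i (upd 0 v0 (upd 1 v1 (upd 2 v2 (fun=> 1))) i).
  apply: step => n0; have := h1 n0 v1 v2; set f := upd 1 _ _; set g := upd 0 _ _.
  have fg : f =1 g by move=> i; case: (ord3 i) => ->.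
  by rewrite (eq_tens fg) => ->; apply: eq_bigr => i _; rewrite fg.
have := h0 (u 0) (u 1) (u 2); set g := upd 0 _ _.
have fg : g =1 u by move=> i; case: (ord3 i) => ->.
by rewrite (eq_tens fg) => ->; apply: eq_bigr => i _; rewrite fg.
Qed.

Lemma eq_T3 l l' p : (forall i u, l i u = l' i u) -> T3 l p = T3 l' p.
Proof.
move=> h; rewrite /T3 /mext; apply: eq_bigr => m _.
by rewrite (eq_bigr _ (fun i _ => h i _)).
Qed.

Definition fcomp (f : fnl) (L : {linear {poly R} -> {poly R}}) (u : {poly R}) : R := f (L u).
Lemma fcomp_is_linear f L : scalar (fcomp f L).
Proof. by move=> a u v; rewrite /fcomp !linearP. Qed.
HB.instance Definition _ f L :=
  GRing.isLinear.Build R {poly R} R _ (fcomp f L) (fcomp_is_linear f L).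

Lemma T3_along l j (L : {linear {poly R} -> {poly R}}) p :
  T3 l (along j L p) = T3 (upd j (fcomp (l j) L : fnl) l) p.
Proof.
elim/mpoly_lin_ind: p => [|a p q hp hq|m]; first by rewrite !linear0.
  by rewrite alongP !T3P hp hq.
rewrite mpX_tens along_tens !T3_tens; apply: eq_bigr => i _.
by rewrite /upd; case: eqP => [->|].
Qed.

(** * Degrees *)

Definition deg_lt (n : 'I_3 -> nat) p :=
  forall m, m \in msupp p -> forall i, (m i < n i)%N.

Lemma deg_lt0 n : deg_lt n 0.
Proof. by move=> m; rewrite mpoly.mcoeff_msupp mpoly.mcoeff0 eqxx. Qed.

Lemma deg_ltP n a p q : deg_lt n p -> deg_lt n q -> deg_lt n (a *: p + q).
Proof.
move=> hp hq m; rewrite mpoly.mcoeff_msupp mpoly.mcoeffD mpoly.mcoeffZ => h.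
case: (boolP (m \in msupp p)) => [/hp //|/mpoly.memN_msupp_eq0 h0].
by apply: hq; rewrite mpoly.mcoeff_msupp; move: h; rewrite h0 mulr0 add0r.
Qed.

Lemma deg_ltD n p q : deg_lt n p -> deg_lt n q -> deg_lt n (p + q).
Proof. by move=> hp hq; rewrite -[p]scale1r; apply: deg_ltP. Qed.

Lemma deg_ltZ n a p : deg_lt n p -> deg_lt n (a *: p).
Proof. by move=> hp; rewrite -[_ *: _]addr0; apply: deg_ltP => //; exact: deg_lt0. Qed.

Lemma deg_ltN n p : deg_lt n p -> deg_lt n (- p).
Proof. by rewrite -scaleN1r; exact: deg_ltZ. Qed.

Lemma deg_ltB n p q : deg_lt n p -> deg_lt n q -> deg_lt n (p - q).
Proof. by move=> hp hq; apply: deg_ltD => //; exact: deg_ltN. Qed.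

Lemma deg_lt_sum n (I : Type) (r : seq I) (Pr : pred I) (F : I -> P3) :
  (forall x, Pr x -> deg_lt n (F x)) -> deg_lt n (\sum_(x <- r | Pr x) F x).
Proof. by move=> h; elim/big_ind: _ => //; [exact: deg_lt0 | exact: deg_ltD]. Qed.

Lemma deg_ltW n n' p : (forall i, n i <= n' i)%N -> deg_lt n p -> deg_lt n' p.
Proof. by move=> h hp m hm i; apply: leq_trans (hp m hm i) (h i). Qed.

Lemma deg_lt_msize p : deg_lt (fun=> mpoly.mmeasure mpoly.mdeg p) p.
Proof.
move=> m /mpoly.msize_mdeg_lt h i; apply: leq_ltn_trans h.
by rewrite mpoly.mdegE (bigD1 i) //= leq_addr.
Qed.

Lemma deg_lt_emb j (u : {poly R}) m : m \in msupp (emb j u) ->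
  (m j < size u)%N /\ forall i, i != j -> m i = 0%N.
Proof.
rewrite -[u in emb j u]coefK poly_def linear_sum /=.
move=> /mpoly.msupp_sum_le /flattenP[r /mapP[k _ ->]].
rewrite linearZ /= mpoly.mcoeff_msupp mpoly.mcoeffZ embXn mpoly.mcoeffX.
case: (eqVneq _ m) => [<- _|_]; last by rewrite mulr0 eqxx.
rewrite mpoly.mulmnE mpoly.mnm1E eqxx mul1n ltn_ord; split=> // i ij.
by rewrite mpoly.mulmnE mpoly.mnm1E eq_sym (negbTE ij).
Qed.

Lemma deg_lt_tens (n : 'I_3 -> nat) (u : 'I_3 -> {poly R}) :
  (forall i, size (u i) <= n i)%N -> deg_lt n (tens u).
Proof.
move=> h m; rewrite /tens.
have: forall (r : seq 'I_3), uniq r -> m \in msupp (\prod_(i <- r) emb i (u i)) ->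
    forall i, if i \in r then (m i < n i)%N else m i == 0%N.
  move: m => m0 r; elim: r m0 => [|j r IH] m ur; first rewrite big_nil.
    rewrite -mpoly.mpolyX0 mpoly.msuppX inE => /eqP-> i.
    by rewrite mpoly.mnm0E.
  move: ur => /= /andP[jr ur]; rewrite big_cons => /mpoly.msuppM_le.
  move=> /allpairsP[[m1 m2] /= [/deg_lt_emb[h1 h1'] /IH h2 ->]] i.
  rewrite inE mpoly.mnmDE; have := h2 ur i; case: (eqVneq i j) => [->|ij] /=.
    by rewrite (negbTE jr) => /eqP->; rewrite addn0; apply: leq_trans h1 (h j).
  by rewrite h1' // add0n.
move=> /(_ (index_enum 'I_3) (index_enum_uniq _)) h' /h' h'' i.
by have := h'' i; rewrite mem_index_enum.
Qed.

Lemma deg_lt_along (n n' : 'I_3 -> nat) j (L : {linear {poly R} -> {poly R}}) p :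
  (forall u : {poly R}, size u <= n j -> size (L u) <= n' j)%N ->
  (forall i, i != j -> n i <= n' i)%N ->
  deg_lt n p -> deg_lt n' (along j L p).
Proof.
move=> hL hn hp; rewrite /along /mext big_seq; apply: deg_lt_sum => m hm.
apply: deg_ltZ; apply: deg_lt_tens => i; rewrite /upd; case: eqP => [->|/eqP ij].
  by apply: hL; rewrite size_polyXn; exact: hp.
by rewrite size_polyXn; apply: leq_trans (hn i ij); exact: hp.
Qed.

Lemma deg_lt_mderiv (n n' : 'I_3 -> nat) j p :
  (n j <= (n' j).+1)%N -> (forall i, i != j -> n i <= n' i)%N ->
  deg_lt n p -> deg_lt n' (mderiv j p).
Proof.
move=> hj hn; rewrite mderiv_along; apply: deg_lt_along => // u hu.
have [->|nz] := eqVneq u 0; first by rewrite /= deriv0 size_poly0.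
by rewrite -ltnS; apply: leq_trans (leq_trans (lt_size_deriv nz) hu) hj.
Qed.

(** * Separation by tensor products of functionals *)

(** Contraction with the functionals of the two directions other than j; what remains is a
    univariate polynomial in direction j. *)
Definition slice j l : P3 -> {poly R} :=
  mext (fun m => (\prod_(i < 3 | i != j) l i 'X^(m i)) *: 'X^(m j)).

Lemma T3_slice j l (f : fnl) p : T3 (upd j f l) p = f (slice j l p).
Proof.
rewrite /T3 /slice /mext linear_sum; apply: eq_bigr => m _ /=.
rewrite !linearZ /=; congr (_ * _).
rewrite (bigD1 j) //= upd_eq mulrC; congr (_ * _).
by apply: eq_bigr => i ij; rewrite upd_neq.
Qed.

Lemma size_slice j l n p : deg_lt n p -> (size (slice j l p) <= n j)%N.
Proof.
move=> hp; rewrite /slice /mext big_seq; elim/big_ind: _ => [|x y hx hy|m hm].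
- by rewrite size_poly0.
- by apply: leq_trans (size_polyD _ _) _; rewrite geq_max hx.
apply: leq_trans (size_scale_leq _ _) (leq_trans (size_scale_leq _ _) _).
by rewrite size_polyXn; exact: hp.
Qed.

(** Tensor product unisolvence. Factors in S are exchanged for those of e one direction at a time:
    contracting the other two directions leaves a univariate polynomial of bounded size, killed by
    all of S in that direction, hence by e. *)
Lemma T3_sep (S : 'I_3 -> fnl -> Prop) (e : 'I_3 -> fnl) n p :
  deg_lt n p ->
  (forall i (u : {poly R}), (size u <= n i)%N -> (forall f, S i f -> f u = 0) -> e i u = 0) ->
  (forall l, (forall i, S i (l i)) -> T3 l p = 0) -> T3 e p = 0.
Proof.
move=> hp hS h.
have step j l : (forall f, S j f -> T3 (upd j f l) p = 0) -> T3 (upd j (e j) l) p = 0.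
  move=> hf; rewrite T3_slice; apply: hS; first exact: size_slice.
  by move=> f /hf; rewrite T3_slice.
have eqT l l' : l =1 l' -> T3 l p = T3 l' p by move=> ll; apply: eq_T3 => i u; rewrite ll.
rewrite -(eqT (upd 0 (e 0) e)); last exact: upd_id.
apply: (step 0) => f0 S0; rewrite -(eqT (upd 1 (e 1) (upd 0 f0 e))); last first.
  by move=> i; case: (ord3 i) => ->.
apply: (step 1) => f1 S1; rewrite -(eqT (upd 2 (e 2) (upd 1 f1 (upd 0 f0 e)))); last first.
  by move=> i; case: (ord3 i) => ->.
by apply: (step 2) => f2 S2; apply: h => i; case: (ord3 i) => ->.
Qed.

Definition ev (c : R) : fnl := horner_eval c.
Lemma evE c u : ev c u = u.[c]. Proof. by []. Qed.

Lemma T3_meval y p : T3 (fun i => ev (y i)) p = meval y p.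
Proof.
elim/mpoly_lin_ind: p => [|a p q hp hq|m]; first by rewrite !linear0 ?rmorph0.
  by rewrite T3P mpoly.mevalD mpoly.mevalZ hp hq.
by rewrite mpX_tens T3_tens meval_tens; apply: eq_bigr => i _; rewrite evE.
Qed.

(* [s i = Some c] restricts the i-th coordinate to c, [None] leaves it free. *)
Definition on_plane (s : 'I_3 -> option R) (y : 'I_3 -> R) :=
  forall i, match s i with Some c => y i = c | None => True end.

Definition vanish (s : 'I_3 -> option R) p :=
  forall y, on_plane s y -> meval y p = 0.

Lemma T3_vanish s l p : vanish s p ->
  (forall i, match s i with Some c => forall u, l i u = u.[c] | None => True end) ->
  T3 l p = 0.
Proof.
move=> hp hl.
pose S i (f : fnl) := exists c, (forall u, f u = u.[c]) /\
  match s i with Some c' => c = c' | None => True end.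
apply: (T3_sep (S := S) (@deg_lt_msize p)).
- move=> i u _; rewrite /S => h; have := hl i; case: (s i) h => [c|] h; last first.
    move=> _; suff -> : u = 0 by rewrite linear0.
    by apply: poly_ext => c; rewrite horner0; apply: (h (ev c)); exists c.
  by move=> ->; apply: (h (ev c)); exists c.
- move=> f hf.
  have [y hy] : exists y : 'I_3 -> R, forall i, (forall u, f i u = u.[y i]) /\
      match s i with Some c => y i = c | None => True end.
    have [[[y0 h0] [y1 h1]] [y2 h2]] := (hf 0, hf 1, hf 2).
    exists (fun i : 'I_3 => nth 0 [:: y0; y1; y2] i); move=> i.
    by case: (ord3 i) => ->.
  rewrite (@eq_T3 _ (fun i => ev (y i))) => [|i u]; last by have [-> _] := hy i.
  by rewrite T3_meval; apply: hp => i; have [_] := hy i.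
Qed.

(** * Mixed derivatives *)

Definition dif (r : 'I_3 -> nat) p : P3 :=
  iter (r 0) (mderiv 0) (iter (r 1) (mderiv 1) (iter (r 2) (mderiv 2) p)).

Lemma iter_mderivP j n a p q :
  iter n (mderiv j) (a *: p + q) = a *: iter n (mderiv j) p + iter n (mderiv j) q.
Proof. by elim: n => //= n ->; rewrite linearP. Qed.

Lemma dif_is_linear r : linear (dif r).
Proof. by move=> a p q; rewrite /dif !iter_mderivP. Qed.
HB.instance Definition _ r := GRing.isLinear.Build R P3 P3 _ (dif r) (dif_is_linear r).

Lemma difP r a p q : dif r (a *: p + q) = a *: dif r p + dif r q.
Proof. exact: linearP. Qed.

Lemma dif_tens r (u : 'I_3 -> {poly R}) : dif r (tens u) = tens (fun i => (u i)^`(r i)).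
Proof.
have it j n (w : 'I_3 -> {poly R}) :
    iter n (mderiv j) (tens w) = tens (upd j (w j)^`(n) w).
  elim: n => [|n IH] /=; first by apply: eq_tens => i; rewrite upd_id.
  rewrite IH mderiv_tens upd_eq -derivnS; apply: eq_tens => i.
  by rewrite /upd; case: eqP.
by rewrite /dif !it; apply: eq_tens => i; case: (ord3 i) => ->.
Qed.

Lemma dif_along r j (L : {linear {poly R} -> {poly R}}) p : r j = 0%N ->
  dif r (along j L p) = along j L (dif r p).
Proof.
move=> rj; elim/mpoly_lin_ind: p => [|a p q hp hq|m]; first by rewrite !linear0.
  by rewrite !(alongP,difP) hp hq.
rewrite mpX_tens along_tens !dif_tens along_tens; apply: eq_tens => i.
by rewrite /upd; case: eqP => // ->; rewrite rj.
Qed.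

Lemma dif_mderiv r j p : dif r (mderiv j p) = dif (upd j (r j).+1 r) p.
Proof.
elim/mpoly_lin_ind: p => [|a p q hp hq|m]; first by rewrite !(linear0 (mderiv _), linear0 (dif _)).
  by rewrite !(linearP (mderiv _), difP) /= ?difP hp hq.
rewrite mpX_tens mderiv_tens !dif_tens; apply: eq_tens => i.
by rewrite /upd; case: eqP => // ->; rewrite derivSn.
Qed.

Lemma mderiv_dif r j p : mderiv j (dif r p) = dif r (mderiv j p).
Proof.
elim/mpoly_lin_ind: p => [|a p q hp hq|m]; first by rewrite !(linear0 (mderiv _), linear0 (dif _)).
  by rewrite !(linearP (mderiv _), difP) /= ?difP hp hq.
rewrite mpX_tens mderiv_tens !dif_tens mderiv_tens; apply: eq_tens => i.
by rewrite /upd; case: eqP => // ->; rewrite -derivnS -derivSn.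
Qed.

Lemma eq_dif r r' p : r =1 r' -> dif r p = dif r' p.
Proof. by move=> h; rewrite /dif !h. Qed.

Lemma dif0 p : dif (fun=> 0%N) p = p. Proof. by []. Qed.

Definition mulX (n : nat) (u : {poly R}) : {poly R} := u * 'X^n.
Lemma mulX_is_linear n : linear (mulX n).
Proof. by move=> a u v; rewrite /mulX mulrDl scalerAl. Qed.
HB.instance Definition _ n :=
  GRing.isLinear.Build R {poly R} {poly R} _ (mulX n) (mulX_is_linear n).

(** Differentiation and multiplication by a monomial are absorbed by the factors, so a weighted
    moment of a derivative is again a product functional of p. *)
Lemma T3_dif_mul l r (m : mon3) p :
  T3 l (dif r p * mpX m) =
  T3 (fun i => fcomp (l i) (mulX (m i) \o derivn (r i)) : fnl) p.
Proof.
elim/mpoly_lin_ind: p => [|a p q hp hq|k]; first by rewrite (linear0 (dif _)) mul0r !(linear0 (T3 _)).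
  by rewrite difP mulrDl -scalerAl !T3P hp hq.
by rewrite [mpX m]mpX_tens mpX_tens dif_tens tensM !T3_tens.
Qed.
End TensorFunctionals.

(** * Univariate profiles on an interval *)

Section Interval.
Variable R : rcfType.
Implicit Types (u v : {poly R}) (a b c : R) (sm : bool).

Definition prim u : {poly R} :=
  \poly_(n < (size u).+1) (if n is m.+1 then u`_m / m.+1%:R else 0).

Lemma coef_prim u n : (prim u)`_n = if n is m.+1 then u`_m / m.+1%:R else 0.
Proof.
rewrite coef_poly; case: n => [|n]; first by [].
rewrite ltnS; case: (ltnP n (size u)) => // h.
by rewrite (nth_default 0 h) mul0r.
Qed.

Lemma prim_is_linear : linear prim.
Proof.
move=> a u v; apply/polyP => n; rewrite coefD coefZ !coef_prim.
by case: n => [|n]; rewrite ?mulr0 ?addr0 // coefD coefZ mulrDl mulrA.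
Qed.
HB.instance Definition _ := GRing.isLinear.Build R {poly R} {poly R} _ prim prim_is_linear.

Lemma primK u : (prim u)^`() = u.
Proof.
by apply/polyP => n; rewrite coef_deriv coef_prim -[LHS]mulr_natr mulfVK ?pnatr_eq0.
Qed.

Lemma prim_deriv u : prim u^`() = u - u.[0]%:P.
Proof.
apply/polyP => n; rewrite coefB coefC coef_prim horner_coef0.
case: n => [|n]; first by rewrite subrr.
by rewrite subr0 coef_deriv -[_`_n.+1 *+ _]mulr_natr mulfK // pnatr_eq0.
Qed.

Lemma size_prim u : (size (prim u) <= (size u).+1)%N.
Proof. exact: size_poly. Qed.

Definition integ a b u : R := (prim u).[b] - (prim u).[a].
Lemma integ_is_linear a b : scalar (integ a b).
Proof. by move=> c u v; rewrite /integ linearP !hornerD !hornerZ; ring. Qed.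
HB.instance Definition _ a b :=
  GRing.isLinear.Build R {poly R} R _ (integ a b) (integ_is_linear a b).

Lemma integ_deriv a b u : integ a b u^`() = u.[b] - u.[a].
Proof. by rewrite /integ prim_deriv !hornerD !hornerN !hornerC; ring. Qed.

Lemma integ_split a b c u : integ a c u = integ a b u + integ b c u.
Proof. by rewrite /integ; ring. Qed.

Lemma integ_id a u : integ a a u = 0.
Proof. exact: subrr. Qed.

(** The antiderivative is monotone with equal end values, hence constant on the interval;
    subtracting that constant leaves a polynomial with too many roots. *)
Lemma integ_ge0_eq0 a b u : a < b ->
  (forall x, a < x < b -> 0 <= u.[x]) -> integ a b u = 0 -> u = 0.
Proof.
move=> ab upos u0.
have mon : {in `[a, b] &, {homo horner (prim u) : x y / x <= y}}.
  by apply: ler_hornerW => x; rewrite in_itv /= primK => /upos.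
have cst x : a <= x <= b -> (prim u).[x] = (prim u).[a].
  move=> /andP[ax xb]; have ab' := ltW ab.
  have m1 : (prim u).[a] <= (prim u).[x] by apply: mon; rewrite ?in_itv /= ?lexx ?ax ?xb.
  have m2 : (prim u).[x] <= (prim u).[b] by apply: mon; rewrite ?in_itv /= ?lexx ?ax ?xb ?ab'.
  by apply/le_anti; rewrite m1 andbT (le_trans m2) // -subr_le0 -/(integ a b u) u0.
suff -> : u = (prim u - (prim u).[a]%:P)^`().
  suff -> : prim u - (prim u).[a]%:P = 0 by rewrite linear0.
  set w := _ - _; pose N := size w.
  (* Equally spaced points, as many as the size of [w], which is one more than its degree. *)
  apply: (@roots_geq_poly_eq0 _ _ [seq a + (b - a) * (n%:R / N.+1%:R) | n <- iota 0 N]).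
  - apply/allP => x /mapP[n]; rewrite mem_iota add0n => /andP[_ nN] ->.
    rewrite rootE /w hornerD hornerN hornerC cst ?subrr //.
    have N0 : 0 < N.+1%:R :> R by rewrite ltr0n.
    have t0 : 0 <= n%:R / N.+1%:R :> R by rewrite divr_ge0 // ler0n.
    have t1 : n%:R / N.+1%:R <= 1 :> R.
      by rewrite ler_pdivrMr // mul1r ler_nat ltnW // ltnW.
    have ba : 0 <= b - a by rewrite subr_ge0 ltW.
    by rewrite lerDl mulr_ge0 //= -lerBrDl ler_piMr.
  - rewrite map_inj_uniq ?iota_uniq // => n m /addrI /mulfI h.
    have ba0 : b - a != 0 by rewrite subr_eq0 gt_eqF.
    by move: (h ba0) => /divIf h'; apply/eqP; rewrite -(eqr_nat R) h' // pnatr_eq0.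
  - by rewrite size_map size_iota.
by rewrite derivB derivC subr0 primK.
Qed.

Lemma factor2 a b u : a < b -> u.[a] = 0 -> u.[b] = 0 ->
  exists v, u = ('X - a%:P) * ('X - b%:P) * v.
Proof.
move=> ab /eqP /factor_theorem[w ->]; rewrite hornerM hornerXsubC => /eqP.
have ba : (b - a == 0) = false by rewrite subr_eq0 gt_eqF.
rewrite mulf_eq0 ba orbF => /factor_theorem[v ->].
by exists v; ring.
Qed.

Lemma size_factor2 a b v n : (size (('X - a%:P) * ('X - b%:P) * v)%R <= n.+2)%N ->
  (size v <= n)%N.
Proof.
have [->|nz] := eqVneq v 0; first by rewrite size_poly0.
rewrite -mulrA size_monicM ?monicXsubC ?mulf_neq0 ?polyXsubC_eq0 //.
by rewrite size_monicM ?monicXsubC // !size_XsubC.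
Qed.

(** The end conditions give u = ((X - a)(X - b))^d v with v of size at most n, so the moments
    include the integral of u v. Up to the sign (-1)^d this integrand is nonnegative on the
    interval, hence zero. *)
Lemma unisolvent1 a b n d u : a < b -> (d <= 2)%N -> (size u <= n + 2 * d)%N ->
  (forall r, (r < d)%N -> u^`(r).[a] = 0 /\ u^`(r).[b] = 0) ->
  (forall m, (m < n)%N -> integ a b (u * 'X^m) = 0) -> u = 0.
Proof.
move=> ab d2 su end0 mom0; set w := ('X - a%:P) * ('X - b%:P).
have [v uE sv] : exists2 v, u = w ^+ d * v & (size v <= n)%N.
  case: d d2 su end0 => [|[|[|]]] // _ su end0.
  - by exists u; rewrite ?mul1r // -[n]addn0.
  - have [ua ub] := end0 0%N isT; have [v uE] := @factor2 a b u ab ua ub.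
    exists v; first by rewrite expr1.
    by apply: (@size_factor2 a b); rewrite -uE; move: su; rewrite addn2.
  - have [ua ub] := end0 0%N isT; have [v uE] := @factor2 a b u ab ua ub.
    have [] := end0 1%N isT; rewrite derivn1 {1 2}uE !derivM !derivB !derivX !derivC.
    rewrite !(hornerD, hornerM, hornerN, hornerC, hornerX) => e1 e2.
    have ab0 : a - b != 0 by rewrite subr_eq0 lt_eqF.
    have va : v.[a] = 0 by apply: (mulfI ab0); rewrite mulr0 -[RHS]e1; ring.
    have vb : v.[b] = 0 by apply: (mulfI ab0); rewrite mulr0 -[RHS]oppr0 -e2; ring.
    have [v' vE] := factor2 ab va vb; exists v'; first by rewrite uE vE /w; ring.
    apply: (@size_factor2 a b); rewrite -vE; apply: (@size_factor2 a b); rewrite -uE.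
    by move: su; rewrite (_ : n + 2 * 2 = n.+4)%N //; lia.
have uv0 : integ a b (u * v) = 0.
  rewrite -[v in u * v]coefK poly_def mulr_sumr linear_sum big1 // => m _.
  rewrite -scalerAr linearZ /= mom0 ?mulr0 //; exact: leq_trans (ltn_ord m) sv.
have : (-1) ^+ d *: (u * v) = 0.
  apply: (integ_ge0_eq0 ab) => [x /andP[ax xb]|]; last by rewrite linearZ /= uv0 mulr0.
  rewrite uE hornerZ !hornerM horner_exp hornerM !hornerXsubC.
  have -> : (-1) ^+ d * (((x - a) * (x - b)) ^+ d * v.[x] * v.[x])
    = ((x - a) * (b - x)) ^+ d * v.[x] ^+ 2.
    by rewrite mulrA mulrA -exprMn -mulrA -expr2; congr (_ ^+ _ * _); ring.
  by apply: mulr_ge0; rewrite ?sqr_ge0 // exprn_ge0 // mulr_ge0 // subr_ge0 ltW.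
have w0 : w != 0 by rewrite /w mulf_neq0 ?polyXsubC_eq0.
move/eqP; rewrite scaler_eq0 signr_eq0 /= (_ : u * v = w ^+ d * (v * v)); last first.
  by rewrite uE mulrA.
rewrite mulf_eq0 expf_eq0 (negbTE w0) andbF mulf_eq0 orbb => /eqP v0.
by rewrite uE v0 mulr0.
Qed.

(* The mass-one profile by which the homotopy in one direction replaces a
   function: constant when only its antiderivative has to be matched between
   cells, and a bump vanishing at both ends ([sm = true]) when the antiderivative
   has to be C^1. *)
Definition rho (sm : bool) a b : {poly R} :=
  if sm then (6%:R / (b - a) ^+ 3) *: (('X - a%:P) * (b%:P - 'X)) else ((b - a)^-1)%:P.

Lemma rho_end (sm : bool) a b : sm -> (rho sm a b).[a] = 0 /\ (rho sm a b).[b] = 0.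
Proof.
move=> ->; rewrite /rho !hornerZ !hornerM !hornerD !hornerN !hornerX !hornerC.
by split; ring.
Qed.

Lemma size_rho sm a b : (size (rho sm a b) <= (if sm then 3 else 1))%N.
Proof.
rewrite /rho; case: sm; last exact: size_polyC_leq1.
apply: leq_trans (size_scale_leq _ _) _; rewrite -[b%:P - _]opprB mulrN size_polyN.
by rewrite size_monicM ?monicXsubC ?polyXsubC_eq0 // !size_XsubC.
Qed.

Lemma integ_rho sm a b : a < b -> integ a b (rho sm a b) = 1.
Proof.
move=> ab; have h0 : b - a != 0 by rewrite subr_eq0 gt_eqF.
have h6 : 6%:R != 0 :> R by rewrite pnatr_eq0.
have h2 : 2%:R != 0 :> R by rewrite pnatr_eq0.
have h3 : 3%:R != 0 :> R by rewrite pnatr_eq0.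
rewrite /rho; case: sm; last first.
  have -> : ((b - a)^-1)%:P = ((b - a)^-1 *: 'X)^`() by rewrite derivZ derivX alg_polyC.
  by rewrite integ_deriv !hornerZ !hornerX -mulrBr mulVf.
rewrite linearZ /=.
have -> : ('X - a%:P) * (b%:P - 'X) =
    (- 3%:R^-1 *: 'X^3 + (a + b) / 2%:R *: 'X^2 - a * b *: 'X : {poly R})^`().
  apply: poly_ext => x; rewrite derivB derivD !derivZ !derivXn derivX.
  rewrite !(hornerD, hornerM, hornerN, hornerZ, hornerMn, hornerXn, hornerX, hornerC) /=.
  by rewrite expr1; field.
rewrite integ_deriv !(hornerD, hornerN, hornerZ, hornerXn, hornerX); field.
by rewrite h0.
Qed.

(** The mass-one profile makes this antiderivative climb from 0 to 1: linearly for the constant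
    profile, and for the bump as 3 s^2 - 2 s^3 in the rescaled variable, flat at both ends. *)
Definition hat1 sm a b : {poly R} := prim (rho sm a b) - (prim (rho sm a b)).[a]%:P.
Definition hat sm a b (c : bool) : {poly R} := if c then hat1 sm a b else 1 - hat1 sm a b.

Lemma hat1_end sm a b : a < b -> (hat1 sm a b).[a] = 0 /\ (hat1 sm a b).[b] = 1.
Proof.
move=> ab; rewrite /hat1 !hornerD !hornerN !hornerC subrr; split=> //.
by rewrite -[RHS](integ_rho sm ab).
Qed.

Lemma deriv_hat sm a b (c : bool) :
  (hat sm a b c)^`() = if c then rho sm a b else - rho sm a b.
Proof.
case: c; rewrite /hat /hat1 !derivB !derivC primK subr0 //.
by rewrite sub0r.
Qed.

Lemma size_hat sm a b (c : bool) : (size (hat sm a b c) <= (if sm then 4 else 2))%N.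
Proof.
have h1 : (size (hat1 sm a b) <= (if sm then 4 else 2))%N.
  apply: leq_trans (size_polyD _ _) _; rewrite size_polyN geq_max.
  apply/andP; split; last by apply: leq_trans (size_polyC_leq1 _) _; case: sm.
  apply: leq_trans (size_prim _) _; have := size_rho sm a b.
  by case: (sm); rewrite -ltnS.
case: c => //=; apply: leq_trans (size_polyD _ _) _; rewrite size_polyN geq_max h1.
by rewrite size_poly1; case: sm {h1}.
Qed.

(** The chain homotopy of an interval. Removing the mass of u, placed on [rho], makes the
    antiderivative vanish at both ends, so that it matches across cells by itself. *)
Definition kap sm a b u : {poly R} :=
  let g := u - integ a b u *: rho sm a b in prim g - (prim g).[a]%:P.

Lemma kap_is_linear sm a b : linear (kap sm a b).
Proof.
move=> c u v; rewrite /kap /=.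
set g := (X in prim X); set gu := u - _; set gv := v - _.
have -> : g = c *: gu + gv.
  by rewrite /g /gu /gv linearP /= -!mul_polyC polyCD polyCM; ring.
by rewrite linearP /= hornerD hornerZ polyCD polyCM -!mul_polyC; ring.
Qed.
HB.instance Definition _ sm a b :=
  GRing.isLinear.Build R {poly R} {poly R} _ (kap sm a b) (kap_is_linear sm a b).

Lemma deriv_kap sm a b u : (kap sm a b u)^`() = u - integ a b u *: rho sm a b.
Proof. by rewrite /kap derivB derivC subr0 primK. Qed.

Lemma kap_end sm a b u : a < b -> (kap sm a b u).[a] = 0 /\ (kap sm a b u).[b] = 0.
Proof.
move=> ab; rewrite /kap !hornerD !hornerN !hornerC subrr; split=> //.
set g := u - _; suff : integ a b g = 0 by [].
by rewrite /g linearB linearZ /= integ_rho // mulr1 subrr.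
Qed.

Lemma kap_deriv sm a b u :
  kap sm a b u^`() = u - (u.[a] *: hat sm a b false + u.[b] *: hat sm a b true).
Proof.
rewrite /kap /= integ_deriv linearB linearZ /= prim_deriv.
rewrite /hat /hat1 !hornerD !hornerN !hornerZ !hornerC -!mul_polyC.
rewrite !(polyCD, polyCN, polyCM); ring.
Qed.

Lemma size_kap sm a b u n : (size u <= n)%N -> ((if sm then 3 else 1) <= n)%N ->
  (size (kap sm a b u) <= n.+1)%N.
Proof.
move=> su sn; rewrite /kap /=; apply: leq_trans (size_polyD _ _) _.
rewrite size_polyN geq_max (leq_trans (size_polyC_leq1 _)) // andbT.
apply: leq_trans (size_prim _) _; rewrite ltnS.
apply: leq_trans (size_polyD _ _) _; rewrite size_polyN geq_max su /=.
apply: leq_trans (size_scale_leq _ _) (leq_trans (size_rho sm a b) sn).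
Qed.
End Interval.

(** * Integrals over subcells as product functionals *)

Section Integrals.
Variable R : realType.
Implicit Types (T : cuboid R) (u : {poly R}) (p : poly3 R).

Lemma Rintegral_horner u (a b : R) : a < b ->
  \int[lebesgue_measure]_(x in `[a, b]) u.[x] = integ a b u.
Proof.
move=> ab; rewrite /Rintegral.
rewrite (@continuous_FTC2 _ (fun x => u.[x]) (fun x => (prim u).[x])) //.
- by apply: continuous_subspaceT => x; exact: continuous_horner.
- split; first by move=> x _; exact: derivable_horner.
  + exact/cvg_at_right_filter/continuous_horner.
  + exact/cvg_at_left_filter/continuous_horner.
- by move=> x _; rewrite -derivE primK.
Qed.

Definition sfun T (s : 'I_3 -> option bool) (i : 'I_3) : {scalar {poly R}} :=
  match s i with
  | None => integ (lo T i) (hi T i)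
  | Some b => ev (endpoint T i b)
  end.

Lemma integral_dirE T s i u : integral_dir T s i (fun x => u.[x]) = sfun T s i u.
Proof.
rewrite /integral_dir /sfun; case: (s i) => [b|] //.
by rewrite Rintegral_horner ?lo_lt_hi.
Qed.

Lemma subcell_integralE T s p : subcell_integral T s p = T3 (sfun T s) p.
Proof.
pose mm := msupp p; pose c m := mcoeff m p; pose F := sfun T s.
have e2 x y : integral_dir T s 2 (fun z =>
    meval (fun i : 'I_3 => nth 0 [:: x; y; z] i) p) =
    \sum_(m <- mm) c m * x ^+ (m 0) * y ^+ (m 1) * F 2 'X^(m 2).
  rewrite (_ : (fun z => _) = (fun z => (\sum_(m <- mm) (c m * x ^+ m 0 * y ^+ m 1) *: 'X^(m 2)).[z])).
    by rewrite integral_dirE linear_sum; apply: eq_bigr => m _; rewrite linearZ.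
  apply/funext => z; rewrite {1}[p]mpoly.mpolyE rmorph_sum horner_sum; apply: eq_bigr => m _.
  rewrite /= mpoly.mevalZ hornerZ hornerXn mpoly.mevalX prod3 /= -/(c m).
  by rewrite !mulrA.
have e1 x : integral_dir T s 1 (fun y => integral_dir T s 2 (fun z =>
    meval (fun i : 'I_3 => nth 0 [:: x; y; z] i) p)) =
    \sum_(m <- mm) c m * x ^+ (m 0) * F 1 'X^(m 1) * F 2 'X^(m 2).
  rewrite (_ : (fun y => _) = (fun y => (\sum_(m <- mm) (c m * x ^+ m 0 * F 2 'X^(m 2)) *: 'X^(m 1)).[y])).
    rewrite integral_dirE linear_sum; apply: eq_bigr => m _; rewrite linearZ /=.
    by rewrite mulrAC.
  apply/funext => y; rewrite e2 horner_sum; apply: eq_bigr => m _.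
  by rewrite hornerZ hornerXn mulrAC.
rewrite /subcell_integral.
rewrite (_ : (fun x => _) = (fun x => (\sum_(m <- mm) (c m * F 1 'X^(m 1) * F 2 'X^(m 2)) *: 'X^(m 0)).[x])).
  rewrite integral_dirE linear_sum /T3 /mext; apply: eq_bigr => m _.
  rewrite linearZ /= prod3.
  by rewrite -/F -[RHS]/(c m * (_ * (_ * _))); ring.
apply/funext => x; rewrite e1 horner_sum; apply: eq_bigr => m _.
by rewrite hornerZ hornerXn; ring.
Qed.

(** The affine hull of [subcell T s], in the format of [vanish]. A polynomial is zero on the subcell
    exactly when it is zero on this hull. *)
Definition plane T (s : 'I_3 -> option bool) (i : 'I_3) : option R :=
  match s i with Some b => Some (endpoint T i b) | None => None end.

Lemma subcell_integral_vanish T s p : vanish (plane T s) p -> subcell_integral T s p = 0.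
Proof.
move=> h; rewrite subcell_integralE; apply: T3_vanish h _ => i.
by rewrite /plane /sfun; case: (s i).
Qed.

Lemma subcell_integralB T s p q :
  subcell_integral T s (p - q) = subcell_integral T s p - subcell_integral T s q.
Proof. by rewrite !subcell_integralE linearB. Qed.

End Integrals.

(** * Geometry of the mesh *)

Section Geometry.
Variable R : realType.
Implicit Types (T : cuboid R) (i : 'I_3) (s : 'I_3 -> option bool).

Lemma exists_pos_min_seq (J : eqType) (f : J -> R) (r : seq J) : (forall j, 0 < f j) ->
  exists2 e : R, 0 < e & forall j, j \in r -> e <= f j.
Proof.
move=> h; elim: r => [|x r [e e0 he]]; first by exists 1.
exists (Order.min e (f x)); first by rewrite lt_min e0 h.
by move=> j; rewrite inE ge_min => /orP[/eqP->|/he->//]; rewrite lexx orbT.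
Qed.

Lemma exists_pos_min (J : finType) (f : J -> R) : (forall j, 0 < f j) ->
  exists2 e : R, 0 < e & forall j, e <= f j.
Proof.
move=> h; have [e e0 he] := exists_pos_min_seq (enum J) h.
by exists e => // j; apply: he; rewrite mem_enum.
Qed.

Definition corner T s (c : bool) : pt3 R :=
  \row_i endpoint T i (if s i is Some b then b else c).

Lemma endpoint_itv T i b : lo T i <= endpoint T i b <= hi T i.
Proof. by rewrite /endpoint; case: b; rewrite lexx ?andbT (ltW (lo_lt_hi T i)). Qed.

Lemma corner_subcell T s c : subcell T s (corner T s c).
Proof. by move=> i; rewrite mxE; case: (s i) => [b //|]; exact: endpoint_itv. Qed.

Lemma subcell_cell T s : subcell T s `<=` cell T.
Proof.
move=> x h i; have := h i; case: (s i) => [b ->|//]; exact: endpoint_itv.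
Qed.

Lemma subcell_refine T s s' : (forall i b, s i = Some b -> s' i = Some b) ->
  subcell T s' `<=` subcell T s.
Proof.
move=> h x hx i; have := hx i; case E: (s i) => [b|]; first by rewrite (h _ _ E).
by case: (s' i) => [b ->|//]; exact: endpoint_itv.
Qed.

(** The two opposite corners of the smaller subcell differ in the i-th coordinate, so that
    coordinate cannot be fixed in the larger one. *)
Lemma subcell_sub_free T T' s s' i : subcell T s `<=` subcell T' s' -> s i = None ->
  [/\ s' i = None, lo T' i <= lo T i & hi T i <= hi T' i].
Proof.
move=> h si; have := h _ (corner_subcell T s false) i; have := h _ (corner_subcell T s true) i.
rewrite !mxE si /endpoint; case: (s' i) => [b <- e|/andP[_ ->] /andP[-> _] //].
by have := lo_lt_hi T i; rewrite e ltxx.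
Qed.

Lemma interior_cell T (x : pt3 R) :
  (forall i, lo T i < x 0 i < hi T i) -> (cell T)^° x.
Proof.
move=> h.
have [e e0 he] : exists2 e : R, 0 < e & forall i, e <= Order.min (x 0 i - lo T i) (hi T i - x 0 i).
  by apply: exists_pos_min => i; have /andP[a b] := h i; rewrite lt_min !subr_gt0 a.
apply/nbhs_ballP; exists e => // y xy i.
have := xy.2 0 i; rewrite /ball /= => /ltr_normlP[]; have := he i; rewrite le_min => /andP[].
by move=> h1 h2 h3 h4; apply/andP; split; lra.
Qed.

Variables (I : finType) (Omega : set (pt3 R)) (M : I -> cuboid R).
Hypothesis hM : cuboid_mesh Omega M.

(** The midpoint of the overlap would be interior to both cells. *)
Lemma overlap_eq t t' :
  (forall i, Order.max (lo (M t) i) (lo (M t') i) < Order.min (hi (M t) i) (hi (M t') i)) ->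
  t = t'.
Proof.
move=> h; apply/eqP; apply/negP => /negP tt'.
pose l i := Order.max (lo (M t) i) (lo (M t') i).
pose u i := Order.min (hi (M t) i) (hi (M t') i).
pose x : pt3 R := \row_i ((l i + u i) / 2).
have : ((cell (M t))^° `&` (cell (M t'))^°) x.
  split; apply: interior_cell => i; rewrite mxE; have := h i; rewrite -/(l i) -/(u i);
    have [] : lo (M t) i <= l i /\ lo (M t') i <= l i by rewrite /l !le_max !lexx orbT.
  - have [] : u i <= hi (M t) i /\ u i <= hi (M t') i by rewrite /u !ge_min !lexx orbT.
    by move=> *; lra.
  - have [] : u i <= hi (M t) i /\ u i <= hi (M t') i by rewrite /u !ge_min !lexx orbT.
    by move=> *; lra.
by rewrite (mesh_disjoint hM tt').
Qed.

Lemma meet_subcell t t' : t != t' -> cell (M t) `&` cell (M t') !=set0 ->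
  exists s s', cell (M t) `&` cell (M t') = subcell (M t) s /\
               cell (M t) `&` cell (M t') = subcell (M t') s'.
Proof.
move=> tt' [x hx]; have [e|//] := mesh_face_to_face hM tt'.
by have : set0 x by rewrite -e.
Qed.

(** The intersection of the two cells is a subcell of each. In its free directions both cells have
    the same interval; in its fixed directions the common coordinate is an end of both. *)
Lemma subcell_match t t' s : subcell (M t) s `<=` cell (M t') ->
  forall i, match s i with
            | None => lo (M t) i = lo (M t') i /\ hi (M t) i = hi (M t') i
            | Some b => exists b', endpoint (M t) i b = endpoint (M t') i b'
            end.
Proof.
case: (eqVneq t t') => [-> _ i|tt' h i]; first by case: (s i) => [b|] //; exists b.
have [|s0 [s1 [e0 e1]]] := @meet_subcell t t' tt'.
  exists (corner (M t) s false); split; last exact/h/corner_subcell.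
  exact/subcell_cell/corner_subcell.
have e01 : subcell (M t) s0 = subcell (M t') s1 by rewrite -e0 -e1.
have sub01 : subcell (M t) s0 `<=` subcell (M t') s1 by rewrite e01.
have sub10 : subcell (M t') s1 `<=` subcell (M t) s0 by rewrite e01.
have hs : subcell (M t) s `<=` subcell (M t) s0.
  by rewrite -e0 => x hx; split; [exact/subcell_cell/hx | exact: h].
have eqI : s0 i = None -> lo (M t) i = lo (M t') i /\ hi (M t) i = hi (M t') i.
  move=> n0; have [n1 l1 h1] := @subcell_sub_free (M t) (M t') s0 s1 i sub01 n0.
  have [_ l2 h2] := @subcell_sub_free (M t') (M t) s1 s0 i sub10 n1.
  by split; apply/le_anti/andP.
case si: (s i) => [b|]; last first.
  by have [/eqI] := subcell_sub_free hs si.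
case n0: (s0 i) => [b0|]; last first.
  by exists b; have [l1 h1] := eqI n0; rewrite /endpoint l1 h1.
have := corner_subcell (M t) s false => /hs; rewrite e01 => /(_ i).
rewrite mxE si; case n1: (s1 i) => [b1|]; first by exists b1.
by have [] := @subcell_sub_free (M t') (M t) s1 s0 i sub10 n1; rewrite n0.
Qed.

Lemma subcell_full t t' s : subcell (M t) s `<=` cell (M t') ->
  (forall i, s i = None) -> t = t'.
Proof.
move=> h n; apply: overlap_eq => i; have := subcell_match h i; rewrite n => -[<- <-].
by rewrite maxxx minxx lo_lt_hi.
Qed.

End Geometry.

(** * Matching across faces and the spaces V(b) *)

Section Continuity.
Variables (R : realType) (I : finType) (Omega : set (pt3 R)) (M : I -> cuboid R).
Hypothesis hM : cuboid_mesh Omega M.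
Variable k : nat.
Implicit Types (v w : I -> poly3 R) (b r : 'I_3 -> nat) (s : 'I_3 -> option bool).

(* [b i] counts the derivatives in direction i, starting from order 0, that are
   matched across the faces normal to direction i. *)
Definition Cont b v : Prop :=
  forall t t' s r, subcell (M t) s `<=` cell (M t') ->
    (forall i, if s i is None then r i = 0%N else is_true (r i < b i)%N) ->
    vanish (plane (M t) s) (dif r (v t) - dif r (v t')).

Definition space b v : Prop := (forall t, deg_lt (fun i => k + b i)%N (v t)) /\ Cont b v.

Lemma on_plane_match t t' s y : subcell (M t) s `<=` cell (M t') ->
  on_plane (plane (M t) s) y -> forall i c, s i = Some c ->
  exists c', y i = endpoint (M t') i c'.
Proof.
move=> sub hy i c si; have := hy i; rewrite /plane si => ->.
by have := subcell_match hM sub i; rewrite si.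
Qed.

Lemma vanish_uni (s : 'I_3 -> option R) (p : poly3 R) i y : vanish s p -> on_plane s y -> s i = None ->
  uni i y p = 0.
Proof.
move=> hp hy si; apply: poly_ext => c; rewrite horner0 horner_uni; apply: hp => j.
by rewrite /upd; case: eqP => [->|_]; [rewrite si | exact: hy].
Qed.

Lemma vanish_along (s : 'I_3 -> option R) (p : poly3 R) i (L : {linear {poly R} -> {poly R}}) :
  vanish s p -> s i = None -> vanish s (along i L p).
Proof.
by move=> hp si y hy; rewrite meval_along (vanish_uni hp) // linear0 horner0.
Qed.

Lemma vanish0 (s : 'I_3 -> option R) : vanish s (0 : poly3 R).
Proof. by move=> y _; rewrite rmorph0. Qed.

Lemma ContP b a v w : Cont b v -> Cont b w -> Cont b (fun t => a *: v t + w t).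
Proof.
move=> hv hw t t' s r sub hr y hy.
have := hv _ _ _ _ sub hr y hy; have := hw _ _ _ _ sub hr y hy.
rewrite !difP !mpoly.mevalB !mpoly.mevalD !mpoly.mevalZ => e1 e2.
by rewrite opprD addrACA -mulrBr e1 e2 mulr0 addr0.
Qed.

Lemma Cont_cst b p : Cont b (fun=> p).
Proof. by move=> t t' s r _ _; rewrite subrr; exact: vanish0. Qed.

Lemma Cont_ext b v w : (forall t, v t = w t) -> Cont b v -> Cont b w.
Proof. by move=> /funext ->. Qed.

Lemma eq_Cont b b' v : b =1 b' -> Cont b v -> Cont b' v.
Proof. by move=> /funext ->. Qed.

Lemma ContW b b' v : (forall i, b' i <= b i)%N -> Cont b v -> Cont b' v.
Proof.
move=> hb hv t t' s r sub hr; apply: hv => // i; have := hr i.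
by case: (s i) => // _ h; exact: leq_trans h (hb i).
Qed.

(** On subcells where direction j is free the derivative is tangential and preserves matching. Where
    j is fixed it consumes one order, unless b' j = 0 and nothing is asked there. *)
Lemma Cont_mderiv j b b' v : (b j <= (b' j).+1)%N -> (forall i, i != j -> b' i <= b i)%N ->
  (b' j < b j)%N \/ b' j = 0%N -> Cont b v -> Cont b' (fun t => mderiv j (v t)).
Proof.
move=> _ hb hbj hv t t' s r sub hr; case sj: (s j) => [c|]; last first.
  rewrite -!mderiv_dif -(linearB (mderiv j)) /= mderiv_along; apply: vanish_along; last by rewrite /plane sj.
  apply: hv => // i; have := hr i; case: (eqVneq i j) => [->|ij]; first by rewrite sj.
  by case: (s i) => // _ h; exact: leq_trans h (hb i ij).
rewrite !dif_mderiv; apply: hv => // i; rewrite /upd; have := hr i.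
case: (eqVneq i j) => [->|ij].
  rewrite sj => h; case: hbj => [h'|h0]; last by move: h; rewrite h0.
  exact: leq_ltn_trans h h'.
by case: (s i) => // _ h; exact: leq_trans h (hb i ij).
Qed.

Lemma spaceP b a v w : space b v -> space b w -> space b (fun t => a *: v t + w t).
Proof. by move=> [dv cv] [dw cw]; split=> [t|]; [exact: deg_ltP | exact: ContP]. Qed.

Lemma space0 b : space b (fun=> 0).
Proof. by split=> [t|]; [exact: deg_lt0 | exact: Cont_cst]. Qed.

Lemma spaceZ b a v : space b v -> space b (fun t => a *: v t).
Proof.
move=> h; have := spaceP a h (space0 b); congr (space _ _); apply/funext => t.
exact: addr0.
Qed.

Lemma spaceD b v w : space b v -> space b w -> space b (fun t => v t + w t).
Proof.
move=> hv hw; have := spaceP 1 hv hw; congr (space _ _); apply/funext => t.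
by rewrite scale1r.
Qed.

Lemma spaceN b v : space b v -> space b (fun t => - v t).
Proof.
move=> h; have := spaceZ (-1) h; congr (space _ _); apply/funext => t.
by rewrite scaleN1r.
Qed.

Lemma spaceB b v w : space b v -> space b w -> space b (fun t => v t - w t).
Proof. by move=> hv hw; apply: spaceD => //; exact: spaceN. Qed.

Lemma eq_space b b' v : b =1 b' -> space b v -> space b' v.
Proof. by move=> /funext ->. Qed.

Lemma space_ext b v w : (forall t, v t = w t) -> space b v -> space b w.
Proof. by move=> /funext ->. Qed.

Lemma space_mderiv j b b' v : b j = (b' j).+1 -> (forall i, i != j -> b i = b' i) ->
  space b v -> space b' (fun t => mderiv j (v t)).
Proof.
move=> hj hb [dv cv]; split=> [t|]; last first.
  by apply: Cont_mderiv cv; rewrite ?hj //; [move=> i ij; rewrite hb | left].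
by apply: deg_lt_mderiv (dv t) => [|i ij]; rewrite ?hj ?addnS ?hb.
Qed.

(** * Degrees of freedom *)

Lemma Cont_moments b r (a : seq ('I_3 * int)) v : Cont b v ->
  (forall i, if i \in unzip1 a then r i = 0%N else is_true (r i < b i)%N) ->
  moments M a (fun t => dif r (v t)).
Proof.
move=> hv hr t t' s hs sub q _; apply/eqP; rewrite -subr_eq0 -subcell_integralB; apply/eqP.
apply: subcell_integral_vanish => y hy; rewrite -mulrBl mpoly.mevalM (hv _ _ _ _ sub) ?mul0r //.
move=> i; have := hr i; have := hs i; case: (s i) => [c [_ h]|[h _]].
  by case: ifP => // /h.
by rewrite (h erefl).
Qed.

Lemma Cont_vertex b r v : Cont b v -> (forall i, r i < b i)%N ->
  vertex_values M (fun t => dif r (v t)).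
Proof.
move=> hv hr t t' c hc; apply/eqP; rewrite -subr_eq0 -mpoly.mevalB; apply/eqP.
apply: (hv t t' (fun i => Some (c i)) r) => //.
  move=> x hx; rewrite (_ : x = vertex (M t) c) //; apply/rowP => i.
  by rewrite mxE; exact: hx.
by move=> i; rewrite /= mxE.
Qed.

(** In a free direction the k - b_i moments complement b_i derivatives at each of the two ends, k +
    b_i conditions in all. The bound 1 in fixed directions leaves only the exponent 0 there. *)
Definition dofs b v s r : Prop := forall t t', subcell (M t) s `<=` cell (M t') ->
  forall m : mon3, (forall i, m i < if s i is None then k - b i else 1)%N ->
  subcell_integral (M t) s (dif r (v t) * mpX m) =
  subcell_integral (M t) s (dif r (v t') * mpX m).

Lemma degree_bound_map (f : 'I_3 -> int) (ds : seq 'I_3) i :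
  degree_bound [seq (d, f d) | d <- ds] i = if i \in ds then f i else 0.
Proof.
rewrite /degree_bound /unzip1 /unzip2 -!map_comp map_id_in //.
case: ifP => ids; last by rewrite nth_default // size_map leqNgt index_mem ids.
by rewrite (nth_map i) ?index_mem //= nth_index.
Qed.

Lemma dofs_moments b v s r (a : seq ('I_3 * int)) (ds : seq 'I_3) :
  moments M a (fun t => dif r (v t)) ->
  a = [seq (d, k%:Z - (b d)%:Z - 1) | d <- ds] ->
  (forall i, s i = None <-> i \in ds) -> dofs b v s r.
Proof.
move=> h ea hs t t' sub m hm; apply: h sub _ _.
  by move=> i; rewrite hs ea /unzip1 -map_comp map_id_in.
move=> m'; rewrite mpoly.msuppX inE => /eqP-> i; rewrite ea degree_bound_map.
have := hm i; have := hs i; case: (s i) => [c [_ h]|[h _]].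
  by case: ifP => [/h //|_]; case: (m i).
by rewrite (h erefl); lia.
Qed.

Lemma dofs_vertex b v s r :
  vertex_values M (fun t => dif r (v t)) -> (forall i, s i <> None) -> dofs b v s r.
Proof.
move=> h hs t t' sub m hm.
pose c i := if s i is Some c then c else true.
have sE i : s i = Some (c i) by have := hs i; rewrite /c; case: (s i).
have -> : mpX m = 1 :> poly3 R.
  rewrite (_ : m = @mpoly.mnm0 3) ?mpoly.mpolyX0 //; apply/mpoly.mnmP => i.
  by rewrite mpoly.mnm0E; have := hm i; rewrite sE; case: (m i).
rewrite !mulr1 !subcell_integralE.
have e p : T3 (sfun (M t) s) p = meval (vertex (M t) c 0) p.
  by rewrite -T3_meval; apply: eq_T3 => i u; rewrite /sfun sE !evE mxE.
rewrite !e; apply: h; apply: sub => i; rewrite sE mxE //.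
Qed.

(** On a common subcell the jump of a derivative is tested, in each free direction, by end
    derivatives and moments; each product of these is a degree of freedom on a subcell of s, hence
    shared. The bound n is separate from k + b for the diagonal of [Gammah], whose larger degree is
    in a direction that is fixed on every subcell where matching is asked. *)
Lemma dofs_Cont b (n : 'I_3 -> nat) v : (forall i, b i <= 2)%N -> (2 <= k)%N ->
  (forall t, deg_lt n (v t)) ->
  (forall s, (forall i, s i <> None -> 0 < b i)%N -> (exists i, s i <> None) ->
     forall i, s i = None -> (n i <= k + b i)%N) ->
  (forall s r, (exists i, s i <> None) ->
     (forall i, if s i is None then r i = 0%N else is_true (r i < b i)%N) -> dofs b v s r) ->
  Cont b v.
Proof.
move=> b2 k2 dv hn H t t' s r sub hr.
have [full|] := pselect (forall i, s i = None).
  by rewrite (subcell_full hM sub full) subrr; exact: vanish0.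
move=> /existsNP fixd y hy; rewrite -linearB; set p := v t - v t'.
have hn' : forall i, s i = None -> (n i <= k + b i)%N.
  apply: (hn s) => // i; have := hr i; case: (s i) => // c h _.
  exact: leq_ltn_trans h.
have -> : meval y (dif r p) = T3 (fun i => fcomp (ev (y i)) (mulX 0 \o derivn (r i)) : {scalar {poly R}}) p.
  have e1 : 1 = mpX (mon (fun=> 0%N)) :> poly3 R.
    by rewrite mpX_mon /tens big1 // => i _; rewrite rmorph1.
  rewrite -T3_meval -[dif r p]mulr1 e1 T3_dif_mul; apply: eq_T3 => i u.
  by rewrite /= /fcomp /= monE.
(* The triple z encodes one factor of a degree of freedom: an end or the whole interval, the order
   of differentiation, and the exponent of the moment. In directions fixed by s it is forced to be
   the given end and order. *)
pose gen i (f : {scalar {poly R}}) (z : option bool * nat * nat) :=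
  (forall c, s i = Some c -> z.1.1 = Some c /\ z.1.2 = r i) /\
  (if z.1.1 is None then z.1.2 = 0%N /\ (z.2 < k - b i)%N else (z.1.2 < b i)%N /\ z.2 = 0%N) /\
  forall u, f u = sfun (M t) (fun=> z.1.1) i (mulX z.2 u^`(z.1.2)).
pose S i f := exists z, gen i f z.
apply: (T3_sep (S := S) (n := n)).
- by apply: deg_ltB; apply: dv.
- move=> i u su hu; case si: (s i) => [c|].
    have ri : (r i < b i)%N by have := hr i; rewrite si.
    have -> : y i = endpoint (M t) i c by have := hy i; rewrite /plane si.
    apply: hu.
    exists (Some c, r i, 0%N); split; first by rewrite si => c' [<-].
    by split.
  suff -> : u = 0 by rewrite linear0.
  have ki : (b i <= k)%N := leq_trans (b2 i) k2.
  apply: (@unisolvent1 _ (lo (M t) i) (hi (M t) i) (k - b i) (b i) u) => //.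
  + exact: lo_lt_hi.
  + by apply: leq_trans su (leq_trans (hn' i si) _); lia.
  + move=> r' r'b; have ends c : (u^`(r')).[endpoint (M t) i c] = 0.
      have := hu (fcomp (ev (endpoint (M t) i c)) (derivn r')); apply.
      exists (Some c, r', 0%N); split; first by rewrite si.
      by split=> // u'; rewrite /= /mulX mulr1.
    by split; [exact: (ends false) | exact: (ends true)].
  + move=> m mb; have := hu (fcomp (integ (lo (M t) i) (hi (M t) i)) (mulX m)); apply.
    by exists (None, 0%N, m); split; rewrite ?si.
- move=> l hl; have [z hz] := choice hl.
  (* The three factors assemble into one degree of freedom on the subcell [s'] of s, so the
     assumption on [dofs] applies. *)
  pose s' i := (z i).1.1; pose r' i := (z i).1.2; pose m' i := (z i).2.
  have -> : T3 l p = T3 (fun i => fcomp (sfun (M t) s' i) (mulX (mon m' i) \o derivn (r' i)) : {scalar {poly R}}) p.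
    by apply: eq_T3 => i u; have [_ [_ ->]] := hz i; rewrite monE.
  rewrite -T3_dif_mul linearB mulrBl linearB /= -!subcell_integralE.
  apply/eqP; rewrite subr_eq0; apply/eqP; apply: (H s' r').
  + case: fixd => i hi; exists i; have [h _] := hz i; case si: (s i) hi h => [c|] // _.
    by move=> /(_ _ erefl)[]; rewrite /s' => ->.
  + by move=> i; have [_ [h _]] := hz i; rewrite /s' /r'; case: (z i).1.1 h => [c|] [].
  + apply: subset_trans sub; apply: subcell_refine => i c si.
    by have [/(_ _ si)[]] := hz i.
  + move=> i; have [_ [h _]] := hz i; rewrite monE /s' /m'.
    by case: (z i).1.1 h => [c|] [] // _ ->.
Qed.
End Continuity.

Lemma distinct_cases i j l : distinct i j l -> forall x, [\/ x = i, x = j | x = l].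
Proof.
move=> h x; move: h; case: (ord3 i) => ->; case: (ord3 j) => ->; case: (ord3 l) => -> //;
  case: (ord3 x) => -> _ //; by [constructor 1 | constructor 2 | constructor 3].
Qed.

Lemma distinct_neq i j l : distinct i j l ->
  [/\ i != j, i != l & j != l] /\ [/\ j != i, l != i & l != j].
Proof.
rewrite /distinct /= !inE andbT negb_or => /andP[/andP[a b] c].
by rewrite ![_ == i]eq_sym [l == j]eq_sym a b c.
Qed.

Lemma distinctE i j l : distinct i j l ->
  ((i == j) = false) * ((i == l) = false) * ((j == l) = false) *
  (((j == i) = false) * ((l == i) = false) * ((l == j) = false)).
Proof. by move=> /distinct_neq[[/negbTE-> /negbTE-> /negbTE->] [/negbTE-> /negbTE-> /negbTE->]]. Qed.

Lemma distinct_swap i j l : distinct i j l -> distinct i l j.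
Proof.
move=> /distinct_neq[[a b c] [a' b' c']].
by rewrite /distinct /= !inE negb_or a b c'.
Qed.

Lemma distinct_exists i j : i != j -> exists l, distinct i j l.
Proof.
case: (ord3 i) => ->; case: (ord3 j) => -> // _; by [exists 0 | exists 1 | exists 2].
Qed.

Lemma distinct_exists2 (i : 'I_3) : exists j l, distinct i j l.
Proof.
by case: (ord3 i) => ->; [exists 1, 2 | exists 0, 2 | exists 0, 1].
Qed.

Lemma lt0P (P : nat -> Prop) : forall n, (n < 0)%N -> P n.
Proof. by []. Qed.

Lemma lt1P (P : nat -> Prop) : P 0%N -> forall n, (n < 1)%N -> P n.
Proof. by move=> h [|n]. Qed.

Lemma lt2P (P : nat -> Prop) : P 0%N -> P 1%N -> forall n, (n < 2)%N -> P n.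
Proof. by move=> h0 h1 [|[|n]]. Qed.

(** * The finite element spaces in terms of the V(b) *)

Section Conversions.
Local Opaque moments vertex_values.
Variables (R : realType) (I : finType) (Omega : set (pt3 R)) (M : I -> cuboid R).
Hypothesis hM : cuboid_mesh Omega M.
Variable k : nat.
Hypothesis k2 : (2 <= k)%N.
Implicit Types (v w : I -> poly3 R) (b : 'I_3 -> nat) (s : 'I_3 -> option bool) (i j l : 'I_3).

Lemma degree_bound3 i j l (A B C : int) : distinct i j l ->
  let a := [:: (i, A); (j, B); (l, C)] in
  [/\ degree_bound a i = A, degree_bound a j = B & degree_bound a l = C].
Proof.
by move=> /distinctE dE; rewrite /degree_bound /= !eqxx !dE.
Qed.

Lemma Q3_deg i j l (A B C : int) (n : 'I_3 -> nat) (p : poly3 R) : distinct i j l ->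
  A + 1 = (n i)%:Z -> B + 1 = (n j)%:Z -> C + 1 = (n l)%:Z ->
  Q [:: (i, A); (j, B); (l, C)] p <-> deg_lt n p.
Proof.
move=> d hA hB hC; have [ei ej el] := degree_bound3 A B C d.
split=> h m hm x; have := h m hm x; case: (distinct_cases d x) => ->.
all: rewrite ?ei ?ej ?el; lia.
Qed.

(** The order of application is that of [with_DD], so that for numerals this is convertible to the
    derivatives in the definitions of the finite element spaces. *)
Definition mixed i j l (ri rj rl : nat) v : I -> poly3 R :=
  iter ri (Defs.D i) (iter rj (Defs.D j) (iter rl (Defs.D l) v)).

Lemma iter_mderiv_dif n j r (p : poly3 R) :
  iter n (mderiv j) (dif r p) = dif (upd j (n + r j)%N r) p.
Proof.
elim: n => [|n IH] /=; first by apply: eq_dif => x; rewrite upd_id.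
rewrite IH mderiv_dif dif_mderiv upd_eq; apply: eq_dif => x.
by rewrite /upd; case: eqP.
Qed.

Lemma mixedE i j l ri rj rl v : distinct i j l ->
  mixed i j l ri rj rl v =
  fun t => dif (fun x => if x == i then ri else if x == j then rj else rl) (v t).
Proof.
move=> d; have it n x w : iter n (Defs.D x) w = fun t => iter n (mderiv x) (w t).
  by elim: n => //= n ->.
apply/funext => t; rewrite /mixed !it -[v t]dif0 !iter_mderiv_dif; apply: eq_dif => x.
have dE := distinctE d.
by case: (distinct_cases d x) => ->; rewrite /upd ?eqxx ?dE ?addn0.
Qed.

Lemma dif_mixed i j l r v : distinct i j l ->
  (fun t => dif r (v t)) = mixed i j l (r i) (r j) (r l) v.
Proof.
move=> d; rewrite (mixedE _ _ _ _ d); apply/funext => t; apply: eq_dif => x.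
have dE := distinctE d.
by case: (distinct_cases d x) => ->; rewrite ?eqxx ?dE.
Qed.

Section Dofs.
Variables (b n : 'I_3 -> nat) (v : I -> poly3 R) (i j l : 'I_3).
Variables (bi bj bl : nat) (ai aj al : int).
Hypothesis d : distinct i j l.
Hypotheses (ebi : b i = bi) (ebj : b j = bj) (ebl : b l = bl).

Lemma dofs_vertex3 ri rj rl : Cont M b v -> (ri < bi)%N -> (rj < bj)%N -> (rl < bl)%N ->
  vertex_values M (mixed i j l ri rj rl v).
Proof.
move=> hv hi hj hl; rewrite (mixedE _ _ _ _ d); apply: Cont_vertex hv _ => x.
have dE := distinctE d.
by case: (distinct_cases d x) => ->; rewrite ?eqxx ?dE
  ?ebi ?ebj ?ebl.
Qed.

Lemma dofs_moments3 ri rj rl (a : seq ('I_3 * int)) : Cont M b v ->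
  (if i \in unzip1 a then ri = 0%N else is_true (ri < bi)%N) ->
  (if j \in unzip1 a then rj = 0%N else is_true (rj < bj)%N) ->
  (if l \in unzip1 a then rl = 0%N else is_true (rl < bl)%N) ->
  moments M a (mixed i j l ri rj rl v).
Proof.
move=> hv hi hj hl; rewrite (mixedE _ _ _ _ d); apply: Cont_moments hv _ => x.
have dE := distinctE d.
case: (distinct_cases d x) => ->.
- by rewrite eqxx ebi; exact: hi.
- by rewrite !dE eqxx ebj; exact: hj.
- by rewrite !dE ebl; exact: hl.
Qed.

(** [dofs_Cont] with subcells sorted by their free directions: vertices, three kinds of edges, three
    kinds of faces. The alternative to the bound on [n i] is the case where only faces normal to i
    carry conditions. *)
Lemma dofs3_Cont : (bi <= 2)%N -> (bj <= 2)%N -> (bl <= 2)%N ->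
  ai = k%:Z - bi%:Z - 1 -> aj = k%:Z - bj%:Z - 1 -> al = k%:Z - bl%:Z - 1 ->
  (forall t, deg_lt n (v t)) ->
  (n i <= k + bi)%N \/ bj = 0%N /\ bl = 0%N -> (n j <= k + bj)%N -> (n l <= k + bl)%N ->
  (forall ri, (ri < bi)%N -> forall rj, (rj < bj)%N -> forall rl, (rl < bl)%N ->
     vertex_values M (mixed i j l ri rj rl v)) ->
  (forall rj, (rj < bj)%N -> forall rl, (rl < bl)%N -> moments M [:: (i, ai)] (mixed i j l 0 rj rl v)) ->
  (forall ri, (ri < bi)%N -> forall rl, (rl < bl)%N -> moments M [:: (j, aj)] (mixed i j l ri 0 rl v)) ->
  (forall ri, (ri < bi)%N -> forall rj, (rj < bj)%N -> moments M [:: (l, al)] (mixed i j l ri rj 0 v)) ->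
  (forall rl, (rl < bl)%N -> moments M [:: (i, ai); (j, aj)] (mixed i j l 0 0 rl v)) ->
  (forall rj, (rj < bj)%N -> moments M [:: (i, ai); (l, al)] (mixed i j l 0 rj 0 v)) ->
  (forall ri, (ri < bi)%N -> moments M [:: (j, aj); (l, al)] (mixed i j l ri 0 0 v)) ->
  Cont M b v.
Proof.
move=> bi2 bj2 bl2 eai eaj eal dv ni nj nl H0 Hi Hj Hl Hij Hil Hjl.
have dE := distinctE d.
apply: (dofs_Cont hM) k2 dv _ _.
- by move=> x; case: (distinct_cases d x) => ->; rewrite ?ebi ?ebj ?ebl.
- move=> s hs [y hy] x sx; case: (distinct_cases d x) sx => -> sx; rewrite ?ebi ?ebj ?ebl //.
  case: ni => // -[bj0 bl0]; case: (distinct_cases d y) hy => -> hy; first by rewrite sx in hy.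
    by have := hs _ hy; rewrite ebj bj0.
  by have := hs _ hy; rewrite ebl bl0.
move=> s r [y hy] hr; have := hr i; have := hr j; have := hr l.
rewrite ebi ebj ebl.
have hx x : x = i \/ x = j \/ x = l by case: (distinct_cases d x) => ->; auto.
case sl: (s l) => [cl|] rl; case sj: (s j) => [cj|] rj; case si: (s i) => [ci|] ri.
- apply: dofs_vertex; first by rewrite (dif_mixed _ _ d); exact: H0.
  by move=> x; case: (hx x) => [->|[->|->]]; rewrite ?si ?sj ?sl.
- apply: (@dofs_moments _ _ _ _ _ _ _ _ [:: (i, ai)] [:: i]).
  + by rewrite (dif_mixed _ _ d) ri; exact: Hi.
  + by rewrite /= ebi eai.
  + by move=> x; case: (hx x) => [->|[->|->]]; rewrite ?si ?sj ?sl !inE ?eqxx ?dE; split.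
- apply: (@dofs_moments _ _ _ _ _ _ _ _ [:: (j, aj)] [:: j]).
  + by rewrite (dif_mixed _ _ d) rj; exact: Hj.
  + by rewrite /= ebj eaj.
  + by move=> x; case: (hx x) => [->|[->|->]]; rewrite ?si ?sj ?sl !inE ?eqxx ?dE; split.
- apply: (@dofs_moments _ _ _ _ _ _ _ _ [:: (i, ai); (j, aj)] [:: i; j]).
  + by rewrite (dif_mixed _ _ d) ri rj; exact: Hij.
  + by rewrite /= ebi eai ebj eaj.
  + by move=> x; case: (hx x) => [->|[->|->]]; rewrite ?si ?sj ?sl !inE ?eqxx ?orbT ?dE; split.
- apply: (@dofs_moments _ _ _ _ _ _ _ _ [:: (l, al)] [:: l]).
  + by rewrite (dif_mixed _ _ d) rl; exact: Hl.
  + by rewrite /= ebl eal.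
  + by move=> x; case: (hx x) => [->|[->|->]]; rewrite ?si ?sj ?sl !inE ?eqxx ?dE; split.
- apply: (@dofs_moments _ _ _ _ _ _ _ _ [:: (i, ai); (l, al)] [:: i; l]).
  + by rewrite (dif_mixed _ _ d) ri rl; exact: Hil.
  + by rewrite /= ebi eai ebl eal.
  + by move=> x; case: (hx x) => [->|[->|->]]; rewrite ?si ?sj ?sl !inE ?eqxx ?orbT ?dE; split.
- apply: (@dofs_moments _ _ _ _ _ _ _ _ [:: (j, aj); (l, al)] [:: j; l]).
  + by rewrite (dif_mixed _ _ d) rj rl; exact: Hjl.
  + by rewrite /= ebj eaj ebl eal.
  + by move=> x; case: (hx x) => [->|[->|->]]; rewrite ?si ?sj ?sl !inE ?eqxx ?orbT ?dE; split.
- by case: hy; case: (hx y) => [->|[->|->]].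
Qed.
End Dofs.

Definition bX i (x : 'I_3) : nat := (2 - (x == i))%N.
Definition bPhi i j (x : 'I_3) : nat := (2 - (x == i) - (x == j))%N.
Definition bGamma i j (x : 'I_3) : nat := ((x == i) + (x == j))%N.

(** The last pair of hypotheses consists of conditions with j and l exchanged; the definition of
    [Xh] provides them through the permutation i, l, j. *)
Lemma space_Xh_comp i j l v : distinct i j l ->
  (forall t, Q [:: (i, k%:Z); (j, k%:Z + 1); (l, k%:Z + 1)] (v t)) ->
  [/\ with_DD j l (vertex_values M) v,
      with_DD j l (moments M [:: (i, k%:Z - 2)]) v,
      with_D l (moments M [:: (j, k%:Z - 3)]) v,
      moments M [:: (j, k%:Z - 3); (l, k%:Z - 3)] v
    & with_D l (moments M [:: (i, k%:Z - 2); (j, k%:Z - 3)]) v] ->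
  [/\ with_D j (moments M [:: (l, k%:Z - 3)]) v
    & with_D j (moments M [:: (i, k%:Z - 2); (l, k%:Z - 3)]) v] ->
  space M k (bX i) v.
Proof.
move=> d hQ [[v1 v2 v3 v4] [i1 i2 i3 i4] [j1 j2] jl [ij1 ij2]] [[l1 l2] [il1 il2]].
have dE := distinctE d.
have ebi : bX i i = 1%N by rewrite /bX eqxx.
have ebj : bX i j = 2%N by rewrite /bX !dE.
have ebl : bX i l = 2%N by rewrite /bX !dE.
have dv t : deg_lt (fun x => k + bX i x)%N (v t).
  by apply: (iffLR (Q3_deg _ d _ _ _)) (hQ t); rewrite ?ebi ?ebj ?ebl; lia.
split; first exact: dv.
apply: (@dofs3_Cont (bX i) (fun x => k + bX i x)%N v i j l 1 2 2
  (k%:Z - 2) (k%:Z - 3) (k%:Z - 3) d ebi ebj ebl isT isT isT _ _ _ dv).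
1-3: lia.
- by left; rewrite ebi.
- by rewrite ebj.
- by rewrite ebl.
- by apply: lt1P; apply: lt2P; apply: lt2P; [exact: v1 | exact: v3 | exact: v2 | exact: v4].
- by apply: lt2P; apply: lt2P; [exact: i1 | exact: i3 | exact: i2 | exact: i4].
- by apply: lt1P; apply: lt2P; [exact: j1 | exact: j2].
- by apply: lt1P; apply: lt2P; [exact: l1 | exact: l2].
- by apply: lt2P; [exact: ij1 | exact: ij2].
- by apply: lt2P; [exact: il1 | exact: il2].
- by apply: lt1P; exact: jl.
Qed.

Lemma XhP u : Xh M k u <-> forall i, space M k (bX i) (fun t => u t 0 i).
Proof.
split=> [h i|h i j l d].
  have [j [l d]] := distinct_exists2 i; have [hq c] := h i j l d.
  apply: (space_Xh_comp d hq c).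
  by have [_ [_ _ c1 _ c2]] := h i l j (distinct_swap d).
have [dv cv] := h i; have dE := distinctE d.
have ebi : bX i i = 1%N by rewrite /bX eqxx.
have ebj : bX i j = 2%N by rewrite /bX !dE.
have ebl : bX i l = 2%N by rewrite /bX !dE.
have V := dofs_vertex3 d ebi ebj ebl cv.
have W := dofs_moments3 d ebi ebj ebl cv.
split; first by move=> t; apply: (iffRL (Q3_deg _ d _ _ _)) (dv t); rewrite ?ebi ?ebj ?ebl; lia.
split; [split|split|split| |split].
- exact: (V 0 0 0)%N.
- exact: (V 0 1 0)%N.
- exact: (V 0 0 1)%N.
- exact: (V 0 1 1)%N.
- by apply: (W 0 0 0)%N; rewrite !inE ?eqxx ?dE.
- by apply: (W 0 1 0)%N; rewrite !inE ?eqxx ?dE.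
- by apply: (W 0 0 1)%N; rewrite !inE ?eqxx ?dE.
- by apply: (W 0 1 1)%N; rewrite !inE ?eqxx ?dE.
- by apply: (W 0 0 0)%N; rewrite !inE ?eqxx ?dE.
- by apply: (W 0 0 1)%N; rewrite !inE ?eqxx ?dE.
- by apply: (W 0 0 0)%N; rewrite !inE ?eqxx ?orbT ?dE.
- by apply: (W 0 0 0)%N; rewrite !inE ?eqxx ?orbT ?dE.
- by apply: (W 0 0 1)%N; rewrite !inE ?eqxx ?orbT ?dE.
Qed.

Lemma bPhiC i j : bPhi i j = bPhi j i.
Proof. by apply/funext => x; rewrite /bPhi subnAC. Qed.

Lemma bGammaC i j : bGamma i j = bGamma j i.
Proof. by apply/funext => x; rewrite /bGamma addnC. Qed.

Definition Phi_diag_dofs i v := forall j l, distinct i j l ->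
  [/\ forall t, Q [:: (i, k%:Z - 1); (j, k%:Z + 1); (l, k%:Z + 1)] (v t),
      with_DD j l (moments M [:: (i, k%:Z - 1)]) v
    & with_D l (moments M [:: (i, k%:Z - 1); (j, k%:Z - 3)]) v].

Lemma Phi_diag i v : Phi_diag_dofs i v <-> space M k (bPhi i i) v.
Proof.
have eb j l : distinct i j l -> [/\ bPhi i i i = 0%N, bPhi i i j = 2%N & bPhi i i l = 2%N].
  move=> d; have dE := distinctE d.
  by rewrite /bPhi eqxx !dE.
split=> [h|[dv cv] j l d].
  have [j [l d]] := distinct_exists2 i; have [ebi ebj ebl] := eb j l d.
  have [hQ [i1 i2 i3 i4] [ij1 ij2]] := h j l d.
  have [_ _ [il1 il2]] := h l j (distinct_swap d).
  have dv t : deg_lt (fun x => k + bPhi i i x)%N (v t).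
    by apply: (iffLR (Q3_deg _ d _ _ _)) (hQ t); rewrite ?ebi ?ebj ?ebl; lia.
  split; first exact: dv.
  apply: (@dofs3_Cont (bPhi i i) (fun x => k + bPhi i i x)%N v i j l 0 2 2
    (k%:Z - 1) (k%:Z - 3) (k%:Z - 3) d ebi ebj ebl isT isT isT _ _ _ dv).
  1-3: lia.
  - by left; rewrite ebi.
  - by rewrite ebj.
  - by rewrite ebl.
  - exact: lt0P.
  - by apply: lt2P; apply: lt2P; [exact: i1 | exact: i3 | exact: i2 | exact: i4].
  - exact: lt0P.
  - exact: lt0P.
  - by apply: lt2P; [exact: ij1 | exact: ij2].
  - by apply: lt2P; [exact: il1 | exact: il2].
  - exact: lt0P.
have [ebi ebj ebl] := eb j l d; have dE := distinctE d.
have W := dofs_moments3 d ebi ebj ebl cv.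
split; [|split|split].
- by move=> t; apply: (iffRL (Q3_deg _ d _ _ _)) (dv t); rewrite ?ebi ?ebj ?ebl; lia.
- by apply: (W 0 0 0)%N; rewrite !inE ?eqxx ?dE.
- by apply: (W 0 1 0)%N; rewrite !inE ?eqxx ?dE.
- by apply: (W 0 0 1)%N; rewrite !inE ?eqxx ?dE.
- by apply: (W 0 1 1)%N; rewrite !inE ?eqxx ?dE.
- by apply: (W 0 0 0)%N; rewrite !inE ?eqxx ?orbT ?dE.
- by apply: (W 0 0 1)%N; rewrite !inE ?eqxx ?orbT ?dE.
Qed.

Definition Phi_off_dofs i j l v :=
  (forall t, Q [:: (i, k%:Z); (j, k%:Z); (l, k%:Z + 1)] (v t)) /\
  [/\ with_D l (vertex_values M) v,
      with_D l (moments M [:: (i, k%:Z - 2)]) v /\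
      with_D l (moments M [:: (j, k%:Z - 2)]) v,
      moments M [:: (l, k%:Z - 3)] v,
      with_D l (moments M [:: (i, k%:Z - 2); (j, k%:Z - 2)]) v
    & moments M [:: (i, k%:Z - 2); (l, k%:Z - 3)] v /\
      moments M [:: (j, k%:Z - 2); (l, k%:Z - 3)] v].

Lemma Phi_off i j l v : distinct i j l -> Phi_off_dofs i j l v <-> space M k (bPhi i j) v.
Proof.
move=> d; have dE := distinctE d.
have ebi : bPhi i j i = 1%N by rewrite /bPhi eqxx !dE.
have ebj : bPhi i j j = 1%N by rewrite /bPhi eqxx !dE.
have ebl : bPhi i j l = 2%N by rewrite /bPhi !dE.
split=> [[hQ [[v1 v2] [[i1 i2] [j1 j2]] l1 [ij1 ij2] [il1 jl1]]]|[dv cv]].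
  have dv t : deg_lt (fun x => k + bPhi i j x)%N (v t).
    by apply: (iffLR (Q3_deg _ d _ _ _)) (hQ t); rewrite ?ebi ?ebj ?ebl; lia.
  split; first exact: dv.
  apply: (@dofs3_Cont (bPhi i j) (fun x => k + bPhi i j x)%N v i j l 1 1 2
    (k%:Z - 2) (k%:Z - 2) (k%:Z - 3) d ebi ebj ebl isT isT isT _ _ _ dv).
  1-3: lia.
  - by left; rewrite ebi.
  - by rewrite ebj.
  - by rewrite ebl.
  - by apply: lt1P; apply: lt1P; apply: lt2P; [exact: v1 | exact: v2].
  - by apply: lt1P; apply: lt2P; [exact: i1 | exact: i2].
  - by apply: lt1P; apply: lt2P; [exact: j1 | exact: j2].
  - by apply: lt1P; apply: lt1P; exact: l1.
  - by apply: lt2P; [exact: ij1 | exact: ij2].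
  - by apply: lt1P; exact: il1.
  - by apply: lt1P; exact: jl1.
have V := dofs_vertex3 d ebi ebj ebl cv.
have W := dofs_moments3 d ebi ebj ebl cv.
split; first by move=> t; apply: (iffRL (Q3_deg _ d _ _ _)) (dv t); rewrite ?ebi ?ebj ?ebl; lia.
split; [split|split; split| |split|split].
- exact: (V 0 0 0)%N.
- exact: (V 0 0 1)%N.
- by apply: (W 0 0 0)%N; rewrite !inE ?eqxx ?dE.
- by apply: (W 0 0 1)%N; rewrite !inE ?eqxx ?dE.
- by apply: (W 0 0 0)%N; rewrite !inE ?eqxx ?dE.
- by apply: (W 0 0 1)%N; rewrite !inE ?eqxx ?dE.
- by apply: (W 0 0 0)%N; rewrite !inE ?eqxx ?dE.
- by apply: (W 0 0 0)%N; rewrite !inE ?eqxx ?orbT ?dE.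
- by apply: (W 0 0 1)%N; rewrite !inE ?eqxx ?orbT ?dE.
- by apply: (W 0 0 0)%N; rewrite !inE ?eqxx ?orbT ?dE.
- by apply: (W 0 0 0)%N; rewrite !inE ?eqxx ?orbT ?dE.
Qed.

Lemma neq_ltn_ord i j : i != j -> (i < j)%N \/ (j < i)%N.
Proof. by rewrite -val_eqE neq_ltn => /orP. Qed.

Lemma PhihP (s : I -> mat3 R) : Phih M k s <->
  (forall t, (s t)^T = s t) /\ forall i j, space M k (bPhi i j) (fun t => s t i j).
Proof.
split=> [[sym hd ho]|[sym h]].
  split=> // i j; case: (eqVneq i j) => [->|ij].
    by apply/Phi_diag => i' l d; exact: hd.
  have key (x y : 'I_3) : x != y -> (x < y)%N -> space M k (bPhi x y) (fun t => s t x y).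
    by move=> xy lt; have [l d] := distinct_exists xy; apply/(Phi_off _ d); exact: ho.
  case: (neq_ltn_ord ij) => lt; first exact: key.
  rewrite bPhiC (_ : (fun t => _) = (fun t => s t j i)).
    by apply: key => //; rewrite eq_sym.
  by apply/funext => t; rewrite -[in LHS](sym t) mxE.
split=> // [i j l d|i j l d lt]; last by apply/(Phi_off _ d).
by have /Phi_diag := h i i; exact.
Qed.

(** On the diagonal of [Gammah] the degree in x_i is below k + 2 while only values are matched. No
    single [space] has this shape, so degree and continuity are kept apart. *)
Definition nGamma i (x : 'I_3) : nat := (k + (x == i) * 2)%N.

Definition Gamma_diag_dofs i v := forall j l, distinct i j l ->
  (forall t, Q [:: (i, k%:Z + 1); (j, k%:Z - 1); (l, k%:Z - 1)] (v t)) /\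
  moments M [:: (j, k%:Z - 1); (l, k%:Z - 1)] v.

Lemma Gamma_diag i v : Gamma_diag_dofs i v <->
  (forall t, deg_lt (nGamma i) (v t)) /\ Cont M (fun x => x == i) v.
Proof.
have eb j l : distinct i j l ->
    [/\ nGamma i i = k.+2, nGamma i j = k & nGamma i l = k] /\
    [/\ nat_of_bool (i == i) = 1%N, nat_of_bool (j == i) = 0%N & nat_of_bool (l == i) = 0%N].
  move=> d; have dE := distinctE d.
  by rewrite /nGamma eqxx !dE addn0 mul1n addn2.
split=> [h|[dv cv] j l d].
  have [j [l d]] := distinct_exists2 i; have [[eni enj enl] [ebi ebj ebl]] := eb j l d.
  have [hQ jl1] := h j l d.
  have dv t : deg_lt (nGamma i) (v t).
    by apply: (iffLR (Q3_deg _ d _ _ _)) (hQ t); rewrite ?eni ?enj ?enl; lia.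
  split; first exact: dv.
  apply: (@dofs3_Cont (fun x => x == i) (nGamma i) v i j l 1 0 0
    (k%:Z - 2) (k%:Z - 1) (k%:Z - 1) d ebi ebj ebl isT isT isT _ _ _ dv).
  1-3: lia.
  - by right.
  - by rewrite enj addn0.
  - by rewrite enl addn0.
  - by apply: lt1P; exact: lt0P.
  - exact: lt0P.
  - by apply: lt1P; exact: lt0P.
  - by apply: lt1P; exact: lt0P.
  - exact: lt0P.
  - exact: lt0P.
  - by apply: lt1P; exact: jl1.
have [[eni enj enl] [ebi ebj ebl]] := eb j l d.
have dE := distinctE d.
have W := dofs_moments3 d ebi ebj ebl cv.
split; first by move=> t; apply: (iffRL (Q3_deg _ d _ _ _)) (dv t); rewrite ?eni ?enj ?enl; lia.
by apply: (W 0 0 0)%N; rewrite !inE ?eqxx ?orbT ?dE.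
Qed.

Definition Gamma_off_dofs i j l v :=
  [/\ forall t, Q [:: (i, k%:Z); (j, k%:Z); (l, k%:Z - 1)] (v t),
      moments M [:: (l, k%:Z - 1)] v,
      moments M [:: (i, k%:Z - 2); (l, k%:Z - 1)] v
    & moments M [:: (j, k%:Z - 2); (l, k%:Z - 1)] v].

Lemma Gamma_off i j l v : distinct i j l ->
  Gamma_off_dofs i j l v <-> space M k (bGamma i j) v.
Proof.
move=> d; have dE := distinctE d.
have ebi : bGamma i j i = 1%N by rewrite /bGamma eqxx !dE.
have ebj : bGamma i j j = 1%N by rewrite /bGamma eqxx !dE.
have ebl : bGamma i j l = 0%N by rewrite /bGamma !dE.
split=> [[hQ l1 il1 jl1]|[dv cv]].
  have dv t : deg_lt (fun x => k + bGamma i j x)%N (v t).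
    by apply: (iffLR (Q3_deg _ d _ _ _)) (hQ t); rewrite ?ebi ?ebj ?ebl; lia.
  split; first exact: dv.
  apply: (@dofs3_Cont (bGamma i j) (fun x => k + bGamma i j x)%N v i j l 1 1 0
    (k%:Z - 2) (k%:Z - 2) (k%:Z - 1) d ebi ebj ebl isT isT isT _ _ _ dv).
  1-3: lia.
  - by left; rewrite ebi.
  - by rewrite ebj.
  - by rewrite ebl.
  - by apply: lt1P; apply: lt1P; exact: lt0P.
  - by apply: lt1P; exact: lt0P.
  - by apply: lt1P; exact: lt0P.
  - by apply: lt1P; apply: lt1P; exact: l1.
  - exact: lt0P.
  - by apply: lt1P; exact: il1.
  - by apply: lt1P; exact: jl1.
have W := dofs_moments3 d ebi ebj ebl cv.
split; first by move=> t; apply: (iffRL (Q3_deg _ d _ _ _)) (dv t); rewrite ?ebi ?ebj ?ebl; lia.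
- by apply: (W 0 0 0)%N; rewrite !inE ?eqxx ?dE.
- by apply: (W 0 0 0)%N; rewrite !inE ?eqxx ?orbT ?dE.
- by apply: (W 0 0 0)%N; rewrite !inE ?eqxx ?orbT ?dE.
Qed.

Lemma GammahP (s : I -> mat3 R) : Gammah M k s <->
  [/\ forall t, (s t)^T = s t,
      forall i, (forall t, deg_lt (nGamma i) (s t i i)) /\
                Cont M (fun x => x == i) (fun t => s t i i)
    & forall i j, i != j -> space M k (bGamma i j) (fun t => s t i j)].
Proof.
split=> [[sym hd ho]|[sym hd h]].
  split=> // [i|i j ij]; first by apply/Gamma_diag => j l d; exact: hd.
  have key (x y : 'I_3) : x != y -> (x < y)%N -> space M k (bGamma x y) (fun t => s t x y).
    by move=> xy lt; have [l d] := distinct_exists xy; apply/(Gamma_off _ d); exact: ho.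
  case: (neq_ltn_ord ij) => lt; first exact: key.
  rewrite bGammaC (_ : (fun t => _) = (fun t => s t j i)).
    by apply: key => //; rewrite eq_sym.
  by apply/funext => t; rewrite -[in LHS](sym t) mxE.
split=> // [i j l d|i j l d lt].
  by have /Gamma_diag := hd i; exact.
apply/(Gamma_off _ d); apply: h.
by have [[]] := distinct_neq d.
Qed.

Lemma ZhP (q : I -> vec3 R) : Zh R I k q <->
  forall i t, deg_lt (fun x => k + (x == i))%N (q t 0 i).
Proof.
have eb i j l : distinct i j l ->
    [/\ nat_of_bool (i == i) = 1%N, nat_of_bool (j == i) = 0%N & nat_of_bool (l == i) = 0%N].
  move=> d; have dE := distinctE d.
  by rewrite eqxx !dE.
split=> h i.
  move=> t; have [j [l d]] := distinct_exists2 i; have [e1 e2 e3] := eb _ _ _ d.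
  by apply: (iffLR (Q3_deg _ d _ _ _)) (h i j l d t); rewrite ?e1 ?e2 ?e3; lia.
move=> j l d t; have [e1 e2 e3] := eb _ _ _ d.
by apply: (iffRL (Q3_deg _ d _ _ _)) (h i t); rewrite ?e1 ?e2 ?e3; lia.
Qed.
End Conversions.

(** * Homotopy onto cubical cochains *)

Section IntervalProjections.
Variable R : rcfType.
Implicit Types (u : {poly R}) (a b : R) (sm rh c : bool).

(* Coordinate functionals and basis of the one-dimensional cochains: the two
   endpoint values with the hat functions, or ([rh = true]) the integral with
   the profile [rho].  In the latter case only [c = true] is used. *)
Definition dual1 rh a b c : {scalar {poly R}} :=
  if rh then (integ a b : {scalar {poly R}}) else ev (if c then b else a).
Definition base1 rh sm a b c : {poly R} :=
  if rh then (if c then rho sm a b else 0) else hat sm a b c.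

Definition proj1 rh sm a b u : {poly R} := \sum_c dual1 rh a b c u *: base1 rh sm a b c.
Lemma proj1_is_linear rh sm a b : linear (proj1 rh sm a b).
Proof.
move=> c u v; rewrite /proj1 scaler_sumr -big_split /=; apply: eq_bigr => d _.
by rewrite linearP scalerDl scalerA.
Qed.
HB.instance Definition _ rh sm a b :=
  GRing.isLinear.Build R {poly R} {poly R} _ (proj1 rh sm a b) (proj1_is_linear rh sm a b).

Lemma proj1_rho sm a b u : proj1 true sm a b u = integ a b u *: rho sm a b.
Proof. by rewrite /proj1 big_bool /= scaler0 addr0. Qed.

Lemma proj1_hat sm a b u :
  proj1 false sm a b u = u.[a] *: hat sm a b false + u.[b] *: hat sm a b true.
Proof. by rewrite /proj1 big_bool /= addrC. Qed.

End IntervalProjections.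

Section Homotopy.
Variables (R : realType) (I : finType) (Omega : set (pt3 R)) (M : I -> cuboid R).
Hypothesis hM : cuboid_mesh Omega M.
Variable k : nat.
Hypothesis k2 : (2 <= k)%N.
Implicit Types (v w : I -> poly3 R) (b : 'I_3 -> nat) (s : 'I_3 -> option bool) (i j l : 'I_3)
  (kind : 'I_3 -> bool) (E : ('I_3 -> bool) -> R) (t : I).

Definition Kop i sm t : poly3 R -> poly3 R := along i (kap sm (lo (M t) i) (hi (M t) i)).
Definition Pop i sm rh t : poly3 R -> poly3 R :=
  along i (proj1 rh sm (lo (M t) i) (hi (M t) i)).
HB.instance Definition _ i sm t := GRing.Linear.on (Kop i sm t).
HB.instance Definition _ i sm rh t := GRing.Linear.on (Pop i sm rh t).

Lemma KopD i sm t p q : Kop i sm t (p + q) = Kop i sm t p + Kop i sm t q.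
Proof. exact: linearD. Qed.

Lemma Kop0 i sm t : Kop i sm t 0 = 0.
Proof. exact: linear0. Qed.

(** With [Kop_mderiv], the homotopy formula in direction i: the projection is onto the profile for
    coefficients that are integrated in direction i, and onto the hats for the others. *)
Lemma mderiv_Kop i sm t p : mderiv i (Kop i sm t p) = p - Pop i sm true t p.
Proof.
rewrite /Kop mderiv_along along_comp -{2}[p](along_id i) -along_sub.
by apply: eq_along => u; rewrite /= deriv_kap proj1_rho.
Qed.

Lemma Kop_mderiv i sm t p : Kop i sm t (mderiv i p) = p - Pop i sm false t p.
Proof.
rewrite /Kop mderiv_along along_comp -{2}[p](along_id i) -along_sub.
by apply: eq_along => u; rewrite /= kap_deriv proj1_hat.
Qed.

Lemma mderivC_Kop i j sm t p : j != i ->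
  mderiv j (Kop i sm t p) = Kop i sm t (mderiv j p).
Proof. by move=> ij; rewrite !mderiv_along along_comm. Qed.

(** The exponents b - e_i of the i-th component of a 1-form; [lower2] is the 2-form analogue, the
    component being named by the direction missing from it. *)
Definition lower b i : 'I_3 -> nat := upd i (b i).-1 b.
Definition lower2 b i : 'I_3 -> nat := fun x => if x == i then b x else (b x).-1.

(** Across faces normal to i the values vanish from both sides. If b_i = 2 the normal derivative
    must match too; it equals v there, because the bump vanishes at the ends. *)
Lemma space_Kop b i v : (b i = 1 \/ b i = 2)%N -> space M k (lower b i) v ->
  space M k b (fun t => Kop i (b i == 2%N) t (v t)).
Proof.
move=> hb [dv cv]; split=> [t|t t' s r sub hr y hy].
  apply: deg_lt_along (dv t) => [u|j ji]; last by rewrite /lower upd_neq.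
  rewrite /lower upd_eq => su.
  have -> : (k + b i = (k + (b i).-1).+1)%N by case: hb => ->; rewrite ?addnS.
  (* The profile must have degree less than k + b_i - 1; for the quadratic bump this is 2 <= k. *)
  apply: size_kap => //; case: hb => -> /=; first by rewrite addn0 ltnW.
  by rewrite addn1 ltnS.
case si: (s i) => [c|]; last first.
  have [e1 e2] : lo (M t) i = lo (M t') i /\ hi (M t) i = hi (M t') i.
    by have := subcell_match hM sub i; rewrite si.
  have ri : r i = 0%N by have := hr i; rewrite si.
  rewrite /Kop -e1 -e2 !dif_along // -linearB.
  apply: (vanish_along (s := plane (M t) s)) => //; last by rewrite /plane si.
  apply: cv => // j; have := hr j; rewrite /lower /upd.
  by case: (eqVneq j i) => [->|//]; rewrite si.
have [c1 yc1] : exists c', y i = endpoint (M t) i c'.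
  by exists c; have := hy i; rewrite /plane si.
have [c2 yc2] := on_plane_match hM sub hy si.
have kend t0 u : (exists c', y i = endpoint (M t0) i c') ->
    (kap (b i == 2%N) (lo (M t0) i) (hi (M t0) i) u).[y i] = 0.
  move=> [c' ->]; have [ha hb'] := kap_end (b i == 2%N) u (lo_lt_hi (M t0) i).
  by rewrite /endpoint; case: c'.
case ri: (r i) => [|n].
  rewrite mpoly.mevalB /Kop !(dif_along _ _ ri) !meval_along.
  by rewrite !kend ?subrr; [|exists c2|exists c1].
have hri := hr i; rewrite si ri in hri.
have b2 : b i = 2%N by case: hb hri => ->.
have n0 : n = 0%N by move: hri; rewrite b2; case: (n).
pose r0 := upd i 0%N r.
have difE t0 p : (exists c', y i = endpoint (M t0) i c') ->
    meval y (dif r (Kop i (b i == 2%N) t0 p)) = meval y (dif r0 p).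
  move=> [c' yc'].
  rewrite (_ : dif r _ = dif r0 (mderiv i (Kop i (b i == 2%N) t0 p))); last first.
    rewrite dif_mderiv; apply: eq_dif => j; rewrite /r0 /upd eqxx.
    by case: (eqVneq j i) => // ->; rewrite ri n0.
  rewrite mderiv_Kop (linearB (dif r0)) /= mpoly.mevalB /Pop dif_along; last by rewrite /r0 upd_eq.
  rewrite meval_along /= proj1_rho hornerZ b2 /=.
  have [ha hb'] := @rho_end R true (lo (M t0) i) (hi (M t0) i) isT.
  by rewrite yc' /endpoint; case: (c'); rewrite ?ha ?hb' mulr0 subr0.
rewrite mpoly.mevalB !difE; [|by exists c2|by exists c1].
rewrite -mpoly.mevalB; apply: (cv t t' s r0) hy => // j.
rewrite /r0 /lower /upd; have := hr j; case: (eqVneq j i) => [->|//].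
by rewrite si b2.
Qed.

(* Cubical cochains as polynomials: coefficients [E] on the subcells extended
   over the cell by the profile in the directions of [kind] and by hat functions
   in the others; [E] is only used where it is [true] in the former directions. *)
Definition bool3 (c0 c1 c2 : bool) (i : 'I_3) : bool := nth false [:: c0; c1; c2] i.

Definition cbase b (kind : 'I_3 -> bool) t (c : 'I_3 -> bool) (i : 'I_3) : {poly R} :=
  base1 (kind i) (b i == 2%N) (lo (M t) i) (hi (M t) i) (c i).

Definition cpoly b kind (E : ('I_3 -> bool) -> R) t : poly3 R :=
  \sum_c0 \sum_c1 \sum_c2 E (bool3 c0 c1 c2) *: tens (cbase b kind t (bool3 c0 c1 c2)).

Definition cdual kind t (c : 'I_3 -> bool) (i : 'I_3) : {scalar {poly R}} :=
  dual1 (kind i) (lo (M t) i) (hi (M t) i) (c i).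

Lemma cpolyB b kind E (E' : ('I_3 -> bool) -> R) t :
  cpoly b kind (fun c => E c - E' c) t = cpoly b kind E t - cpoly b kind E' t.
Proof.
rewrite /cpoly -sumrB; apply: eq_bigr => c0 _; rewrite -sumrB; apply: eq_bigr => c1 _.
by rewrite -sumrB; apply: eq_bigr => c2 _; rewrite scalerBl.
Qed.

Lemma eq_cpoly b kind E (E' : ('I_3 -> bool) -> R) t :
  (forall c : 'I_3 -> bool, (forall i, kind i -> c i) -> E c = E' c) -> cpoly b kind E t = cpoly b kind E' t.
Proof.
move=> h; apply: eq_bigr => c0 _; apply: eq_bigr => c1 _; apply: eq_bigr => c2 _.
set c := bool3 _ _ _; have [/forallP hc|] := boolP [forall i, kind i ==> c i].
  by rewrite h // => i; exact/implyP.
rewrite negb_forall => /existsP[i]; rewrite negb_imply => /andP[ki ci].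
suff -> : tens (cbase b kind t c) = 0 by rewrite !scaler0.
by rewrite (tensD1 i) /cbase /base1 ki (negbTE ci) linear0 mul0r.
Qed.

(** Once projected in all three directions, p is remembered only through its values and integrals on
    the vertices, edges or faces of the cell. *)
Lemma Pop_cpoly b kind t p :
  Pop 0 (b 0 == 2%N) (kind 0) t (Pop 1 (b 1 == 2%N) (kind 1) t
    (Pop 2 (b 2 == 2%N) (kind 2) t p)) = cpoly b kind (fun c => T3 (cdual kind t c) p) t.
Proof.
elim/mpoly_lin_ind: p => [|a p q hp hq|m].
- rewrite !linear0 /cpoly big1 // => c0 _; rewrite big1 // => c1 _; rewrite big1 // => c2 _.
  by rewrite linear0 scale0r.
- rewrite !(linearP (Pop _ _ _ _)) /= hp hq /cpoly scaler_sumr -big_split /=.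
  apply: eq_bigr => c0 _; rewrite scaler_sumr -big_split /=.
  apply: eq_bigr => c1 _; rewrite scaler_sumr -big_split /=.
  by apply: eq_bigr => c2 _; rewrite T3P scalerDl scalerA.
rewrite mpX_tens /Pop !along_tens.
pose F i c := dual1 (kind i) (lo (M t) i) (hi (M t) i) c ('X^(m i)).
pose G i c := base1 (kind i) (b i == 2%N) (lo (M t) i) (hi (M t) i) c.
rewrite (@eq_tens _ _ (fun i => \sum_c F i c *: G i c)); last first.
  by move=> i; case: (ord3 i) => ->.
have -> : tens (fun i => \sum_c F i c *: G i c) = \sum_c0 \sum_c1 \sum_c2
    (F 0 c0 * (F 1 c1 * F 2 c2)) *: (emb 0 (G 0 c0) * (emb 1 (G 1 c1) * emb 2 (G 2 c2))).
  rewrite /tens prod3 !linear_sum mulr_suml; apply: eq_bigr => c0 _.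
  rewrite mulr_suml mulr_sumr; apply: eq_bigr => c1 _.
  rewrite mulr_sumr mulr_sumr; apply: eq_bigr => c2 _.
  by rewrite !linearZ /= -!mpoly.mul_mpolyC !mpoly.mpolyCM; ring.
rewrite /cpoly; apply: eq_bigr => c0 _; apply: eq_bigr => c1 _; apply: eq_bigr => c2 _.
by rewrite T3_tens prod3 /tens prod3.
Qed.

Lemma upd_bool3 i (c c0 c1 c2 : bool) : upd i c (bool3 c0 c1 c2) =
  bool3 (if i == 0 then c else c0) (if i == 1 then c else c1) (if i == 2 then c else c2).
Proof. by apply/funext => j; case: (ord3 i) => ->; case: (ord3 j) => ->. Qed.

Lemma sum_bool3_split (G : ('I_3 -> bool) -> poly3 R) i :
  \sum_c0 \sum_c1 \sum_c2 G (bool3 c0 c1 c2) =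
  \sum_c0 \sum_c1 \sum_c2 (if bool3 c0 c1 c2 i
    then G (bool3 c0 c1 c2) + G (upd i false (bool3 c0 c1 c2)) else 0).
Proof.
by case: (ord3 i) => ->; rewrite !big_bool /= !upd_bool3 /=; ring.
Qed.

(** The hats at the upper and lower end have derivatives [rho] and [- rho], so differentiation acts
    on the coefficients as the cubical coboundary. *)
Lemma mderiv_cpoly b kind E t i : ~~ kind i ->
  mderiv i (cpoly b kind E t) =
  cpoly b (upd i true kind) (fun c => E (upd i true c) - E (upd i false c)) t.
Proof.
move=> ki; pose T c := tens (cbase b (upd i true kind) t c).
have updT (c : 'I_3 -> bool) : c i -> upd i true c = c.
  by move=> ci; apply/funext => j; rewrite /upd; case: eqP => // ->.
have dE (c : 'I_3 -> bool) : mderiv i (tens (cbase b kind t c)) =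
    if c i then T c else - T (upd i true c).
  rewrite mderiv_tens /T tens_upd [X in if _ then X else _](tensD1 i).
  rewrite [X in if _ then _ else - X](tensD1 i) /cbase /base1 upd_eq upd_eq (negbTE ki).
  have -> : toff i (fun x => if upd i true kind x then
      if c x then rho (b x == 2%N) (lo (M t) x) (hi (M t) x) else 0
      else hat (b x == 2%N) (lo (M t) x) (hi (M t) x) (c x)) =
      toff i (fun x => if kind x then
      if c x then rho (b x == 2%N) (lo (M t) x) (hi (M t) x) else 0
      else hat (b x == 2%N) (lo (M t) x) (hi (M t) x) (c x)).
    by apply: eq_toff => x xi; rewrite upd_neq.
  rewrite deriv_hat; case: (c i) => //; rewrite linearN mulNr; congr (- (_ * _)).
  by apply: eq_toff => x xi; rewrite !upd_neq.
rewrite /cpoly linear_sum (eq_bigr (fun c0 => \sum_c1 \sum_c2 (E (bool3 c0 c1 c2) *: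
    mderiv i (tens (cbase b kind t (bool3 c0 c1 c2)))))); last first.
  move=> c0 _; rewrite linear_sum; apply: eq_bigr => c1 _; rewrite linear_sum.
  by apply: eq_bigr => c2 _; rewrite linearZ.
rewrite (sum_bool3_split (fun c => E c *: mderiv i (tens (cbase b kind t c))) i).
apply: eq_bigr => c0 _; apply: eq_bigr => c1 _; apply: eq_bigr => c2 _.
set c := bool3 _ _ _; rewrite !dE upd_eq; case ci: (c i).
  rewrite scalerBl (updT _ ci) -/(T c) scalerN; congr (_ - _ *: T _).
  by apply/funext => j; rewrite /upd; case: eqP => // ->.
by rewrite (tensD1 i) /cbase /base1 upd_eq ci linear0 mul0r scaler0.
Qed.

(* In each direction at most one value of [c] contributes on a given plane, and
   it designates the same point from both cells. *)
Lemma base1_match b kind t t' s r y i (G G' : bool -> R) :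
  subcell (M t) s `<=` cell (M t') -> on_plane (plane (M t) s) y ->
  (b i = 1 \/ b i = 2)%N ->
  (if s i is None then r i = 0%N else is_true (r i < b i - kind i)%N) ->
  (forall c c', (if kind i then s i = None /\ c = c'
     else endpoint (M t) i c = endpoint (M t') i c') -> G c = G' c') ->
  \sum_c ((cbase b kind t (fun=> c) i)^`(r i)).[y i] * G c =
  \sum_c ((cbase b kind t' (fun=> c) i)^`(r i)).[y i] * G' c.
Proof.
move=> sub hy hb hr hG; case si: (s i) => [c|]; last first.
  have [e1 e2] : lo (M t) i = lo (M t') i /\ hi (M t) i = hi (M t') i.
    by have := subcell_match hM sub i; rewrite si.
  apply: eq_bigr => d _; rewrite /cbase e1 e2 (hG d d) //.
  by case: ifP => // _; rewrite /endpoint e1 e2.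
rewrite si in hr.
have [c1 yc1] : exists c', y i = endpoint (M t) i c'.
  by exists c; have := hy i; rewrite /plane si.
have [c2 yc2] := on_plane_match hM sub hy si.
rewrite /cbase /base1; case ki: (kind i) hr hG => hr hG.
  have r0 : r i = 0%N by case: hb hr => ->; case: (r i).
  have b2 : b i = 2%N by case: hb hr => // ->; rewrite r0.
  have z t0 c' d : y i = endpoint (M t0) i c' ->
      ((if d then rho (b i == 2%N) (lo (M t0) i) (hi (M t0) i) else 0)^`(r i)).[y i] = 0.
    move=> ->; rewrite r0 b2 derivn0; case: d; last by rewrite horner0.
    have [ha hb'] := @rho_end R true (lo (M t0) i) (hi (M t0) i) isT.
    by rewrite /endpoint; case: c'.
  by rewrite !big1 // => d _; rewrite (z _ _ _ yc1, z _ _ _ yc2) mul0r.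
rewrite subn0 in hr.
have h t0 c' d : y i = endpoint (M t0) i c' ->
    ((hat (b i == 2%N) (lo (M t0) i) (hi (M t0) i) d)^`(r i)).[y i] =
    ((d == c') && (r i == 0%N))%:R.
  move=> ->; case r0: (r i) hr => [|[|n]] hr; last by case: hb hr => ->.
    rewrite derivn0 andbT.
    have [ha hb'] := hat1_end (b i == 2%N) (lo_lt_hi (M t0) i).
    have h1 x : (1 : {poly R}).[x] = 1 by rewrite -polyC1 hornerC.
    case: d c' => [] []; rewrite /hat /endpoint /= ?ha ?hb' //.
      by rewrite hornerD hornerN h1 hb' subrr.
    by rewrite hornerD hornerN h1 ha subr0.
  rewrite derivn1 deriv_hat andbF.
  have -> : (b i == 2%N) by case: hb hr => ->.
  have [ha hb'] := @rho_end R true (lo (M t0) i) (hi (M t0) i) isT.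
  by case: d c' => [] []; rewrite /endpoint ?hornerN ?ha ?hb' ?oppr0.
rewrite (bigD1 c1) //= [RHS](bigD1 c2) //= !(h _ _ _ yc1, h _ _ _ yc2) !eqxx.
rewrite big1 => [|d /negbTE dc]; last by rewrite (h _ _ _ yc1) dc mul0r.
rewrite big1 => [|d /negbTE dc]; last by rewrite (h _ _ _ yc2) dc mul0r.
by rewrite !addr0 (hG c1 c2) // -yc1 yc2.
Qed.

Lemma dif_cpoly b kind E t r y : meval y (dif r (cpoly b kind E t)) =
  \sum_c0 ((cbase b kind t (fun=> c0) 0)^`(r 0)).[y 0] * (
  \sum_c1 ((cbase b kind t (fun=> c1) 1)^`(r 1)).[y 1] * (
  \sum_c2 ((cbase b kind t (fun=> c2) 2)^`(r 2)).[y 2] * E (bool3 c0 c1 c2))).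
Proof.
rewrite /cpoly linear_sum rmorph_sum; apply: eq_bigr => c0 _.
rewrite linear_sum rmorph_sum mulr_sumr; apply: eq_bigr => c1 _.
rewrite linear_sum rmorph_sum !mulr_sumr; apply: eq_bigr => c2 _.
rewrite linearZ /= mpoly.mevalZ dif_tens meval_tens prod3 /cbase /=; ring.
Qed.

Definition bkind b (kind : 'I_3 -> bool) (i : 'I_3) : nat := (b i - kind i)%N.

Lemma space_cpoly b kind (E : I -> ('I_3 -> bool) -> R) :
  (forall i, b i = 1 \/ b i = 2)%N ->
  (forall t t' s (c c' : 'I_3 -> bool), subcell (M t) s `<=` cell (M t') ->
     (forall i, if kind i then s i = None /\ c i = c' i
        else endpoint (M t) i (c i) = endpoint (M t') i (c' i)) -> E t c = E t' c') ->
  space M k (bkind b kind) (fun t => cpoly b kind (E t) t).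
Proof.
move=> hb hE; split=> [t|t t' s r sub hr y hy].
  apply: deg_lt_sum => c0 _; apply: deg_lt_sum => c1 _; apply: deg_lt_sum => c2 _.
  apply: deg_ltZ; apply: deg_lt_tens => i; rewrite /cbase /base1 /bkind.
  case: (kind i).
    case: (bool3 _ _ _ i); last by rewrite size_poly0.
    by apply: leq_trans (size_rho _ _ _) _; case: (hb i) => -> /=; lia.
  by apply: leq_trans (size_hat _ _ _ _) _; case: (hb i) => -> /=; lia.
rewrite mpoly.mevalB !dif_cpoly; apply/eqP; rewrite subr_eq0; apply/eqP.
apply: (base1_match sub hy) => // [|c0 c0' h0]; first by have := hr 0.
apply: (base1_match sub hy) => // [|c1 c1' h1]; first by have := hr 1.
apply: (base1_match sub hy) => // [|c2 c2' h2]; first by have := hr 2.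
by apply: hE sub _ => i; case: (ord3 i) => ->.
Qed.
End Homotopy.

Lemma ord3_cycle (i : 'I_3) :
  [/\ distinct i (i + 1) (i + 2), i + 1 + 1 = i + 2, i + 1 + 2 = i, i + 2 + 1 = i
    & i + 2 + 2 = i + 1].
Proof. by case: (ord3 i) => ->; split=> //; exact: val_inj. Qed.

(** * Reduction of closed fields to cubical cochains *)

Section Complexes.
Variables (R : realType) (I : finType) (Omega : set (pt3 R)) (M : I -> cuboid R).
Hypothesis hM : cuboid_mesh Omega M.
Variable k : nat.
Hypothesis k2 : (2 <= k)%N.
Variable b : 'I_3 -> nat.
Hypothesis hb : forall i, (b i = 1 \/ b i = 2)%N.
Implicit Types (i j l : 'I_3) (f g : 'I_3 -> I -> poly3 R).

Definition space1 g := forall i, space M k (lower b i) (g i).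
Definition space2 f := forall i, space M k (lower2 b i) (f i).

Definition rot (g : 'I_3 -> poly3 R) i : poly3 R :=
  mderiv (i + 1) (g (i + 2)) - mderiv (i + 2) (g (i + 1)).
Definition dvg (f : 'I_3 -> poly3 R) : poly3 R := \sum_i mderiv i (f i).

Lemma rotD (g g' : 'I_3 -> poly3 R) i : rot (fun x => g x + g' x) i = rot g i + rot g' i.
Proof. by rewrite /rot !linearD /=; ring. Qed.

Lemma dvg_rot (g : 'I_3 -> poly3 R) : dvg (rot g) = 0.
Proof.
rewrite /dvg sum3 /rot.
have -> : 0 + 1 = 1 :> 'I_3 by exact: val_inj.
have -> : 0 + 2 = 2 :> 'I_3 by exact: val_inj.
have -> : 1 + 1 = 2 :> 'I_3 by exact: val_inj.
have -> : 1 + 2 = 0 :> 'I_3 by exact: val_inj.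
have -> : 2 + 1 = 0 :> 'I_3 by exact: val_inj.
have -> : 2 + 2 = 1 :> 'I_3 by exact: val_inj.
rewrite !linearB /= (mderivC 1 0) (mderivC 2 0) (mderivC 2 1); ring.
Qed.

Lemma rot_grad p i : rot (fun x => mderiv x p) i = 0.
Proof. by rewrite /rot mderivC subrr. Qed.

Lemma dvgB (f f' : 'I_3 -> poly3 R) : dvg (fun x => f x - f' x) = dvg f - dvg f'.
Proof. by rewrite /dvg -sumrB; apply: eq_bigr => i _; rewrite linearB. Qed.

Lemma b_gt0 i : (0 < b i)%N. Proof. by case: (hb i) => ->. Qed.

Lemma space1_grad phi : space M k b phi ->
  space1 (fun i t => mderiv i (phi t)).
Proof.
move=> h i; apply: space_mderiv h; first by rewrite /lower upd_eq prednK ?b_gt0.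
by move=> x xi; rewrite /lower upd_neq.
Qed.

Lemma space2_rot g : space1 g -> space2 (fun i t => rot (g^~ t) i).
Proof.
move=> h i; have [d _ _ _ _] := ord3_cycle i; have [[n1 n2 n3] [m1 m2 m3]] := distinct_neq d.
have hx x : x = i \/ x = i + 1 \/ x = i + 2 by case: (distinct_cases d x) => ->; auto.
apply: spaceB.
- apply: space_mderiv (h (i + 2)); first by rewrite /lower /lower2 upd_neq // (negbTE m1) prednK ?b_gt0.
  move=> x; rewrite /lower /lower2; case: (hx x) => [->|[->|->]]; rewrite ?eqxx // => _.
    by rewrite upd_neq.
  by rewrite upd_eq (negbTE m2).
- apply: space_mderiv (h (i + 1)); first by rewrite /lower /lower2 upd_neq // (negbTE m2) prednK ?b_gt0.
  move=> x; rewrite /lower /lower2; case: (hx x) => [->|[->|->]]; rewrite ?eqxx // => _.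
    by rewrite upd_neq.
  by rewrite upd_eq (negbTE m1).
Qed.

(** The potential is K applied to the cross product of f with the i-th unit vector. Its rot recovers
    the components other than i directly, and component i through the vanishing divergence. *)
Lemma step2 i f : space2 f -> (forall t, dvg (f^~ t) = 0) ->
  exists2 g, space1 g & forall t j,
    f j t = rot (g^~ t) j + Pop M i (b i == 2%N) (i != j) t (f j t).
Proof.
move=> hf f0; have [d e11 e12 e21 e22] := ord3_cycle i.
have [[n1 n2 n3] [m1 m2 m3]] := distinct_neq d.
have hx x : x = i \/ x = i + 1 \/ x = i + 2 by case: (distinct_cases d x) => ->; auto.
pose K t := Kop M i (b i == 2%N) t.
pose g j t := if j == i + 1 then K t (f (i + 2) t)
  else if j == i + 2 then - K t (f (i + 1) t) else 0.
have gE0 t : g i t = 0 by rewrite /g (negbTE n1) (negbTE n2).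
have gE1 t : g (i + 1) t = K t (f (i + 2) t) by rewrite /g eqxx.
have gE2 t : g (i + 2) t = - K t (f (i + 1) t) by rewrite /g (negbTE m3) eqxx.
exists g => [j|t j].
  have key j' : j' != i -> forall f' : I -> poly3 R, space M k (lower2 b j') f' ->
      forall j, j != i -> j != j' -> space M k (lower b j) (fun t => K t (f' t)).
    move=> j'i f' hf' j'' ji jj'.
    have bi : lower b j'' i = b i by rewrite /lower upd_neq // eq_sym.
    rewrite /K -bi; apply: (space_Kop hM k2); first by rewrite bi.
    apply: eq_space hf' => x; rewrite /lower2 {1}/lower /upd bi.
    case: (eqVneq x j') => [->|xj']; first by rewrite (negbTE j'i) /lower /upd eq_sym (negbTE jj').
    case: (eqVneq x i) => [->//|xi]; rewrite /lower /upd; case: (eqVneq x j'') => // xj''.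
      by rewrite xj''.
    have : [\/ x = i, x = j'' | x = j'].
      have dd : distinct i j'' j' by rewrite /distinct /= !inE negb_or ![i == _]eq_sym ji j'i jj'.
      exact: distinct_cases.
    by case=> e; move: xi xj' xj''; rewrite e eqxx.
  case: (hx j) => [->|[->|->]].
  - by apply: space_ext (space0 M k _) => t; rewrite gE0.
  - by apply: space_ext (key _ m2 _ (hf _) _ m1 n3) => t; rewrite gE1.
  - by apply: space_ext (spaceN (key _ m1 _ (hf _) _ m2 m3)) => t; rewrite gE2.
case: (hx j) => [->|[->|->]]; rewrite /rot.
- rewrite gE1 gE2 linearN /= !mderivC_Kop // eqxx.
  have : mderiv i (f i t) + (mderiv (i + 1) (f (i + 1) t) + mderiv (i + 2) (f (i + 2) t)) = 0.
    rewrite -[RHS](f0 t) /dvg (bigD1 i) //= (bigD1 (i + 1)) //= (bigD1 (i + 2)) ?m2 ?m3 //=.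
    rewrite big1 ?addr0 // => x /andP[/andP[]]; case: (hx x) => [->|[->|->]]; rewrite ?eqxx //.
  move=> /(congr1 (Kop M i (b i == 2%N) t)); rewrite !KopD Kop0 Kop_mderiv => e.
  by apply/eqP; rewrite -subr_eq0 -[X in _ == X]e; apply/eqP; ring.
- rewrite e11 e12 gE2 gE0 linear0 sub0r linearN /= opprK mderiv_Kop n1; ring.
- rewrite e21 e22 gE0 gE1 linear0 subr0 mderiv_Kop n2; ring.
Qed.

(** The potential is K applied to g_i; for the other components, vanishing rot trades the derivative
    of g_i in direction j for that of g_j in direction i. *)
Lemma step1 i g : space1 g -> (forall t j, rot (g^~ t) j = 0) ->
  exists2 phi, space M k b phi & forall t j,
    g j t = mderiv j (phi t) + Pop M i (b i == 2%N) (i == j) t (g j t).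
Proof.
move=> hg g0; have [d e11 e12 e21 e22] := ord3_cycle i.
have [[n1 n2 n3] [m1 m2 m3]] := distinct_neq d.
exists (fun t => Kop M i (b i == 2%N) t (g i t)); first exact: (space_Kop hM k2 (hb i) (hg i)).
move=> t j; case: (eqVneq i j) => [<-|ij]; first by rewrite mderiv_Kop; ring.
rewrite mderivC_Kop 1?eq_sym //.
have -> : mderiv j (g i t) = mderiv i (g j t).
  case: (distinct_cases d j) ij => ->; first by rewrite eqxx.
    by move=> _; have := g0 t (i + 2); rewrite /rot e21 e22 => /eqP; rewrite subr_eq0 => /eqP->.
  by move=> _; have := g0 t (i + 1); rewrite /rot e11 e12 => /eqP; rewrite subr_eq0 => /eqP->.
by rewrite Kop_mderiv; ring.
Qed.

Lemma homotopy2 f : space2 f -> (forall t, dvg (f^~ t) = 0) ->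
  exists2 g, space1 g & forall t j, f j t = rot (g^~ t) j +
    cpoly M b (fun x => x != j) (fun c => T3 (cdual M (fun x => x != j) t c) (f j t)) t.
Proof.
move=> hf f0.
(* Each remainder differs from its predecessor by a rot, so it stays in the space and
   divergence-free, and the next direction can be treated. *)
have next i f' : space2 f' -> (forall t, dvg (f'^~ t) = 0) -> exists2 g, space1 g &
   [/\ space2 (fun j t => Pop M i (b i == 2%N) (i != j) t (f' j t)),
       forall t, dvg (fun j => Pop M i (b i == 2%N) (i != j) t (f' j t)) = 0 &
       forall t j, f' j t = rot (g^~ t) j + Pop M i (b i == 2%N) (i != j) t (f' j t)].
  move=> hf' f0'; have [g hg e] := step2 i hf' f0'; exists g => //.
  have eP t j : Pop M i (b i == 2%N) (i != j) t (f' j t) = f' j t - rot (g^~ t) j.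
    by rewrite {2}e; ring.
  split=> // [j|t].
    by apply: space_ext (spaceB (hf' j) (space2_rot hg j)) => t; rewrite eP.
  rewrite (_ : (fun j => _) = (fun j => f' j t - rot (g^~ t) j)); last by apply/funext.
  by rewrite dvgB f0' dvg_rot subr0.
have [g2 hg2 [hf2 f20 e2]] := next 2 f hf f0.
have [g1 hg1 [hf1 f10 e1]] := next 1 _ hf2 f20.
have [g3 hg3 [hf3 f30 e3]] := next 0 _ hf1 f10.
exists (fun j t => g2 j t + (g1 j t + g3 j t)).
  by move=> j; apply: spaceD => //; exact: spaceD.
move=> t j; rewrite !rotD -Pop_cpoly {1}e2 {1}e1 {1}e3; ring.
Qed.

Lemma homotopy1 g : space1 g -> (forall t j, rot (g^~ t) j = 0) ->
  exists2 phi, space M k b phi & forall t j, g j t = mderiv j (phi t) +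
    cpoly M b (fun x => x == j) (fun c => T3 (cdual M (fun x => x == j) t c) (g j t)) t.
Proof.
move=> hg g0.
have next i g' : space1 g' -> (forall t j, rot (g'^~ t) j = 0) -> exists2 phi, space M k b phi &
   [/\ space1 (fun j t => Pop M i (b i == 2%N) (i == j) t (g' j t)),
       forall t l, rot (fun j => Pop M i (b i == 2%N) (i == j) t (g' j t)) l = 0 &
       forall t j, g' j t = mderiv j (phi t) + Pop M i (b i == 2%N) (i == j) t (g' j t)].
  move=> hg' g0'; have [phi hphi e] := step1 i hg' g0'; exists phi => //.
  have eP t j : Pop M i (b i == 2%N) (i == j) t (g' j t) = g' j t - mderiv j (phi t).
    by rewrite {2}e; ring.
  split=> // [j|t l].
    by apply: space_ext (spaceB (hg' j) (space1_grad hphi j)) => t; rewrite eP.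
  rewrite (_ : (fun j => _) = (fun j => g' j t + - mderiv j (phi t))); last by apply/funext.
  have := rotD (g'^~ t) (fun j => - mderiv j (phi t)) l; rewrite g0' add0r => ->.
  by rewrite /rot !linearN /= (mderivC (l + 1)); ring.
have [p2 hp2 [hg2 g20 e2]] := next 2 g hg g0.
have [p1 hp1 [hg1 g10 e1]] := next 1 _ hg2 g20.
have [p3 hp3 [hg3 g30 e3]] := next 0 _ hg1 g10.
exists (fun t => p2 t + (p1 t + p3 t)).
  by apply: spaceD => //; exact: spaceD.
move=> t j; rewrite !linearD -Pop_cpoly {1}e2 {1}e1 {1}e3 /=; ring.
Qed.
End Complexes.

(** * Coarse contractibility of the closed domain *)

Section CoarseContractible.
Variables (R : realType) (T : pseudoMetricType R).
Implicit Types (X : set T) (p x y z : T) (d e : R).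

(* A contraction at every scale, cut into finitely many steps; consecutive
   steps are close to each other, but no step needs to be continuous. *)
Definition coarsely_contractible X p : Prop := forall d, 0 < d ->
  exists (N : nat) (h : nat -> T -> T) (e : R),
  [/\ 0 < e, forall x, X x -> h 0%N x = x, forall x, X x -> h N x = p,
      forall n x, X x -> X (h n x)
    & forall n x y, X x -> X y -> ball x e y ->
      [/\ ball (h n x) d (h n y), ball (h n x) d (h n.+1 y) & ball (h n.+1 x) d (h n y)]].

Lemma coarse_H0 X p d (f : T -> R) : coarsely_contractible X p -> 0 < d ->
  (forall x y, X x -> X y -> ball x d y -> f x = f y) ->
  forall x, X x -> f x = f p.
Proof.
move=> hX d0 hf x Xx; have [N [h [e [e0 h0 hN hX' hh]]]] := hX d d0.
suff H n : f x = f (h n x) by rewrite (H N) hN.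
elim: n => [|n ->]; first by rewrite h0.
by apply: hf; [exact: hX' | exact: hX' |]; have [] := hh n x x Xx Xx (ballxx x e0).
Qed.

Lemma coarse_H1 X p d (f : T -> T -> R) : coarsely_contractible X p -> 0 < d -> X p ->
  (forall x y z, X x -> X y -> X z -> ball x d y -> ball x d z -> ball y d z ->
     f y z - f x z + f x y = 0) ->
  exists (g : T -> R) (e : R), 0 < e /\
    forall x y, X x -> X y -> ball x e y -> f x y = g y - g x.
Proof.
move=> hX d0 Xp hf; have [N [h [e [e0 h0 hN hX' hh]]]] := hX d d0.
have H n : exists g : T -> R, forall x y, X x -> X y -> ball x e y ->
    f x y = f (h n x) (h n y) + g y - g x.
  elim: n => [|n [g hg]].
    by exists (fun=> 0) => x y Xx Xy _; rewrite !h0 // addr0 subr0.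
  (* The correction is f along the track of x from one step to the next. The quadrilateral between
     consecutive steps is cut into two triangles, which give [c1] and [c2]. *)
  exists (fun x => g x - f (h n x) (h n.+1 x)) => x y Xx Xy xy.
  have [b1 b2 b3] := hh n x y Xx Xy xy.
  have [_ b4 _] := hh n y y Xy Xy (ballxx y e0).
  have [_ b5 _] := hh n x x Xx Xx (ballxx x e0).
  have [b6 _ _] := hh n.+1 x y Xx Xy xy.
  have c1 := hf _ _ _ (hX' n _ Xx) (hX' n _ Xy) (hX' n.+1 _ Xy) b1 b2 b4.
  have c2 := hf _ _ _ (hX' n _ Xx) (hX' n.+1 _ Xx) (hX' n.+1 _ Xy) b5 b2 b6.
  by rewrite hg //; lra.
have [g hg] := H N; exists g, e; split=> // x y Xx Xy xy; rewrite hg // !hN //.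
have := hf p p p Xp Xp Xp (ballxx p d0) (ballxx p d0) (ballxx p d0).
by rewrite subrr add0r => ->; rewrite add0r.
Qed.

Lemma coarse_H2 X p d (f : T -> T -> T -> R) : coarsely_contractible X p -> 0 < d -> X p ->
  (forall x y z w, X x -> X y -> X z -> X w -> ball x d y -> ball x d z -> ball x d w ->
     ball y d z -> ball y d w -> ball z d w ->
     f y z w - f x z w + f x y w - f x y z = 0) ->
  exists (g : T -> T -> R) (e : R), 0 < e /\
    forall x y z, X x -> X y -> X z -> ball x e y -> ball x e z -> ball y e z ->
    f x y z = g y z - g x z + g x y.
Proof.
move=> hX d0 Xp hf; have [N [h [e [e0 h0 hN hX' hh]]]] := hX d d0.
have H n : exists g : T -> T -> R, forall x y z, X x -> X y -> X z ->
    ball x e y -> ball x e z -> ball y e z ->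
    f x y z = f (h n x) (h n y) (h n z) + (g y z - g x z + g x y).
  elim: n => [|n [g hg]].
    by exists (fun _ _ => 0) => x y z Xx Xy Xz _ _ _; rewrite !h0 // subr0 !addr0.
  (* The prism operator: the quadrilateral swept by the pair x, y is cut into two triangles, and the
     prism swept by a triple into the three tetrahedra of [c1], [c2], [c3]. *)
  pose P x y := f (h n x) (h n.+1 x) (h n.+1 y) - f (h n x) (h n y) (h n.+1 y).
  exists (fun x y => g x y - P x y) => x y z Xx Xy Xz xy xz yz.
  have hx := hX' n _ Xx; have hy := hX' n _ Xy; have hz := hX' n _ Xz.
  have hx' := hX' n.+1 _ Xx; have hy' := hX' n.+1 _ Xy; have hz' := hX' n.+1 _ Xz.
  have [_ xx _] := hh n x x Xx Xx (ballxx x e0).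
  have [_ yy _] := hh n y y Xy Xy (ballxx y e0).
  have [_ zz _] := hh n z z Xz Xz (ballxx z e0).
  have [xy1 xy2 _] := hh n x y Xx Xy xy; have [xy3 _ _] := hh n.+1 x y Xx Xy xy.
  have [xz1 xz2 _] := hh n x z Xx Xz xz; have [xz3 _ _] := hh n.+1 x z Xx Xz xz.
  have [yz1 yz2 _] := hh n y z Xy Xz yz; have [yz3 _ _] := hh n.+1 y z Xy Xz yz.
  have c1 := hf _ _ _ _ hx hx' hy' hz' xx xy2 xz2 xy3 xz3 yz3.
  have c2 := hf _ _ _ _ hx hy hy' hz' xy1 xy2 xz2 yy yz2 yz3.
  have c3 := hf _ _ _ _ hx hy hz hz' xy1 xz1 xz2 yz1 yz2 zz.
  by rewrite hg // /P; lra.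
(* What remains at p is the constant [f p p p], itself the coboundary of a constant, since c - c + c
   = c. *)
have [g hg] := H N; exists (fun x y => g x y + f p p p), e; split=> // x y z Xx Xy Xz xy xz yz.
by rewrite hg // !hN //; lra.
Qed.

End CoarseContractible.

Section Heine.
Variable R : realType.

Lemma heine (T T' : pseudoMetricType R) (K : set T) (f : T -> T') (d : R) :
  compact K -> {within K, continuous f} -> 0 < d ->
  exists2 e : R, 0 < e & forall x y, K x -> K y -> ball x e y -> ball (f x) d (f y).
Proof.
move=> /compact_near_coveringP cK /subspace_continuousP cf d0.
have d2 : 0 < d / 2 by rewrite divr_gt0.
pose P (e : R) x := K x -> forall y, K y -> ball x e y -> ball (f x) d (f y).
have [x Kx|e /= e0 he] := cK R (0 : R)^'+ P _.
  have /= := cf x Kx _ (nbhsx_ballx (f x) (d / 2) d2).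
  rewrite /within /= => /nbhs_ballP[r /= r0 hr].
  have r2 : 0 < r / 2 by rewrite divr_gt0.
  exists (ball x (r / 2), [set e | 0 < e] `&` [set e | e < r / 2]).
    split => /=; first exact: nbhsx_ballx.
    by apply: filterI; [exact: nbhs_right_gt | exact: nbhs_right_lt].
  move=> [x' e] /= [xx' [e0 er]] Kx' y Ky x'y.
  have xy : ball x r y by rewrite [r]splitr; apply: ball_triangle xx' (le_ball (ltW er) x'y).
  have xx'' : ball x r x' by apply: le_ball xx'; lra.
  by rewrite [d]splitr; apply: ball_triangle (ball_sym (hr _ xx'' Kx')) (hr _ xy Ky).
have h0 : 0 < e / 2 by rewrite divr_gt0.
exists (e / 2) => // x y Kx; apply: (he (e / 2)) => //=.
by rewrite sub0r normrN gtr0_norm //; lra.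
Qed.

End Heine.

(** * The collar and the contraction of the closure *)

Section Collar.
Variable R : realType.
Notation pt := (pt3 R).
Variable Omega : set pt.
Hypotheses (hopen : open Omega) (hlip : lipschitz_boundary Omega).
Let X := closure Omega.

Lemma coord_mulmx_cvg (A : 'M[R]_3) i : continuous (fun z : pt => (z *m A) 0 i).
Proof.
have e (z : pt) : (z *m A) 0 i = z 0 0 * A 0 i + (z 0 1 * A 1 i + z 0 2 * A 2 i).
  by rewrite mxE sum3.
rewrite (_ : (fun z : pt => _) = (fun z : pt => z 0 0 * A 0 i + (z 0 1 * A 1 i + z 0 2 * A 2 i))).
  move=> y; have h j : (fun z : pt => z 0 j * A j i) @ nbhs y --> y 0 j * A j i.
    by apply: cvgM; [exact: coord_continuous | exact: cvg_cst].
  exact: (cvgD (h 0) (cvgD (h 1) (h 2))).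
by apply/funext => z.
Qed.

Lemma graph_cvg (A : 'M[R]_3) (g : R * R -> R) : lipschitz g ->
  continuous (fun z : pt => (z *m A) 0 2 - g ((z *m A) 0 0, (z *m A) 0 1)).
Proof.
move=> /pinfty_ex_gt0[K K0 hK] y.
have c2 := @coord_mulmx_cvg A 2 y.
have cp : (fun z : pt => ((z *m A) 0 0, (z *m A) 0 1)) @ nbhs y --> ((y *m A) 0 0, (y *m A) 0 1).
  exact: (cvg_pair (@coord_mulmx_cvg A 0 y) (@coord_mulmx_cvg A 1 y)).
suff cg : (fun z : pt => g ((z *m A) 0 0, (z *m A) 0 1)) @ nbhs y -->
    g ((y *m A) 0 0, (y *m A) 0 1) by exact: (cvgB c2 cg).
apply/cvgrPdist_lt => e e0.
have eK : 0 < e / K by rewrite divr_gt0.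
move/cvgrPdist_lt: cp => /(_ _ eK); apply: filterS => z hz.
have := hK (((y *m A) 0 0, (y *m A) 0 1), ((z *m A) 0 0, (z *m A) 0 1)) (conj Logic.I Logic.I).
by move=> /= /le_lt_trans; apply; rewrite mulrC -ltr_pdivlMr.
Qed.

(** Near a boundary point the direction is the downward vertical of the Lipschitz chart. Points of
    the closure lie on or below the graph, since the part above it is open, so any positive move
    down ends strictly below. *)
Lemma inward x : X x -> exists (r : R) (d : pt), 0 < r /\
  forall y, X y -> ball x r y -> forall s, 0 < s <= 1 -> Omega (y + s *: d).
Proof.
move=> Xx; have [Ox|nOx] := pselect (Omega x).
  have : nbhs x Omega by apply: open_nbhs_nbhs.
  move=> /nbhs_ballP[r /= r0 hr]; exists r, 0; split=> // y _ xy s _.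
  by rewrite scaler0 addr0; exact: hr.
have [|A [g [AA lg]]] := hlip (x := x).
  by split => // /interior_subset.
move=> /nbhs_ballP[r0 /= r00 hr].
have AA' : A^T *m A = 1%:M by exact: mulmx1C.
pose d0 : pt := - (delta_mx 0 2 *m A^T).
have d0A : d0 *m A = - delta_mx 0 2 by rewrite mulNmx -mulmxA AA' mulmx1.
(* A full push then has length below r0 / 2, so a point of the half ball stays where the chart is
   valid. *)
pose tau := r0 / (2 * (1 + `|d0|)).
have d1 : 0 < 2 * (1 + `|d0|) by rewrite mulr_gt0 // ltr_wpDr.
have tau0 : 0 < tau by rewrite divr_gt0.
have taud : tau * `|d0| < r0 / 2.
  rewrite /tau mulrAC ltr_pdivrMr //.
  have -> : r0 / 2 * (2 * (1 + `|d0|)) = r0 + r0 * `|d0| by field.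
  by rewrite ltrDr.
exists (r0 / 2), (tau *: d0); split; first by rewrite divr_gt0.
move=> y Xy xy s /andP[s0 s1].
have le0 : (y *m A) 0 2 - g ((y *m A) 0 0, (y *m A) 0 1) <= 0.
  rewrite leNgt; apply/negP => gt0.
  have h1 : \forall z \near nbhs y, 0 < (z *m A) 0 2 - g ((z *m A) 0 0, (z *m A) 0 1).
    exact: (cvgr_gt _ (@graph_cvg A g lg y) 0 gt0).
  have h2 : \forall z \near y, ball x r0 z.
    apply/nbhs_ballP; exists (r0 / 2); first by rewrite /= divr_gt0.
    by move=> z yz; rewrite [r0]splitr; exact: ball_triangle xy yz.
  have [z [Oz [hz1 hz2]]] := Xy _ (filterI h1 h2).
  by have /(hr z hz2) := Oz; rewrite -subr_lt0 ltNge (ltW hz1).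
have inb : ball x r0 (y + s *: (tau *: d0)).
  rewrite [r0]splitr; apply: ball_triangle xy _.
  rewrite -ball_normE /ball_ /= opprD addrA subrr sub0r normrN normrZ gtr0_norm //.
  apply: le_lt_trans taud; rewrite normrZ gtr0_norm //.
  by rewrite ler_piMl // mulr_ge0 // ltW.
have dE (j : 'I_3) : ((y + s *: (tau *: d0)) *m A) 0 j = (y *m A) 0 j - s * tau * (j == 2)%:R.
  by rewrite scalerA mulmxDl -scalemxAl d0A !mxE eqxx /= mulrN.
apply/(hr _ inb); rewrite !dE /= !mulr0 !subr0 mulr1.
have : 0 < s * tau by rewrite mulr_gt0.
by move: le0; set u := g _; lra.
Qed.

Hypothesis cX : compact X.

(** Finitely many local inward pushes, each weighted by a continuous bump, are composed. A push
    either fixes a point or sends it into Omega, and later pushes keep it there, so no compatibility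
    between the charts is needed. *)
Lemma collar e : 0 < e -> exists J : pt -> pt,
  [/\ continuous J, forall x, X x -> Omega (J x) & forall x, ball x e (J x)].
Proof.
move=> e0.
have hx x : exists p : R * pt, 0 < p.1 /\
    (X x -> forall y, X y -> ball x p.1 y -> forall s, 0 < s <= 1 -> Omega (y + s *: p.2)).
  have [/inward[r [d [r0 h]]]|nXx] := pselect (X x); first by exists (r, d); split.
  by exists (1, 0); split.
have [rd hrd] := choice hx.
(* The positive part of a, written with an absolute value; it is positive exactly on the ball of the
   chart at x. *)
pose psi x y := let a := 1 - `|y - x| / (rd x).1 in (a + `|a|) / 2.
have psi_ge0 x y : 0 <= psi x y <= 1.
  have a1 : 1 - `|y - x| / (rd x).1 <= 1.
    by rewrite gerBl divr_ge0 // ltW //; have [] := hrd x.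
  by rewrite /psi; move: (1 - _) a1 => a a1; case: (ler0P a) => a0; apply/andP; split; lra.
have ballE x y : ball x (rd x).1 y <-> 0 < 1 - `|y - x| / (rd x).1.
  have [r0 _] := hrd x.
  by rewrite -ball_normE /ball_ /= distrC subr_gt0 ltr_pdivrMr // mul1r.
have psi_gt0 x y : 0 < psi x y -> ball x (rd x).1 y.
  rewrite ballE /psi; move: (1 - _) => a; case: (ler0P a) => a0; lra.
have psi_ball x y : ball x (rd x).1 y -> 0 < psi x y.
  rewrite ballE /psi; move: (1 - _) => a; case: (ler0P a) => a0; lra.
have OX y : Omega y -> X y by exact: subset_closure.
pose j t x y := y + (t * psi x y) *: (rd x).2.
have jO t x y : 0 < t <= 1 -> X x -> X y -> 0 < psi x y -> Omega (j t x y).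
  move=> /andP[t0 t1] Xx Xy p0; have [_ /(_ Xx y Xy (psi_gt0 _ _ p0)) h] := hrd x.
  apply: h; rewrite mulr_gt0 //=; have /andP[_ p1] := psi_ge0 x y.
  by rewrite mulr_ile1 // ltW.
have j0 t x y : psi x y = 0 -> j t x y = y by rewrite /j => ->; rewrite mulr0 scale0r addr0.
have jc t x : continuous (j t x).
  move=> y.
  have c0 : (fun z : pt => z - x) @ nbhs y --> y - x by apply: cvgB; [exact: cvg_id | exact: cvg_cst].
  have c1 : (fun z : pt => `|z - x| / (rd x).1) @ nbhs y --> `|y - x| / (rd x).1.
    by apply: cvgM; [exact: cvg_norm | exact: cvg_cst].
  have ca : (fun z : pt => 1 - `|z - x| / (rd x).1) @ nbhs y --> 1 - `|y - x| / (rd x).1.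
    by apply: cvgB; [exact: cvg_cst | exact: c1].
  have cn := cvgD ca (cvg_norm ca).
  have cp : (fun z : pt => psi x z) @ nbhs y --> psi x y.
    by apply: cvgM; [exact: cn | exact: cvg_cst].
  have ct : (fun z : pt => t * psi x z) @ nbhs y --> t * psi x y.
    by apply: cvgM; [exact: cvg_cst | exact: cp].
  have cz : (fun z : pt => (t * psi x z) *: (rd x).2) @ nbhs y --> (t * psi x y) *: (rd x).2.
    exact: cvgZr_tmp.
  have ci : (fun z : pt => z) @ nbhs y --> y by exact: cvg_id.
  exact: (cvgD ci cz).
have jd t x y : 0 < t -> `|j t x y - y| <= t * `|(rd x).2|.
  move=> t0; rewrite /j addrC addKr normrZ; have /andP[p0 p1] := psi_ge0 x y.
  rewrite ger0_norm; last by rewrite mulr_ge0 // ltW.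
  by rewrite ler_wpM2r // ler_piMr // ltW.
have main (l : seq pt) : (forall x, x \in l -> X x) -> exists B : R, 0 <= B /\
    forall t, 0 < t <= 1 -> exists J : pt -> pt,
    [/\ continuous J, forall y, X y -> (Omega y \/ exists2 x, x \in l & 0 < psi x y) -> Omega (J y)
      & forall y, `|J y - y| <= t * B].
  elim: l => [_|x l IH hl].
    exists 0; split=> // t _; exists id; split=> [y|y _ [//|[x]]|y]; first exact: cvg_id.
    - by rewrite in_nil.
    - by rewrite subrr normr0 mulr0.
  have [|B [B0 hB]] := IH; first by move=> z zl; apply: hl; rewrite inE zl orbT.
  exists (B + `|(rd x).2|); split=> [|t t01]; first by rewrite addr_ge0.
  have Xx : X x by apply: hl; rewrite inE eqxx.
  have [t0 t1] := andP t01.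
  have [J [cJ hJ dJ]] := hB t t01; exists (J \o j t x); split.
  - by move=> y; apply: continuous_comp; [exact: jc | exact: cJ].
  - move=> y Xy hy /=; have /andP[p0 _] := psi_ge0 x y.
    move: p0; rewrite le_eqVlt => /orP[/eqP p0|p0]; last first.
      by have Oj := jO t x y t01 Xx Xy p0; apply: hJ; [exact: OX | left].
    rewrite j0 //; apply: hJ => //; case: hy => [|[z]]; first by left.
    by rewrite inE => /orP[/eqP->|zl hz]; [rewrite -p0 ltxx | right; exists z].
  - move=> y /=; rewrite -[_ - y](subrKA (j t x y)) mulrDr.
    by apply: le_trans (ler_normD _ _) _; rewrite lerD // jd.
have := cX; rewrite compact_cover => /(_ _ X (fun z => (ball z (rd z).1)^°)).
case => [z _|z Xz|D sD hD].
- exact: open_interior.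
- by exists z => //; apply: nbhsx_ballx; have [] := hrd z.
have [|B [B0 hB]] := main (finmap.enum_fset D).
  by move=> z zD; have := sD z zD; rewrite inE.
(* This t is at most 1, as the pushes require, and makes the total displacement t B smaller than
   e. *)
have t01 : 0 < e / (e + B + 1) <= 1.
  have q : 0 < e + B + 1 by rewrite ltr_wpDl // addr_ge0 // ltW.
  by rewrite divr_gt0 //= ler_pdivrMr // mul1r -addrA ler_wpDr // addr_ge0.
have [J [cJ hJ dJ]] := hB _ t01; exists J; split=> // [x Xx|x].
  apply: hJ => //; right; have [z /= zD zx] := hD x Xx.
  by exists z => //; apply: psi_ball; exact: interior_subset zx.
rewrite -ball_normE /ball_ /= distrC; apply: le_lt_trans (dJ x) _.
have q : 0 < e + B + 1 by rewrite ltr_wpDl // addr_ge0 // ltW.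
rewrite mulrAC ltr_pdivrMr // ltr_pM2l //; lra.
Qed.

Hypothesis hcontr : contractible Omega.

(** The first step jumps from x to J x, at distance less than d / 2; the others sample the
    contraction started at J x. Since J maps the closure into Omega, the latter is uniformly
    continuous on a compact set. *)
Lemma closure_coarsely_contractible : exists2 p, X p & coarsely_contractible X p.
Proof.
have [p Op [H [cH HO H0 H1]]] := hcontr.
have OX y : Omega y -> X y by exact: subset_closure.
exists p; first exact: OX.
move=> d d0; have d2 : 0 < d / 2 by rewrite divr_gt0.
have [J [cJ JO Jd]] := collar d2.
pose K : set (R * pt) := `[0 : R, 1]%classic `*` X.
have cK : compact K by apply: compact_setX => //; exact: segment_compact.
pose G (z : R * pt) := H (z.1, J z.2).
have cG : {within K, continuous G}.
  apply/subspace_continuousP => z [z1 z2].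
  move/subspace_continuousP : cH => /(_ (z.1, J z.2)).
  have Dz : 0 <= z.1 <= 1 /\ Omega (J z.2) by split; [move: z1; rewrite /= in_itv | exact: JO].
  move=> /(_ Dz) cHz; apply: (@cvg_comp _ _ _ (fun w : R * pt => (w.1, J w.2)) H); last exact: cHz.
  have cphi : (fun w : R * pt => (w.1, J w.2)) @ nbhs z --> (z.1, J z.2).
    have f1 : (fun w : R * pt => w.1) @ nbhs z --> z.1 by exact: cvg_fst.
    have f2 : (fun w : R * pt => w.2) @ nbhs z --> z.2 by exact: cvg_snd.
    have f3 : (fun w : R * pt => J w.2) @ nbhs z --> J z.2.
      by apply: (cvg_comp _ _ f2); exact: cJ.
    exact: (cvg_pair f1 f3).
  move=> W hW; change (nbhs z (fun w => K w -> W (w.1, J w.2))).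
  have : nbhs z (fun w => 0 <= w.1 <= 1 /\ Omega (J w.2) -> W (w.1, J w.2)) := cphi _ hW.
  apply: filterS => w hw [w1 w2].
  by apply: hw; split; [move: w1; rewrite /= in_itv | exact: JO].
have [e1 e10 he1] := heine cK cG d0.
pose e := Order.min e1 (d / 2).
have e0 : 0 < e by rewrite lt_min e10 d2.
have ee1 : e <= e1 by rewrite ge_min lexx.
have ed2 : e <= d / 2 by rewrite ge_min lexx orbT.
pose N := (Num.truncn e1^-1).+1.
have N0 : 0 < N%:R :> R by rewrite ltr0n.
have Ne1 : N%:R^-1 < e1.
  by rewrite invf_plt ?posrE //; exact: truncnS_gt.
(* Times are capped at 1 because the steps are indexed by all natural numbers; consecutive times
   differ by less than [e1]. *)
pose sq n : R := Order.min (n%:R / N%:R) 1.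
have sq01 n : 0 <= sq n <= 1.
  by rewrite le_min ler01 ge_min lexx orbT !andbT divr_ge0 // ler0n.
have sqd n m : (m = n \/ m = n.+1)%N -> `|sq n - sq m| < e1.
  case=> ->; first by rewrite subrr normr0.
  have : n.+1%:R / N%:R = n%:R / N%:R + N%:R^-1 :> R by rewrite -natr1 mulrDl mul1r.
  have : 0 < N%:R^-1 :> R by rewrite invr_gt0.
  move: Ne1; rewrite /sq !minElt => Ne1 Np ->.
  by case: ifP => h1; case: ifP => h2; rewrite ltr_norml; move: h1 h2; case: ltP => //; lra.
pose h n x := if n is m.+1 then H (sq m, J x) else x.
have hsX n x : X x -> Omega (H (sq n, J x)) by move=> Xx; apply: HO; split => //=; exact: JO.
have near01 n m x y : (m = n \/ m = n.+1)%N -> X x -> X y -> ball x e y ->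
    ball (H (sq n, J x)) d (H (sq m, J y)).
  move=> nm Xx Xy xy; apply: (he1 (sq n, x) (sq m, y)); split=> //=.
  - by rewrite in_itv /= sq01.
  - by rewrite in_itv /= sq01.
  - by rewrite -ball_normE /ball_ /= sqd.
  - exact: le_ball xy.
have sq0 : sq 0 = 0 by rewrite /sq mul0r; apply: min_l; exact: ler01.
have HJ0 x : X x -> H (sq 0, J x) = J x by move=> Xx; rewrite sq0 H0 //; exact: JO.
exists N.+1, h, e; split => //.
- move=> x Xx; rewrite /h (_ : sq N = 1) ?H1 //; first exact: JO.
  by rewrite /sq divff ?gt_eqF // minxx.
- by case=> [//|n] x Xx; exact/OX/hsX.
move=> [|n] x y Xx Xy xy; rewrite /h.
  rewrite !HJ0 //; split.
  - by apply: le_ball xy; apply: le_trans ed2 _; lra.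
  - by rewrite [d]splitr; apply: ball_triangle (le_ball ed2 xy) (Jd y).
  - by rewrite [d]splitr; apply: ball_triangle (ball_sym (Jd x)) (le_ball ed2 xy).
split; [apply: near01; auto|apply: near01; auto|].
by apply: ball_sym; apply: near01; auto; exact: ball_sym.
Qed.

End Collar.

(** * Cubical cohomology of the mesh *)

Section Cochains.
Variables (R : realType) (I : finType) (Omega : set (pt3 R)) (M : I -> cuboid R).
Hypothesis hM : cuboid_mesh Omega M.
Let X := closure Omega.
Implicit Types (t : I) (i j l n : 'I_3) (y z w u : 'I_3 -> R) (x : pt3 R) (kind : 'I_3 -> bool).

Lemma mesh_compact : compact X.
Proof.
rewrite /X (mesh_cover hM) (_ : \bigcup_t cell (M t) = \big[setU/set0]_(t : I) cell (M t)); last first.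
  by rewrite -bigcup_pred; apply: eq_bigcupl.
apply: bigsetU_compact => t _.
rewrite (_ : cell (M t) = [set v | forall i, `[lo (M t) i, hi (M t) i]%classic (v ord0 i)]).
  apply: (@rV_compact _ _ (fun i => `[lo (M t) i, hi (M t) i]%classic)) => i; exact: segment_compact.
by apply/seteqP; split=> v hv i; have := hv i; rewrite /= in_itv.
Qed.

Definition inbox t y := forall i, lo (M t) i <= y i <= hi (M t) i.

Lemma inbox_X t x : inbox t (x 0) -> X x.
Proof. by move=> h; rewrite /X (mesh_cover hM); exists t. Qed.

(** Each coordinate is rounded to the nearer end of the cell, the midpoint downwards. *)
Definition rnd t y i : R :=
  endpoint (M t) i ((lo (M t) i + hi (M t) i) / 2 < y i).

Lemma rnd_inbox t y : inbox t (rnd t y).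
Proof. by move=> i; exact: endpoint_itv. Qed.

Lemma rnd_lo t y i : y i < lo (M t) i + (hi (M t) i - lo (M t) i) / 2 -> rnd t y i = lo (M t) i.
Proof. by move=> h; rewrite /rnd ltNge; have -> : y i <= (lo (M t) i + hi (M t) i) / 2 by lra. Qed.

Lemma rnd_hi t y i : hi (M t) i - (hi (M t) i - lo (M t) i) / 2 < y i -> rnd t y i = hi (M t) i.
Proof. by move=> h; rewrite /rnd; have -> : (lo (M t) i + hi (M t) i) / 2 < y i by lra. Qed.

Definition close (d : R) y z := forall i, `|y i - z i| < d.

Lemma ball_close x x' (d : R) : ball x d x' <-> 0 < d /\ close d (x 0) (x' 0).
Proof.
split=> [[d0 h]|[d0 h]]; split=> // i; first exact: h.
by move=> j; rewrite ord1; exact: h.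
Qed.

Lemma meet_fixed t t' s y : cell (M t) `&` cell (M t') = subcell (M t) s ->
  inbox t y -> inbox t' y -> forall i c, s i = Some c -> y i = endpoint (M t) i c.
Proof.
move=> e h h' i c si; have : (cell (M t) `&` cell (M t')) (\row_i y i).
  by split=> j; rewrite mxE; [exact: h | exact: h'].
by rewrite e => /(_ i); rewrite si mxE.
Qed.

(** Cells containing close points meet. In the free directions of the intersection they have the
    same interval; in a fixed direction both points are within half a width of the common end and
    round to it. Either way each rounded point lies in both cells. *)
Lemma close_cells : exists2 d : R, 0 < d & forall t t' y z,
  inbox t y -> inbox t' z -> close d y z ->
  inbox t' (rnd t y) /\ inbox t (rnd t' z) /\ ((forall i, y i = z i) -> rnd t y =1 rnd t' z).
Proof.
(* [d1] bounds the half widths from below and makes both points round to a shared end; [d2] bounds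
   the gaps between separated cells and forces the cells to meet. *)
have [d1 d10 hd1] : exists2 d : R, 0 < d & forall p : I * 'I_3,
    d <= (hi (M p.1) p.2 - lo (M p.1) p.2) / 2.
  by apply: exists_pos_min => p; rewrite divr_gt0 // subr_gt0 lo_lt_hi.
have [d2 d20 hd2] : exists2 d : R, 0 < d & forall p : I * I * 'I_3,
    d <= if hi (M p.1.1) p.2 < lo (M p.1.2) p.2
         then lo (M p.1.2) p.2 - hi (M p.1.1) p.2 else 1.
  by apply: exists_pos_min => p; case: ifP => // h; rewrite subr_gt0.
exists (Order.min d1 d2); first by rewrite lt_min d10 d20.
move=> t t' y z hy hz yz.
have yz1 i : `|y i - z i| < d1 by apply: lt_le_trans (yz i) _; rewrite ge_min lexx.
have yz2 i : `|y i - z i| < d2 by apply: lt_le_trans (yz i) _; rewrite ge_min lexx orbT.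
have [<-{t' hz}|tt'] := eqVneq t t'.
  split; [exact: rnd_inbox | split; [exact: rnd_inbox |]].
  by move=> e i; rewrite /rnd e.
have lohi i : lo (M t') i <= hi (M t) i.
  rewrite leNgt; apply/negP => h; have := hd2 (t, t', i); rewrite /= h => h2.
  have := yz2 i; rewrite ltr_norml; have := hy i; have := hz i.
  by move=> /andP[? ?] /andP[? ?] /andP[? ?]; lra.
have lohi' i : lo (M t) i <= hi (M t') i.
  rewrite leNgt; apply/negP => h; have := hd2 (t', t, i); rewrite /= h => h2.
  have := yz2 i; rewrite ltr_norml; have := hy i; have := hz i.
  by move=> /andP[? ?] /andP[? ?] /andP[? ?]; lra.
pose mx i := Order.max (lo (M t) i) (lo (M t') i).
pose mn i := Order.min (hi (M t) i) (hi (M t') i).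
have lt_i := fun t0 => lo_lt_hi (M t0).
have mxb : inbox t mx /\ inbox t' mx.
  by split=> i; rewrite /mx le_max ge_max lexx ?orbT /= ?lohi ?lohi' ?ltW.
have mnb : inbox t mn /\ inbox t' mn.
  by split=> i; rewrite /mn le_min ge_min lexx ?orbT ?andbT /= ?lohi ?lohi' ?ltW.
have [|s [s' [es _]]] := meet_subcell hM tt'.
  exists (\row_i mx i); have [h h'] := mxb.
  by split=> i; rewrite mxE; [exact: h | exact: h'].
have sub : subcell (M t) s `<=` cell (M t') by rewrite -es => x [].
have key i : (lo (M t) i = lo (M t') i /\ hi (M t) i = hi (M t') i) \/ rnd t y i = rnd t' z i.
  have := subcell_match hM sub i; case si: (s i) => [c|]; last by left.
  move=> _; right.
  have e1 := meet_fixed es mxb.1 mxb.2 si; have e2 := meet_fixed es mnb.1 mnb.2 si.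
  have := yz1 i; rewrite ltr_norml => /andP[n1 n2].
  have h1 := hd1 (t, i); have h2 := hd1 (t', i); rewrite /= in h1 h2.
  have /andP[a1 a2] := hy i; have /andP[a3 a4] := hz i.
  have w1 := lt_i t i; have w2 := lt_i t' i.
  have : mx i = mn i by rewrite e1 e2.
  rewrite /mx /mn maxElt minElt; case: ifP => b1; case: ifP => b2 e.
  - by rewrite rnd_hi ?rnd_lo //; lra.
  - lra.
  - lra.
  - by rewrite rnd_lo ?rnd_hi //; lra.
split; [|split].
- move=> i; case: (key i) => [[<- <-]|->]; exact: rnd_inbox.
- move=> i; case: (key i) => [[-> ->]|<-]; exact: rnd_inbox.
- by move=> e i; case: (key i) => // -[e1 e2]; rewrite /rnd /endpoint e e1 e2.
Qed.

(** The oriented integral over the axis-parallel box spanned from y to z in the directions of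
    [kind]; in the others only the coordinate of y counts. *)
Definition box_dual kind y z i : {scalar {poly R}} :=
  if kind i then (integ (y i) (z i) : {scalar {poly R}}) else ev (y i).

Lemma T3_zero (l : 'I_3 -> {scalar {poly R}}) p i : (forall q, l i q = 0) -> T3 l p = 0.
Proof.
move=> h; rewrite (@eq_T3 _ l (upd i (l i) l)) ?T3_slice ?h // => j u.
by rewrite /upd; case: eqP => [->|].
Qed.

Lemma box_dual_degenerate kind y z p i : kind i -> y i = z i -> T3 (box_dual kind y z) p = 0.
Proof. by move=> ki yz; apply: (@T3_zero _ _ i) => u; rewrite /box_dual ki yz /= integ_id. Qed.

(** The corners lie in the common subcell. If a direction of integration is fixed there, the box is
    degenerate and both sides vanish; otherwise all fixed directions are evaluated, and only the
    matched traces enter. *)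
Lemma box_dual_indep (b : 'I_3 -> nat) (v : I -> poly3 R) kind t t' y z : Cont M b v ->
  (forall i, ~~ kind i -> (0 < b i)%N) ->
  inbox t y -> inbox t' y -> inbox t z -> inbox t' z ->
  T3 (box_dual kind y z) (v t) = T3 (box_dual kind y z) (v t').
Proof.
move=> cv hb yt yt' zt zt'; have [->//|tt'] := eqVneq t t'.
have [|s [s' [es _]]] := meet_subcell hM tt'.
  by exists (\row_i y i); split=> i; rewrite mxE; [exact: yt | exact: yt'].
have sub : subcell (M t) s `<=` cell (M t') by rewrite -es => x [].
have [[i [c si] ki]|nk] := pselect (exists2 i, exists c, s i = Some c & kind i).
  have e : y i = z i by rewrite (meet_fixed es yt yt' si) (meet_fixed es zt zt' si).
  by rewrite !(box_dual_degenerate _ ki e).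
apply/eqP; rewrite -subr_eq0 -linearB; apply/eqP.
apply: (@T3_vanish _ (plane (M t) s)).
  apply: (cv t t' s (fun=> 0%N)) sub _ => i; case si: (s i) => [c|] //.
  by apply: hb; apply/negP => ki; apply: nk; exists i => //; exists c.
move=> i; rewrite /plane; case si: (s i) => [c|] // u.
have /negbTE ki : ~~ kind i by apply/negP => ki; apply: nk; exists i => //; exists c.
by rewrite /box_dual ki evE (meet_fixed es yt yt' si).
Qed.

Definition point3 (a b c : R) (i : 'I_3) : R := nth 0 [:: a; b; c] i.

Lemma inbox_point3 t y z w : inbox t y -> inbox t z -> inbox t w -> inbox t (point3 (y 0) (z 1) (w 2)).
Proof. by move=> hy hz hw i; case: (ord3 i) => ->; [exact: hy | exact: hz | exact: hw]. Qed.

(* Alexander-Whitney: the chains that make cochains on pairs and on triples of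
   points out of line integrals and of fluxes *)
Definition edge_path (g : 'I_3 -> poly3 R) y z : R :=
  T3 (box_dual (fun i => i == 0) (point3 (y 0) (z 1) (z 2)) (point3 (z 0) (z 1) (z 2))) (g 0) +
  T3 (box_dual (fun i => i == 1) (point3 (y 0) (y 1) (z 2)) (point3 (y 0) (z 1) (z 2))) (g 1) +
  T3 (box_dual (fun i => i == 2) (point3 (y 0) (y 1) (y 2)) (point3 (y 0) (y 1) (z 2))) (g 2).

Definition face_chain (f : 'I_3 -> poly3 R) y z w : R :=
  T3 (box_dual (fun i => i != 2) (point3 (y 0) (z 1) (w 2)) (point3 (z 0) (w 1) (w 2))) (f 2) -
  T3 (box_dual (fun i => i != 1) (point3 (y 0) (z 1) (z 2)) (point3 (z 0) (z 1) (w 2))) (f 1) +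
  T3 (box_dual (fun i => i != 0) (point3 (y 0) (y 1) (z 2)) (point3 (y 0) (z 1) (w 2))) (f 0).

Definition triple3 (a b c : {scalar {poly R}}) (i : 'I_3) : {scalar {poly R}} :=
  if i == 0 then a else if i == 1 then b else c.

Lemma box_dual_triple3 kind y z p : T3 (box_dual kind y z) p =
  T3 (triple3 (box_dual kind y z 0) (box_dual kind y z 1) (box_dual kind y z 2)) p.
Proof. by apply: eq_T3 => i u; case: (ord3 i) => ->. Qed.

Lemma T3_add (l : 'I_3 -> {scalar {poly R}}) i (f f1 f2 : {scalar {poly R}}) p :
  (forall q, f q = f1 q + f2 q) -> T3 (upd i f l) p = T3 (upd i f1 l) p + T3 (upd i f2 l) p.
Proof. by move=> h; rewrite !T3_slice h. Qed.

Lemma T3_mderiv (l : 'I_3 -> {scalar {poly R}}) i (a c : R) p :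
  T3 (upd i (integ a c : {scalar {poly R}}) l) (mderiv i p) =
  T3 (upd i (ev c) l) p - T3 (upd i (ev a) l) p.
Proof.
rewrite mderiv_along T3_along.
set l' := upd i _ _.
rewrite (@eq_T3 _ l' (upd i (fcomp (integ a c) (@deriv R) : {scalar {poly R}}) l)); last first.
  by move=> j q; rewrite /l' /upd; case: eqP => // _; rewrite eqxx.
by rewrite !T3_slice /= /fcomp integ_deriv.
Qed.
End Cochains.

(** * Stokes identities for paths and face chains *)

Section Cocycles.
Variable R : realType.
Implicit Types (F G H : {scalar {poly R}}) (p : poly3 R) (g f : 'I_3 -> poly3 R) (y z w u : 'I_3 -> R).

Lemma rotE g : [/\ rot g 0 = mderiv 1 (g 2) - mderiv 2 (g 1),
  rot g 1 = mderiv 2 (g 0) - mderiv 0 (g 2)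
  & rot g 2 = mderiv 0 (g 1) - mderiv 1 (g 0)].
Proof.
by split; congr (mderiv _ (g _) - mderiv _ (g _)); exact: val_inj.
Qed.

Let itg (a c : R) : {scalar {poly R}} := integ a c.
Let B3 F G H p := T3 (triple3 F G H) p.

Let B3D F G H p q : B3 F G H (p - q) = B3 F G H p - B3 F G H q.
Proof. exact: linearB. Qed.

Let triple3_0 F G H K : triple3 F G H =1 upd 0 F (triple3 K G H).
Proof. by move=> i; case: (ord3 i) => ->. Qed.
Let triple3_1 F G H K : triple3 F G H =1 upd 1 G (triple3 F K H).
Proof. by move=> i; case: (ord3 i) => ->. Qed.
Let triple3_2 F G H K : triple3 F G H =1 upd 2 H (triple3 F G K).
Proof. by move=> i; case: (ord3 i) => ->. Qed.

Let eqB (l l' : 'I_3 -> {scalar {poly R}}) p : l =1 l' -> T3 l p = T3 l' p.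
Proof. by move=> h; apply: eq_T3 => i q; rewrite h. Qed.

Let add0 G H p a b c : B3 (itg a c) G H p = B3 (itg a b) G H p + B3 (itg b c) G H p.
Proof.
rewrite /B3 !(eqB _ (triple3_0 _ G H (itg a a))); apply: T3_add => q; exact: integ_split.
Qed.
Let add1 F H p a b c : B3 F (itg a c) H p = B3 F (itg a b) H p + B3 F (itg b c) H p.
Proof.
rewrite /B3 !(eqB _ (triple3_1 F _ H (itg a a))); apply: T3_add => q; exact: integ_split.
Qed.
Let add2 F G p a b c : B3 F G (itg a c) p = B3 F G (itg a b) p + B3 F G (itg b c) p.
Proof.
rewrite /B3 !(eqB _ (triple3_2 F G _ (itg a a))); apply: T3_add => q; exact: integ_split.
Qed.
Let der0 G H p a c : B3 (itg a c) G H (mderiv 0 p) = B3 (ev c) G H p - B3 (ev a) G H p.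
Proof. rewrite /B3 !(eqB _ (triple3_0 _ G H (itg a a))); exact: T3_mderiv. Qed.
Let der1 F H p a c : B3 F (itg a c) H (mderiv 1 p) = B3 F (ev c) H p - B3 F (ev a) H p.
Proof. rewrite /B3 !(eqB _ (triple3_1 F _ H (itg a a))); exact: T3_mderiv. Qed.
Let der2 F G p a c : B3 F G (itg a c) (mderiv 2 p) = B3 F G (ev c) p - B3 F G (ev a) p.
Proof. rewrite /B3 !(eqB _ (triple3_2 F G _ (itg a a))); exact: T3_mderiv. Qed.

Let edge_pathE g y z : edge_path g y z = B3 (itg (y 0) (z 0)) (ev (z 1)) (ev (z 2)) (g 0) +
  B3 (ev (y 0)) (itg (y 1) (z 1)) (ev (z 2)) (g 1) +
  B3 (ev (y 0)) (ev (y 1)) (itg (y 2) (z 2)) (g 2).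
Proof. by rewrite /edge_path !box_dual_triple3. Qed.

Let face_chainE f y z w : face_chain f y z w =
  B3 (itg (y 0) (z 0)) (itg (z 1) (w 1)) (ev (w 2)) (f 2) -
  B3 (itg (y 0) (z 0)) (ev (z 1)) (itg (z 2) (w 2)) (f 1) +
  B3 (ev (y 0)) (itg (y 1) (z 1)) (itg (z 2) (w 2)) (f 0).
Proof. by rewrite /face_chain !box_dual_triple3. Qed.

(** The closed polygon bounds three axis-parallel rectangles, one per component of rot. *)
Lemma edge_path_cocycle g y z w : (forall i, rot g i = 0) ->
  edge_path g z w - edge_path g y w + edge_path g y z = 0.
Proof.
move=> hg; have [r0 r1 r2] := rotE g; rewrite !edge_pathE.
have c2 := B3D (itg (y 0) (z 0)) (itg (z 1) (w 1)) (ev (w 2)) (mderiv 0 (g 1)) (mderiv 1 (g 0)).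
have c1 := B3D (itg (y 0) (z 0)) (ev (z 1)) (itg (z 2) (w 2)) (mderiv 2 (g 0)) (mderiv 0 (g 2)).
have c0 := B3D (ev (y 0)) (itg (y 1) (z 1)) (itg (z 2) (w 2)) (mderiv 1 (g 2)) (mderiv 2 (g 1)).
rewrite -r2 hg der0 der1 in c2; rewrite -r1 hg der0 der2 in c1; rewrite -r0 hg der1 der2 in c0.
have B0 F G H : B3 F G H 0 = 0 by exact: linear0.
rewrite !B0 in c0 c1 c2.
rewrite (add0 _ _ _ (y 0) (z 0) (w 0)) (add1 _ _ _ (y 1) (z 1) (w 1)) (add2 _ _ _ (y 2) (z 2) (w 2)).
lra.
Qed.

(** The alternating sum of the face chains is the boundary of a single box, with sides from y to z,
    from z to w and from w to u, to which the divergence theorem applies. *)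
Lemma face_chain_cocycle f y z w u : dvg f = 0 ->
  face_chain f z w u - face_chain f y w u + face_chain f y z u - face_chain f y z w = 0.
Proof.
move=> hf; rewrite !face_chainE.
have : B3 (itg (y 0) (z 0)) (itg (z 1) (w 1)) (itg (w 2) (u 2)) (dvg f) = 0.
  by rewrite hf; exact: linear0.
rewrite /dvg sum3 /B3 !linearD /= -!/(B3 _ _ _ _) der0 der1 der2.
rewrite !(add0 _ _ _ (y 0) (z 0) (w 0)) (add1 _ _ _ (z 1) (w 1) (u 1)) (add1 _ _ _ (y 1) (z 1) (w 1)).
by rewrite !(add2 _ _ _ (z 2) (w 2) (u 2)); lra.
Qed.
End Cocycles.

(** * Potentials of cubical cocycles *)

Section CubicalCohomology.
Variables (R : realType) (I : finType) (Omega : set (pt3 R)) (M : I -> cuboid R).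
Hypothesis hM : cuboid_mesh Omega M.
Let X := closure Omega.
Variable p0 : pt3 R.
Hypothesis Xp0 : X p0.
Hypothesis cX : coarsely_contractible X p0.
Variable b : 'I_3 -> nat.
Hypothesis b0 : forall i, (0 < b i)%N.
Implicit Types (t : I) (i j : 'I_3) (y z w u : 'I_3 -> R) (x : pt3 R) (c : 'I_3 -> bool).

Definition pt y : pt3 R := \row_i y i.

Lemma ptE y : pt y 0 = y.
Proof. by apply/funext => i; rewrite mxE. Qed.

Lemma inbox_pt t y : inbox M t y -> X (pt y).
Proof. by move=> h; apply: (inbox_X hM (t := t)); rewrite ptE. Qed.

Lemma choose_cell : {cl : pt3 R -> I | forall x, X x -> inbox M (cl x) (x 0)}.
Proof.
apply: cid; have [t0 _ _] : (\bigcup_t cell (M t)) p0 by rewrite -(mesh_cover hM).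
have h x : exists t, X x -> inbox M t (x 0).
  have [|nX] := pselect (X x); last by exists t0 => /nX.
  by rewrite /X (mesh_cover hM) => -[t _ xt]; exists t.
by have [cl hcl] := choice h; exists cl.
Qed.
Let cl := sval choose_cell.
Let clP x : X x -> inbox M (cl x) (x 0). Proof. exact: (svalP choose_cell). Qed.

(** The vertex to which x is rounded; by [rounded] any other cell containing x gives the same
    vertex. *)
Let v x := rnd M (cl x) (x 0).

Let ball_pt y z d : 0 < d -> close d y z -> ball (pt y) d (pt z).
Proof. by move=> d0 h; apply/ball_close; rewrite !ptE. Qed.

Let close_ball x x' d : ball x d x' -> close d (x 0) (x' 0).
Proof. by move=> /ball_close[]. Qed.

Let closexx y (d : R) : 0 < d -> close d y y.
Proof. by move=> d0 i; rewrite subrr normr0. Qed.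

Definition vtx t c i : R := endpoint (M t) i (c i).

Lemma vtx_inbox t c : inbox M t (vtx t c).
Proof. by move=> i; exact: endpoint_itv. Qed.

Lemma rnd_vtx t c : rnd M t (vtx t c) = vtx t c.
Proof.
apply/funext => i; rewrite /rnd /vtx /endpoint; have := lo_lt_hi (M t) i.
by case: (c i) => lh; case: ltP => // h; exfalso; lra.
Qed.

Lemma vtx_upd t c i a : vtx t (upd i a c) = upd i (endpoint (M t) i a) (vtx t c).
Proof. by apply/funext => j; rewrite /vtx /upd; case: eqP => [->|]. Qed.

Definition interpolate (N m : nat) (a a' : R) : R := a + m%:R / N%:R * (a' - a).
Definition seg N m y z i : R := interpolate N m (y i) (z i).

Lemma interpolate0 N a a' : interpolate N 0 a a' = a.
Proof. by rewrite /interpolate !mul0r addr0. Qed.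

Lemma interpolaten N a a' : (0 < N)%N -> interpolate N N a a' = a'.
Proof. by move=> N0; rewrite /interpolate divff ?pnatr_eq0 ?gtn_eqF // mul1r addrC subrK. Qed.

Lemma interpolatexx N m a : interpolate N m a a = a.
Proof. by rewrite /interpolate subrr mulr0 addr0. Qed.

Lemma interpolate_itv N m a a' (A B : R) : (m <= N)%N -> A <= a <= B -> A <= a' <= B ->
  A <= interpolate N m a a' <= B.
Proof.
move=> mN ha ha'; case: N mN => [|N mN]; first by rewrite leqn0 => /eqP ->; rewrite interpolate0.
rewrite /interpolate; set s := _ / _.
have s0 : 0 <= s by rewrite divr_ge0.
have s1 : s <= 1 by rewrite ler_pdivrMr ?ltr0n // mul1r ler_nat.
move: ha ha' => /andP[h1 h2] /andP[h3 h4].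
have k1 : 0 <= s * (a' - A) by rewrite mulr_ge0 // subr_ge0.
have k2 : 0 <= (1 - s) * (a - A) by rewrite mulr_ge0 // subr_ge0.
have k3 : 0 <= s * (B - a') by rewrite mulr_ge0 // subr_ge0.
have k4 : 0 <= (1 - s) * (B - a) by rewrite mulr_ge0 // subr_ge0.
by apply/andP; split; lra.
Qed.

Lemma interpolate_step N m a a' : interpolate N m.+1 a a' - interpolate N m a a' = (a' - a) / N%:R.
Proof. by rewrite /interpolate -natr1; ring. Qed.

Lemma seg_inbox N m t y z : (m <= N)%N -> inbox M t y -> inbox M t z -> inbox M t (seg N m y z).
Proof. by move=> mN hy hz i; exact: interpolate_itv. Qed.

Lemma fine_subdivision (e : R) : 0 < e -> exists2 N, (0 < N)%N &
  forall t i a a', lo (M t) i <= a <= hi (M t) i -> lo (M t) i <= a' <= hi (M t) i ->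
  `|a' - a| / N%:R < e.
Proof.
move=> e0; have [e1 e10 he1] : exists2 e1 : R, 0 < e1 & forall p : I * 'I_3,
    e1 <= e / (hi (M p.1) p.2 - lo (M p.1) p.2).
  by apply: exists_pos_min => p; rewrite divr_gt0 // subr_gt0 lo_lt_hi.
exists (Num.truncn e1^-1).+1 => // t i a a' ha ha'; set N := _.+1.
have N1 : N%:R^-1 < e1 by rewrite invf_plt ?posrE ?ltr0n //; exact: truncnS_gt.
have := lt_le_trans N1 (he1 (t, i)) => /=; have := lo_lt_hi (M t) i; set W := hi _ _ - _.
move=> lh; have W0 : 0 < W by rewrite subr_gt0.
rewrite ltr_pdivlMr // => h; apply: le_lt_trans h; rewrite mulrC ler_wpM2l // ?invr_ge0 //.
by rewrite /W ler_norml; lra.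
Qed.

Let closeness := cid2 (close_cells hM).
Let d : R := s2val closeness.
Let d0 : 0 < d. Proof. exact: (s2valP closeness). Qed.
Let hd t t' y z : inbox M t y -> inbox M t' z -> close d y z ->
  inbox M t' (rnd M t y) /\ inbox M t (rnd M t' z) /\ ((forall i, y i = z i) -> rnd M t y =1 rnd M t' z).
Proof. exact: (s2valP' closeness). Qed.

Let rounded t y : inbox M t y -> v (pt y) = rnd M t y.
Proof.
move=> ty; apply/funext => i; have cy := clP (inbox_pt ty); rewrite ptE in cy.
by have [_ [_ h]] := hd cy ty (closexx y d0); rewrite /v ptE h.
Qed.

Let vin x x' : X x -> X x' -> ball x d x' -> inbox M (cl x) (v x').
Proof. by move=> Xx Xx' /close_ball xx'; have [_ []] := hd (clP Xx) (clP Xx') xx'. Qed.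

Let vpt t y : inbox M t y -> inbox M t (v (pt y)).
Proof. by move=> ty; rewrite (rounded ty); exact: rnd_inbox. Qed.

(** The cells chosen for two close points share a rounded vertex, where the values of phi match; so
    the constant is locally constant at scale d and [coarse_H0] applies. *)
Lemma constant_on_mesh (phi : I -> poly3 R) : Cont M b phi ->
  (forall t, exists a, phi t = mpolyC 3 a) ->
  exists a, forall t, phi t = mpolyC 3 a.
Proof.
move=> cphi /choice [a ha].
have same t t' y : inbox M t y -> inbox M t' y -> a t = a t'.
  move=> yt yt'; have := box_dual_indep hM (kind := xpred0) cphi (fun i _ => b0 i) yt yt' yt yt'.
  by rewrite !T3_meval !ha !mpoly.mevalC.
have key x : X x -> a (cl x) = a (cl p0).
  apply: (coarse_H0 cX d0 (f := a \o cl)) => y z Xy Xz yz.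
  have [h _] := hd (clP Xy) (clP Xz) (close_ball yz).
  by apply: same h; exact: rnd_inbox.
exists (a (cl p0)) => t; rewrite ha; congr mpolyC.
have tc := @vtx_inbox t xpred0; rewrite -(key _ (inbox_pt tc)).
by have h := clP (inbox_pt tc); rewrite ptE in h; exact: (same _ _ _ tc h).
Qed.

Section One.
Variable g : 'I_3 -> I -> poly3 R.
Hypothesis cg : forall n, Cont M (lower b n) (g n).
Hypothesis g0 : forall t i, rot (g^~ t) i = 0.

Let edge_path_indep t t' y z : inbox M t y -> inbox M t' y -> inbox M t z -> inbox M t' z ->
  edge_path (g^~ t) y z = edge_path (g^~ t') y z.
Proof.
move=> yt yt' zt zt'; rewrite /edge_path.
have K n y' z' : inbox M t y' -> inbox M t' y' -> inbox M t z' -> inbox M t' z' ->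
    T3 (box_dual (fun i => i == n) y' z') (g n t) = T3 (box_dual (fun i => i == n) y' z') (g n t').
  move=> y1 y2 z1 z2; have := box_dual_indep hM (kind := fun i => i == n) (@cg n) _ y1 y2 z1 z2; apply => i hi; rewrite /lower upd_neq //.
by congr (_ + _ + _); apply: K; exact: inbox_point3.
Qed.

Let edge_path_self t y : edge_path (g^~ t) y y = 0.
Proof. by have := edge_path_cocycle y y y (g0 t); lra. Qed.

(** The cochain is the path integral between rounded points, a cocycle at scale d. Its potential F
    is valid only for pairs closer than e, so the edge is subdivided; the rounded path integrals
    from its start add up by the cocycle identity, and rounding fixes the two ends. *)
Lemma line_potential : exists F : pt3 R -> R, forall t j c,
  T3 (cdual M (fun i => i == j) t c) (g j t) =
  F (pt (vtx t (upd j true c))) - F (pt (vtx t (upd j false c))).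
Proof.
pose f x x' := edge_path (g^~ (cl x)) (v x) (v x').
have fE x t y z : X x -> inbox M t y -> inbox M t z -> ball x d (pt y) -> ball x d (pt z) ->
    edge_path (g^~ (cl x)) (v (pt y)) (v (pt z)) = edge_path (g^~ t) (rnd M t y) (rnd M t z).
  move=> Xx yt zt xy xz; rewrite -(rounded yt) -(rounded zt).
  have [Xy Xz] := (inbox_pt yt, inbox_pt zt).
  by apply: edge_path_indep; [exact: vin | exact: vpt | exact: vin | exact: vpt].
have [|F [e1 [e10 hF]]] := coarse_H1 (f := f) cX d0 Xp0.
  move=> x x' x'' Xx Xx' Xx'' h1 h2 h3; rewrite -(edge_path_cocycle (v x) (v x') (v x'') (g0 (cl x))).
  congr (_ - _ + _); rewrite /f; apply: edge_path_indep; (exact: vin || exact: rnd_inbox).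
pose e := Order.min e1 d; have e0 : 0 < e by rewrite lt_min e10 d0.
have [N N0 hN] := fine_subdivision e0.
exists F => t j c.
have -> : T3 (cdual M (fun i => i == j) t c) (g j t) =
    T3 (box_dual (fun i => i == j) (vtx t (upd j false c)) (vtx t (upd j true c))) (g j t).
  by apply: eq_T3 => i q; rewrite /cdual /dual1 /box_dual /vtx /endpoint /upd; case: eqP => [->|_].
set y := vtx t _; set z := vtx t (upd _ true _).
have [yt zt] : inbox M t y /\ inbox M t z by split; exact: vtx_inbox.
pose P m := seg N m y z.
have Pt m : (m <= N)%N -> inbox M t (P m) by move=> h; exact: seg_inbox.
have Pc m : close e (P m) (P m.+1).
  move=> i; rewrite distrC /P /seg interpolate_step normrM normfV normr_nat; exact: hN.
have [ed ee1] : e <= d /\ e <= e1 by rewrite /e !ge_min !lexx orbT.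
have H m : (m <= N)%N -> edge_path (g^~ t) (rnd M t (P 0)) (rnd M t (P m)) = F (pt (P m)) - F (pt (P 0)).
  elim: m => [|m IH] mN; first by rewrite edge_path_self subrr.
  have Xm := inbox_pt (Pt _ (ltnW mN)); have XS := inbox_pt (Pt _ mN).
  have bm := ball_pt e0 (Pc m).
  have := hF _ _ Xm XS (le_ball ee1 bm).
  rewrite /f (fE _ _ _ _ Xm (Pt _ (ltnW mN)) (Pt _ mN)); last 2 first.
  - exact: ballxx.
  - exact: le_ball bm.
  have := edge_path_cocycle (rnd M t (P 0)) (rnd M t (P m)) (rnd M t (P m.+1)) (g0 t).
  have := IH (ltnW mN); lra.
have P0 : P 0%N = y by apply/funext => i; rewrite /P /seg interpolate0.
have PN : P N = z by apply/funext => i; rewrite /P /seg interpolaten.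
have := H N (leqnn N); rewrite P0 PN /y /z !rnd_vtx => <-.
rewrite /edge_path; case: (ord3 j) => ->.
- rewrite [X in _ + X + _](@box_dual_degenerate _ _ _ _ _ 1) // [X in _ + _ + X](@box_dual_degenerate _ _ _ _ _ 2) // !addr0.
  by apply: eq_T3 => i q; rewrite /box_dual; case: (ord3 i) => ->.
- rewrite [X in X + _ + _](@box_dual_degenerate _ _ _ _ _ 0) // [X in _ + _ + X](@box_dual_degenerate _ _ _ _ _ 2) // addr0 add0r.
  by apply: eq_T3 => i q; rewrite /box_dual; case: (ord3 i) => ->.
- rewrite [X in X + _ + _](@box_dual_degenerate _ _ _ _ _ 0) // [X in _ + X + _](@box_dual_degenerate _ _ _ _ _ 1) // !add0r.
  by apply: eq_T3 => i q; rewrite /box_dual; case: (ord3 i) => ->.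
Qed.
End One.

Section Grid.
Variables (T : Type) (P : nat -> nat -> T) (H : T -> T -> R).

(** Discrete Stokes: in the sum of the circulations around all squares the interior edges cancel. *)
Lemma grid_telescope N N' :
  \sum_(0 <= m < N) \sum_(0 <= n < N')
    (H (P m n) (P m.+1 n) + H (P m.+1 n) (P m.+1 n.+1)
     - H (P m n.+1) (P m.+1 n.+1) - H (P m n) (P m n.+1)) =
  \sum_(0 <= m < N) H (P m 0%N) (P m.+1 0%N) + \sum_(0 <= n < N') H (P N n) (P N n.+1)
  - \sum_(0 <= m < N) H (P m N') (P m.+1 N') - \sum_(0 <= n < N') H (P 0%N n) (P 0%N n.+1).
Proof.
pose r m := \sum_(0 <= n < N') H (P m n) (P m n.+1).
transitivity (\sum_(0 <= m < N) ((r m.+1 - r m) + (H (P m 0%N) (P m.+1 0%N) - H (P m N') (P m.+1 N')))).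
  apply: eq_big_nat => m _.
  rewrite -(opprB (H (P m N') _)) -(telescope_sumr (fun n => H (P m n) (P m.+1 n))) // /r.
  by rewrite -!sumrB; apply: eq_big_nat => n _; ring.
by rewrite big_split /= telescope_sumr // sumrB /r; ring.
Qed.
End Grid.

Section Two.
Variable f : 'I_3 -> I -> poly3 R.
Hypothesis cf : forall n, Cont M (lower2 b n) (f n).
Hypothesis f0 : forall t, dvg (f^~ t) = 0.

Let face_chain_indep t t' y z w : inbox M t y -> inbox M t' y -> inbox M t z -> inbox M t' z ->
  inbox M t w -> inbox M t' w -> face_chain (f^~ t) y z w = face_chain (f^~ t') y z w.
Proof.
move=> yt yt' zt zt' wt wt'; rewrite /face_chain.
have K n y' z' : inbox M t y' -> inbox M t' y' -> inbox M t z' -> inbox M t' z' ->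
    T3 (box_dual (fun i => i != n) y' z') (f n t) = T3 (box_dual (fun i => i != n) y' z') (f n t').
  move=> y1 y2 z1 z2; have := box_dual_indep hM (kind := fun i => i != n) (@cf n) _ y1 y2 z1 z2.
  by apply => i; rewrite negbK /lower2 => ->.
by congr (_ - _ + _); apply: K; exact: inbox_point3.
Qed.

Let face_chain_line t j y z w : (forall i, i != j -> y i = z i /\ z i = w i) ->
  face_chain (f^~ t) y z w = 0.
Proof.
rewrite /face_chain; case: (ord3 j) => -> h.
- have [_ e1] := h 1 isT; have [_ e2] := h 2 isT.
  by rewrite (@box_dual_degenerate _ _ _ _ _ 1) // (@box_dual_degenerate _ _ _ _ _ 2) // (@box_dual_degenerate _ _ _ _ _ 2) // subrr addr0.
- have [e0 _] := h 0 isT; have [_ e2] := h 2 isT.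
  by rewrite (@box_dual_degenerate _ _ _ _ _ 0) // (@box_dual_degenerate _ _ _ _ _ 0) // (@box_dual_degenerate _ _ _ _ _ 2) // subrr addr0.
- have [e0 _] := h 0 isT; have [e1 _] := h 1 isT.
  by rewrite (@box_dual_degenerate _ _ _ _ _ 0) // (@box_dual_degenerate _ _ _ _ _ 0) // (@box_dual_degenerate _ _ _ _ _ 1) // subrr addr0.
Qed.

(** E sums the small-scale potential h along a subdivided edge. Within one cell the rounded flux has
    a second potential, the cone [ka] from the lowest corner. Both have the same circulation around
    each small square, hence around the whole face, where the one of [ka] is explicit. *)
Lemma surface_potential : exists E : ('I_3 -> R) -> ('I_3 -> R) -> R, forall t p q c, p != q ->
  let V a a' := vtx t (upd p a (upd q a' c)) in
  face_chain (f^~ t) (V false false) (V true false) (V true true) -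
  face_chain (f^~ t) (V false false) (V false true) (V true true) =
  E (V false false) (V true false) + E (V true false) (V true true)
  - E (V false true) (V true true) - E (V false false) (V false true).
Proof.
pose F x x' x'' := face_chain (f^~ (cl x)) (v x) (v x') (v x'').
have FE t y z w : inbox M t y -> inbox M t z -> inbox M t w ->
    ball (pt y) d (pt z) -> ball (pt y) d (pt w) ->
    F (pt y) (pt z) (pt w) = face_chain (f^~ t) (rnd M t y) (rnd M t z) (rnd M t w).
  move=> yt zt wt yz yw; rewrite /F -(rounded yt) -(rounded zt) -(rounded wt).
  have Xy := inbox_pt yt; have Xz := inbox_pt zt; have Xw := inbox_pt wt.
  apply: face_chain_indep; [exact: rnd_inbox | exact: vpt | exact: vin | exact: vpt | exact: vin | exact: vpt].
have [|h [e1 [e10 hh]]] := coarse_H2 (f := F) cX d0 Xp0.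
  move=> x x' x'' x3 Xx Xx' Xx'' Xx3 h1 h2 h3 h4 h5 h6.
  rewrite -(face_chain_cocycle (v x) (v x') (v x'') (v x3) (f0 (cl x))).
  congr (_ - _ + _ - _); rewrite /F; apply: face_chain_indep; (exact: vin || exact: rnd_inbox).
pose e := Order.min e1 d; have e0 : 0 < e by rewrite lt_min e10 d0.
have [ed ee1] : e <= d /\ e <= e1 by rewrite /e !ge_min !lexx orbT.
have [N N0 hN] := fine_subdivision e0.
exists (fun y z => \sum_(0 <= m < N) h (pt (seg N m y z)) (pt (seg N m.+1 y z))) => t p q c pq V.
pose sc m i := interpolate N m (lo (M t) i) (hi (M t) i).
pose P m n := upd p (sc m p) (upd q (sc n q) (vtx t c)).
have qp : q != p by rewrite eq_sym.
have Pt m n : (m <= N)%N -> (n <= N)%N -> inbox M t (P m n).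
  move=> mN nN i; have lh := ltW (lo_lt_hi (M t) i).
  rewrite /P /upd; case: eqP => [->|_]; last case: eqP => [->|_]; last exact: endpoint_itv.
  - by apply: interpolate_itv => //; rewrite lexx ltW // lo_lt_hi.
  - by apply: interpolate_itv => //; rewrite lexx ltW // lo_lt_hi.
have st m i : `|sc m i - sc m.+1 i| < e.
  have lh := ltW (lo_lt_hi (M t) i).
  by rewrite distrC interpolate_step normrM normfV normr_nat; apply: (hN t i); rewrite lexx lh.
have Pc m n m' n' : (m' = m \/ m' = m.+1)%N -> (n' = n \/ n' = n.+1)%N -> close e (P m n) (P m' n').
  move=> hm hn i; rewrite /P /upd; case: eqP => _; last case: eqP => _.
  - by case: hm => ->; rewrite ?subrr ?normr0.
  - by case: hn => ->; rewrite ?subrr ?normr0.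
  - by rewrite subrr normr0.
pose G m n := rnd M t (P m n).
pose ka y z := face_chain (f^~ t) (V false false) y z.
(* On a small triangle both h and [ka] have the rounded flux as coboundary: h by its choice, [ka] by
   the cocycle identity with the apex of the cone as first point. *)
have tri m n m' n' m'' n'' : (m' = m \/ m' = m.+1)%N -> (n' = n \/ n' = n.+1)%N ->
    (m'' = m' \/ m'' = m'.+1)%N -> (n'' = n' \/ n'' = n'.+1)%N ->
    (m'' = m \/ m'' = m.+1)%N -> (n'' = n \/ n'' = n.+1)%N -> (m'' <= N)%N -> (n'' <= N)%N ->
    h (pt (P m' n')) (pt (P m'' n'')) - h (pt (P m n)) (pt (P m'' n'')) + h (pt (P m n)) (pt (P m' n')) =
    ka (G m' n') (G m'' n'') - ka (G m n) (G m'' n'') + ka (G m n) (G m' n').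
  move=> h1 h2 h3 h4 h5 h6 h7 h8.
  have a1 := Pt m n; have a2 := Pt m' n'; have a3 := Pt m'' n'' h7 h8.
  have {}a1 : inbox M t (P m n) by apply: a1; lia.
  have {}a2 : inbox M t (P m' n') by apply: a2; lia.
  have b1 := ball_pt e0 (Pc _ _ _ _ h1 h2); have b2 := ball_pt e0 (Pc _ _ _ _ h3 h4).
  have b3 := ball_pt e0 (Pc _ _ _ _ h5 h6).
  rewrite -hh; [|exact: inbox_pt a1|exact: inbox_pt a2|exact: inbox_pt a3|exact: le_ball b1|exact: le_ball b3|exact: le_ball b2].
  rewrite (FE t) //; [|exact: le_ball b1|exact: le_ball b3].
  have := face_chain_cocycle (V false false) (G m n) (G m' n') (G m'' n'') (f0 t).
  by rewrite -/(ka _ _) /ka /G => H; lra.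
have square m n : (m < N)%N -> (n < N)%N ->
    h (pt (P m n)) (pt (P m.+1 n)) + h (pt (P m.+1 n)) (pt (P m.+1 n.+1))
     - h (pt (P m n.+1)) (pt (P m.+1 n.+1)) - h (pt (P m n)) (pt (P m n.+1)) =
    ka (G m n) (G m.+1 n) + ka (G m.+1 n) (G m.+1 n.+1)
     - ka (G m n.+1) (G m.+1 n.+1) - ka (G m n) (G m n.+1).
  move=> mN nN.
  have := tri m n m.+1 n m.+1 n.+1; have := tri m n m n.+1 m.+1 n.+1.
  by move=> /(_ ltac:(lia) ltac:(lia) ltac:(lia) ltac:(lia) ltac:(lia) ltac:(lia) ltac:(lia) ltac:(lia)) h1
    /(_ ltac:(lia) ltac:(lia) ltac:(lia) ltac:(lia) ltac:(lia) ltac:(lia) ltac:(lia) ltac:(lia)) h2; lra.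
have := grid_telescope (fun m n => pt (P m n)) h N N.
have -> : \sum_(0 <= m < N) \sum_(0 <= n < N)
   (h (pt (P m n)) (pt (P m.+1 n)) + h (pt (P m.+1 n)) (pt (P m.+1 n.+1)) -
    h (pt (P m n.+1)) (pt (P m.+1 n.+1)) - h (pt (P m n)) (pt (P m n.+1))) =
   \sum_(0 <= m < N) \sum_(0 <= n < N) (ka (G m n) (G m.+1 n) + ka (G m.+1 n) (G m.+1 n.+1)
     - ka (G m n.+1) (G m.+1 n.+1) - ka (G m n) (G m n.+1)).
  by apply: eq_big_nat => m mN; apply: eq_big_nat => n nN; exact: square.
rewrite (grid_telescope G ka).
(* Along a straight axis-parallel line [ka] is additive, because the face chain of three collinear
   points is degenerate. *)
have line j (S : nat -> 'I_3 -> R) : (forall m m' i, i != j -> S m i = S m' i) ->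
    forall m, \sum_(0 <= m < m) ka (S m) (S m.+1) = ka (S 0%N) (S m).
  move=> hS; elim=> [|m IH].
    have := face_chain_cocycle (V false false) (S 0%N) (S 0%N) (S 0%N) (f0 t).
    by rewrite big_geq // (face_chain_line (j := 0) t (y := S 0%N)) // /ka => H; lra.
  rewrite big_nat_recr //= IH.
  have := face_chain_cocycle (V false false) (S 0%N) (S 0%N) (S m) (f0 t).
  have := face_chain_cocycle (V false false) (S 0%N) (S m) (S m.+1) (f0 t).
  rewrite (face_chain_line (j := j) t (y := S 0%N) (z := S m)); last by move=> i ij; split; exact: hS.
  by rewrite /ka => *; lra.
have PE a a' : P (if a then N else 0%N) (if a' then N else 0%N) = V a a'.
  apply/funext => i; rewrite /P /V !vtx_upd /upd /endpoint /sc /=.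
  by case: eqP => _; [case: a | case: eqP => _ //; case: a']; rewrite ?interpolate0 ?interpolaten.
have GE a a' : G (if a then N else 0%N) (if a' then N else 0%N) = V a a'.
  by rewrite /G PE rnd_vtx.
rewrite (line p (G^~ 0%N)); last by move=> m m' i ip; rewrite /G /rnd /P /upd (negbTE ip).
rewrite (line q (G N)); last first.
  by move=> m m' i iq; rewrite /G /rnd /P /upd (negbTE iq).
rewrite (line p (G^~ N)); last by move=> m m' i ip; rewrite /G /rnd /P /upd (negbTE ip).
rewrite (line q (G 0%N)); last first.
  by move=> m m' i iq; rewrite /G /rnd /P /upd (negbTE iq).
have -> : G 0%N 0%N = V false false by exact: (GE false false).
have -> : G N 0%N = V true false by exact: (GE true false).
have -> : G N N = V true true by exact: (GE true true).
have -> : G 0%N N = V false true by exact: (GE false true).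
have segp a' : forall m, seg N m (V false a') (V true a') = P m (if a' then N else 0%N).
  move=> m; apply/funext => i; rewrite /seg /P /V !vtx_upd /upd /endpoint /sc /=.
  by case: eqP => _ //; case: eqP => _; [case: a'; rewrite interpolatexx ?interpolaten ?interpolate0 | rewrite interpolatexx].
have segq a : forall m, seg N m (V a false) (V a true) = P (if a then N else 0%N) m.
  move=> m; apply/funext => i; rewrite /seg /P /V !vtx_upd /upd /endpoint /sc /=.
  by case: eqP => _; [case: a; rewrite interpolatexx ?interpolaten ?interpolate0 | case: eqP => _ //; rewrite interpolatexx].
have sump a' : \sum_(0 <= m < N) h (pt (seg N m (V false a') (V true a'))) (pt (seg N m.+1 (V false a') (V true a')))
    = \sum_(0 <= m < N) h (pt (P m (if a' then N else 0%N))) (pt (P m.+1 (if a' then N else 0%N))).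
  by apply: eq_bigr => m _; rewrite !segp.
have sumq a : \sum_(0 <= m < N) h (pt (seg N m (V a false) (V a true))) (pt (seg N m.+1 (V a false) (V a true)))
    = \sum_(0 <= m < N) h (pt (P (if a then N else 0%N) m)) (pt (P (if a then N else 0%N) m.+1)).
  by apply: eq_bigr => m _; rewrite !segq.
rewrite !sump !sumq => <-; rewrite /ka.
rewrite (face_chain_line (j := p) t (y := V false false) (z := V false false) (w := V true false)); last first.
  by move=> i ip; split=> //; rewrite /V !vtx_upd !(upd_neq _ _ ip).
rewrite (face_chain_line (j := q) t (y := V false false) (z := V false false) (w := V false true)); last first.
  by move=> i iq; split=> //; rewrite /V !vtx_upd /upd /=; case: eqP => // _; rewrite (negbTE iq).
lra.
Qed.

(** Of the two triangles of a face only the one that crosses its directions in increasing order has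
    a nonzero face chain, and that chain is the whole face. The cyclic order of j + 1 and j + 2
    disagrees with it for j = 1, which compensates the minus sign in [face_chain]. *)
Lemma flux_potential : exists E : ('I_3 -> R) -> ('I_3 -> R) -> R,
  let e t j c := E (vtx t (upd j false c)) (vtx t (upd j true c)) in forall t j c,
  T3 (cdual M (fun i => i != j) t c) (f j t) =
  (e t (j + 2) (upd (j + 1) true c) - e t (j + 2) (upd (j + 1) false c))
  - (e t (j + 1) (upd (j + 2) true c) - e t (j + 1) (upd (j + 2) false c)).
Proof.
have [E hE] := surface_potential; exists E => e t j c.
have updC p q a a' : p != q -> upd p a (upd q a' c) = upd q a' (upd p a c).
  move=> pq; apply/funext => i; rewrite /upd; case: (eqVneq i p) => [->|//].
  by rewrite (negbTE pq).
have h p q : p != q -> let V a a' := vtx t (upd p a (upd q a' c)) in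
    face_chain (f^~ t) (V false false) (V true false) (V true true) -
    face_chain (f^~ t) (V false false) (V false true) (V true true) =
    (e t q (upd p true c) - e t q (upd p false c))
    - (e t p (upd q true c) - e t p (upd q false c)).
  by move=> pq V; rewrite hE // /e -!(updC p q) // /V; ring.
have dgn (kind : 'I_3 -> bool) y z (r : poly3 R) i : kind i -> y i = z i -> T3 (box_dual kind y z) r = 0.
  exact: box_dual_degenerate.
case: (ord3 j) => ->.
- have -> : 0 + 1 = 1 :> 'I_3 by exact: val_inj.
  have -> : 0 + 2 = 2 :> 'I_3 by exact: val_inj.
  rewrite -h // /face_chain.
  rewrite (dgn _ _ _ (f 2 t) 0) // (dgn _ _ _ (f 1 t) 0) //.
  rewrite (dgn _ _ _ (f 2 t) 0) // (dgn _ _ _ (f 1 t) 0) // [X in _ - (_ + X)](dgn _ _ _ (f 0 t) 1) //.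
  by rewrite !subr0 add0r addr0 subr0; apply: eq_T3 => i q; case: (ord3 i) => ->.
- have -> : 1 + 1 = 2 :> 'I_3 by exact: val_inj.
  have -> : 1 + 2 = 0 :> 'I_3 by exact: val_inj.
  rewrite -[RHS]opprK opprB -h // /face_chain.
  rewrite (dgn _ _ _ (f 2 t) 1) // (dgn _ _ _ (f 0 t) 1) //.
  rewrite (dgn _ _ _ (f 2 t) 0) // [X in _ - (_ - X + _)](dgn _ _ _ (f 1 t) 0) // (dgn _ _ _ (f 0 t) 1) //.
  by rewrite !subr0 !addr0 sub0r subr0 opprK; apply: eq_T3 => i q; case: (ord3 i) => ->.
- have -> : 2 + 1 = 0 :> 'I_3 by exact: val_inj.
  have -> : 2 + 2 = 1 :> 'I_3 by exact: val_inj.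
  rewrite -h // /face_chain.
  rewrite (dgn _ _ _ (f 1 t) 2) // (dgn _ _ _ (f 0 t) 1) //.
  rewrite [X in _ - (X - _ + _)](dgn _ _ _ (f 2 t) 0) // (dgn _ _ _ (f 1 t) 0) // (dgn _ _ _ (f 0 t) 2) //.
  by rewrite !subr0 !addr0 !subr0; apply: eq_T3 => i q; case: (ord3 i) => ->.
Qed.
End Two.
End CubicalCohomology.

(** * Exactness of the de Rham complex on V(b) *)

Section DeRham.
Variables (R : realType) (I : finType) (Omega : set (pt3 R)) (M : I -> cuboid R).
Hypotheses (hopen : open Omega) (hcontr : contractible Omega) (hlip : lipschitz_boundary Omega).
Hypothesis hM : cuboid_mesh Omega M.
Variable k : nat.
Hypothesis k2 : (2 <= k)%N.
Variable b : 'I_3 -> nat.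
Hypothesis hb : forall i, (b i = 1 \/ b i = 2)%N.
Implicit Types (t : I) (i j : 'I_3) (f g : 'I_3 -> I -> poly3 R).

Let b0 i : (0 < b i)%N. Proof. by case: (hb i) => ->. Qed.

Let topology : exists2 p, closure Omega p & coarsely_contractible (closure Omega) p.
Proof. exact: (closure_coarsely_contractible hopen hlip (mesh_compact hM)). Qed.

Lemma mderiv0_constant p : (forall i, mderiv i p = 0) -> exists a : R, p = mpolyC 3 a.
Proof.
move=> h; exists (mcoeff (mpoly.mnm0) p); apply/mpoly.mpolyP => m.
rewrite mpoly.mcoeffC; have [<-|m0] := eqVneq mpoly.mnm0 m; first by rewrite mulr1.
rewrite mulr0; have [i mi] : exists i, m i != 0%N.
  apply/existsP; rewrite -negb_forall; apply: contraNN m0 => /forallP h0.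
  by apply/eqP/mpoly.mnmP => i; rewrite mpoly.mnm0E (eqP (h0 i)).
have := congr1 (mcoeff (mpoly.mnm_sub m (mnm1 i))) (h i).
rewrite mpoly.mcoeff_deriv mpoly.mcoeff0 mpoly.submK; last by rewrite mpoly.lep1mP.
by move=> /eqP; rewrite -mulr_natr mulf_eq0 pnatr_eq0 orbF => /eqP.
Qed.

Lemma mesh_constant (phi : I -> poly3 R) : Cont M b phi -> (forall t i, mderiv i (phi t) = 0) ->
  exists a, forall t, phi t = mpolyC 3 a.
Proof.
move=> hphi h; have [p Xp cX] := topology.
by apply: (constant_on_mesh hM Xp cX b0 hphi) => t; exact: mderiv0_constant.
Qed.

(** The cubical potential is interpolated from the vertices by hats; its gradient is exactly the
    remainder of the homotopy, by [mderiv_cpoly]. *)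
Lemma closed_gradient g : space1 M k b g -> (forall t j, rot (g^~ t) j = 0) ->
  exists2 phi, space M k b phi & forall t j, g j t = mderiv j (phi t).
Proof.
move=> hg g0; have [p Xp cX] := topology.
have [phi hphi ephi] := homotopy1 hM k2 hb hg g0.
have [F hF] := line_potential hM Xp cX b0 (fun n => (hg n).2) g0.
pose E t c := F (pt (vtx M t c)).
exists (fun t => phi t + cpoly M b (fun=> false) (E t) t).
  apply: spaceD => //; apply: (@eq_space _ _ _ _ (bkind b (fun=> false))) => [i|].
    by rewrite /bkind subn0.
  apply: (space_cpoly hM k2) => // t t' s c c' _ h; rewrite /E (_ : vtx M t c = vtx M t' c') //.
  exact/funext.
move=> t j; rewrite ephi (raddfD (mderiv j)) /= mderiv_cpoly //; congr (_ + _).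
rewrite (_ : upd j true _ = (fun x => x == j)); last by apply/funext => x; rewrite /upd; case: eqP.
by apply: eq_cpoly => c _; rewrite hF.
Qed.

Lemma closed_rot f : space2 M k b f -> (forall t, dvg (f^~ t) = 0) ->
  exists2 g, space1 M k b g & forall t j, f j t = rot (g^~ t) j.
Proof.
move=> hf f0; have [p Xp cX] := topology.
have [g hg eg] := homotopy2 hM k2 hb hf f0.
have [F hF] := flux_potential hM Xp cX b0 (fun n => (hf n).2) f0.
pose E t i (c : 'I_3 -> bool) := F (vtx M t (upd i false c)) (vtx M t (upd i true c)).
exists (fun i t => g i t + cpoly M b (fun x => x == i) (E t i) t).
  move=> i; apply: spaceD; first exact: hg.
  apply: (@eq_space _ _ _ _ (bkind b (fun x => x == i))) => [x|].
    by rewrite /bkind /lower /upd; case: eqP => [->|_]; rewrite ?subn1 ?subn0.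
  apply: (space_cpoly hM k2) => // t t' s c c' sub h; rewrite /E.
  have e a : vtx M t (upd i a c) = vtx M t' (upd i a c').
    apply/funext => x; rewrite /vtx /upd; have := h x; have := subcell_match hM sub x.
    by case: eqP => // _ m [sx _]; move: m; rewrite sx /endpoint => -[-> ->].
  by rewrite !e.
move=> t j; rewrite eg (rotD (g^~ t)); congr (_ + _).
have [n1 n2] : j + 1 != j + 2 /\ j + 2 != j + 1.
  by case: (ord3 j) => ->.
rewrite /rot !mderiv_cpoly // (_ : upd (j + 1) true _ = (fun x => x != j)); last first.
  by apply/funext => x; rewrite /upd; case: (ord3 j) => ->; case: (ord3 x) => ->.
rewrite (_ : upd (j + 2) true _ = (fun x => x != j)); last first.
  by apply/funext => x; rewrite /upd; case: (ord3 j) => ->; case: (ord3 x) => ->.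
by rewrite -cpolyB; apply: eq_cpoly => c _; rewrite hF.
Qed.
End DeRham.

(** * The elasticity complex *)

Section Entries.
Variable R : realType.
Implicit Types (s : mat3 R) (u : vec3 R) (i j x y : 'I_3) (om : 'I_3 -> poly3 R).

Lemma symE s i j : sym s i j = (2^-1 : R) *: (s i j + s j i).
Proof. by rewrite /sym !mxE mpoly.mul_mpolyC. Qed.

Lemma symgradE u i j :
  symgrad u i j = (2^-1 : R) *: (mderiv j (u 0 i) + mderiv i (u 0 j)).
Proof. by rewrite /symgrad symE !mxE. Qed.

Lemma curlTE s i j : curlT s i j = rot (fun y => s y j) i.
Proof. by rewrite /curlT /curl /curl_row !mxE. Qed.

Lemma curlcurlTE s i j : curlcurlT s i j = rot (curlT s i) j.
Proof. by rewrite /curlcurlT; move: (curlT s) => c; rewrite /curl /curl_row !mxE. Qed.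

Lemma divE s i : div s 0 i = dvg (s i).
Proof. by rewrite /div mxE. Qed.

Lemma scale_half (p : poly3 R) : (2^-1 : R) *: (p + p) = p.
Proof. by rewrite -{1 2}[p]scale1r -scalerDl scalerA mulVf ?scale1r // (pnatr_eq0 R 2). Qed.

Lemma sym_tr s : (sym s)^T = sym s.
Proof. by apply/matrixP => i j; rewrite mxE !symE addrC. Qed.

Lemma eq_rot (g g' : 'I_3 -> poly3 R) i : (forall j, g j = g' j) -> rot g i = rot g' i.
Proof. by move=> h; rewrite /rot !h. Qed.

Lemma rotZ (a : R) (g : 'I_3 -> poly3 R) i : rot (fun x => a *: g x) i = a *: rot g i.
Proof. by rewrite /rot scalerBr !mpoly.mderivZ. Qed.

Lemma rotN (g : 'I_3 -> poly3 R) i : rot (fun x => - g x) i = - rot g i.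
Proof. by rewrite /rot !linearN /= opprB addrC opprK. Qed.

Lemma mderiv_rot x (g : 'I_3 -> poly3 R) i :
  mderiv x (rot g i) = rot (fun y => mderiv x (g y)) i.
Proof. by rewrite /rot linearB /= ![mderiv x (mderiv _ _)]mderivC. Qed.

Lemma rotC (s : 'I_3 -> 'I_3 -> poly3 R) i j :
  rot (fun x => rot (fun y => s y x) i) j = rot (fun y => rot (s y) j) i.
Proof.
rewrite /rot !linearB /=.
rewrite (mderivC (j + 1) (i + 1)) (mderivC (j + 1) (i + 2)) (mderivC (j + 2) (i + 1)) (mderivC (j + 2) (i + 2)).
ring.
Qed.

Lemma ord3_add : [/\ [/\ 0 + 1 = 1 :> 'I_3, 1 + 1 = 2 :> 'I_3 & 2 + 1 = 0 :> 'I_3] &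
  [/\ 0 + 2 = 2 :> 'I_3, 1 + 2 = 0 :> 'I_3 & 2 + 2 = 1 :> 'I_3]].
Proof. by split; split; exact: val_inj. Qed.

(* \sum_x skw om y x * v x = (v \times om) y *)
Definition skw om y x : poly3 R :=
  if x == y + 1 then om (y + 2) else if x == y + 2 then - om (y + 1) else 0.

Lemma skw_antisym om y x : skw om x y = - skw om y x.
Proof.
rewrite /skw; have [[e1 e2 e3] [e4 e5 e6]] := ord3_add.
by case: (ord3 x) => ->; case: (ord3 y) => ->; rewrite ?(e1, e2, e3, e4, e5, e6) /= ?oppr0 ?opprK.
Qed.

(** The algebraic link between the two de Rham complexes: the column-wise curl of a skew matrix is
    the divergence of its axial vector times the identity, minus the gradient. *)
Lemma rot_skw om i x : rot (skw om ^~ x) i =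
  (if i == x then dvg om else 0) - mderiv x (om i).
Proof.
rewrite /rot /skw /dvg sum3; have [[e1 e2 e3] [e4 e5 e6]] := ord3_add.
by case: (ord3 x) => ->; case: (ord3 i) => ->; rewrite ?(e1, e2, e3, e4, e5, e6) /= ?(e1, e2, e3, e4, e5, e6) ?linear0 ?linearN /=; ring.
Qed.

(** Used to see that the rotation vector omega is divergence-free, which removes the trace term of
    [rot_skw]. *)
Lemma trace_curlT s : s^T = s -> \sum_i curlT s i i = 0.
Proof.
move=> hs; have e i j : s i j = s j i by rewrite -{1}hs mxE.
rewrite sum3 !curlTE /rot; have [[e1 e2 e3] [e4 e5 e6]] := ord3_add.
rewrite ?(e1, e2, e3, e4, e5, e6) (e 1 0) (e 2 0) (e 2 1); ring.
Qed.

(** The divergence of column x is, up to sign, the antisymmetric part of the row-wise curl in the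
    two other indices. *)
Lemma dvg_trace (ta : 'I_3 -> 'I_3 -> poly3 R) :
  (forall i j, rot (ta i) j = rot (ta j) i) ->
  forall x, dvg (fun i => ta i x - (if i == x then \sum_j ta j j else 0)) = 0.
Proof.
move=> h x; have [[e1 e2 e3] [e4 e5 e6]] := ord3_add.
have h01 := h 0 1; have h02 := h 0 2; have h12 := h 1 2.
rewrite /rot ?(e1, e2, e3, e4, e5, e6) in h01 h02 h12.
move: h01 h02 h12; rewrite /dvg !sum3.
by case: (ord3 x) => -> /= h01 h02 h12; rewrite ?subr0 ?linearB ?linearD /=;
  [move: h12|move: h02|move: h01] => /eqP; rewrite -subr_eq0 => /eqP hh;
  ((rewrite -[RHS]hh; ring) || (rewrite -[RHS]oppr0 -[in RHS]hh; ring)).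
Qed.

Lemma curlcurlT_symgrad u : curlcurlT (symgrad u) = 0.
Proof.
apply/matrixP => i j; rewrite curlcurlTE [RHS]mxE.
pose w := rot (u 0) i.
(* The column-wise curl kills one half of the symmetric gradient; the other half is the gradient of
   rot u, which the row-wise curl kills. *)
have e x : curlT (symgrad u) i x = (2^-1 : R) *: mderiv x w.
  rewrite curlTE (eq_rot (g' := fun y => (2^-1 : R) *: (mderiv y (u 0 x) + mderiv x (u 0 y)))).
    by rewrite rotZ rotD rot_grad add0r /w mderiv_rot.
  by move=> y; rewrite symgradE addrC.
by rewrite (eq_rot _ e) rotZ rot_grad scaler0.
Qed.

Lemma div_curlcurlT s : div (curlcurlT s) = 0.
Proof.
apply/rowP => i; rewrite divE [RHS]mxE -(dvg_rot (curlT s i)).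
by apply: eq_bigr => j _; rewrite curlcurlTE.
Qed.
End Entries.

Section Elasticity.
Variables (R : realType) (I : finType) (Omega : set (pt3 R)) (M : I -> cuboid R).
Hypotheses (hopen : open Omega) (hcontr : contractible Omega) (hlip : lipschitz_boundary Omega).
Hypothesis hM : cuboid_mesh Omega M.
Variable k : nat.
Hypothesis k2 : (2 <= k)%N.
Implicit Types (t : I) (i j x y : 'I_3) (u : I -> vec3 R) (s : I -> mat3 R).

Definition bOm i x : nat := (1 + (x == i))%N.

Let bX12 i x : (bX i x = 1 \/ bX i x = 2)%N.
Proof. by rewrite /bX; case: eqP; auto. Qed.
Let bOm12 i x : (bOm i x = 1 \/ bOm i x = 2)%N.
Proof. by rewrite /bOm; case: eqP; auto. Qed.

Lemma lower_bX i x : lower (bX i) x =1 bPhi x i.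
Proof. by move=> y; rewrite /lower /upd /bX /bPhi; case: (eqVneq y x) => [->|_] /=; case: eqP. Qed.
Lemma lower_bOm i x : lower (bOm i) x =1 lower2 (bX x) i.
Proof.
move=> y; rewrite /lower /lower2 /upd /bX /bOm.
by case: (ord3 x) => ->; case: (ord3 y) => ->; case: (ord3 i) => ->.
Qed.
Lemma lower2_bOm i x : lower2 (bOm i) x =1 bGamma i x.
Proof.
move=> y; rewrite /lower2 /bOm /bGamma.
by case: (ord3 x) => ->; case: (ord3 y) => ->; case: (ord3 i) => ->.
Qed.

(** The part of [Gammah] whose diagonal entries have matched normal derivatives as well. It contains
    the range of [curlcurlT] and the kernel of [div], and unlike [Gammah] it fits into the de Rham
    complexes. *)
Definition Gamma_reg s := (forall t, (s t)^T = s t) /\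
  forall i j, space M k (bGamma i j) (fun t => s t i j).

Lemma symgrad_Phih u : Xh M k u -> Phih M k (cellwise (@symgrad R) u).
Proof.
move=> /(XhP hM k2) hu; apply/(PhihP hM k2); split=> [t|i j]; first exact: sym_tr.
apply: (@space_ext _ _ _ _ _ (fun t => (2^-1 : R) *: (mderiv j (u t 0 i) + mderiv i (u t 0 j)))).
  by move=> t; rewrite /cellwise symgradE.
have g x y : space M k (bPhi x y) (fun t => mderiv y (u t 0 x)).
  rewrite bPhiC; apply: (eq_space (lower_bX x y)).
  exact: (space1_grad (bX12 x) (hu x)).
apply/spaceZ/spaceD; first exact: g.
by rewrite bPhiC; exact: g.
Qed.

Lemma curlT_space1 s : Phih M k s -> forall i, space1 M k (bOm i) (fun x t => curlT (s t) i x).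
Proof.
move=> /(PhihP hM k2) [hs h] i x; apply: (eq_space (fun y => esym (lower_bOm i x y))).
apply: (@space_ext _ _ _ _ _ (fun t => rot (fun y => s t y x) i)); first by move=> t; rewrite curlTE.
apply: (space2_rot (bX12 x) (g := fun y t => s t y x)) => y.
by apply: (eq_space (fun z => esym (lower_bX x y z))); exact: h.
Qed.

Lemma curlcurlT_sym (s : mat3 R) : s^T = s -> (curlcurlT s)^T = curlcurlT s.
Proof.
move=> hs; apply/matrixP => i j; rewrite mxE !curlcurlTE.
rewrite (eq_rot _ (fun x => curlTE s j x)) (eq_rot _ (fun x => curlTE s i x)).
rewrite (rotC (fun x y => s x y)); apply: eq_rot => y; apply: eq_rot => x.
by rewrite -{1}hs mxE.
Qed.

Lemma curlcurlT_reg s : Phih M k s -> Gamma_reg (cellwise (@curlcurlT R) s).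
Proof.
move=> hs; split=> [t|i j].
  by apply: curlcurlT_sym; move/(PhihP hM k2): hs => [].
apply: (eq_space (lower2_bOm i j)).
apply: (@space_ext _ _ _ _ _ (fun t => rot (fun x => curlT (s t) i x) j)).
  by move=> t; rewrite /cellwise curlcurlTE.
exact: (space2_rot (bOm12 i) (curlT_space1 hs i)).
Qed.

Lemma Gamma_reg_Gammah s : Gamma_reg s -> Gammah M k s.
Proof.
move=> [hs h]; apply/(GammahP hM k2); split=> // i.
have [h1 h2] := h i i; split=> [t|].
  by apply: deg_ltW (h1 t) => x; rewrite /bGamma /nGamma muln2 addnn.
by apply: ContW h2 => x; rewrite /bGamma leq_addr.
Qed.

Lemma div_Zh s : Gammah M k s -> Zh R I k (cellwise (@div R) s).
Proof.
move=> /(GammahP hM k2) [_ hd ho]; apply/(ZhP k2 _) => i t.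
rewrite /cellwise divE; apply: deg_lt_sum => j _; have [->|ij] := eqVneq j i.
  apply: (deg_lt_mderiv _ _ ((hd i).1 t)); first by rewrite /nGamma eqxx /= addn2 addn1.
  by move=> x /negbTE xi; rewrite /nGamma xi.
rewrite eq_sym in ij; apply: (deg_lt_mderiv _ _ ((ho i j ij).1 t)).
  by rewrite /bGamma eqxx addnA addn1.
by move=> x /negbTE xj; rewrite /bGamma xj addn0.
Qed.

Lemma ker_curlcurlT s : Phih M k s -> (forall t, curlcurlT (s t) = 0) ->
  exists2 u, Xh M k u & s = cellwise (@symgrad R) u.
Proof.
move=> hs h0; have c1 := curlT_space1 hs; have [tr hPhi] := (PhihP hM k2 s).1 hs.
have sC t i j : s t i j = s t j i by rewrite -{1}tr mxE.
have [om hom] : exists om : 'I_3 -> I -> poly3 R, forall i, space M k (bOm i) (om i) /\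
    forall t x, curlT (s t) i x = mderiv x (om i t).
  suff h i : exists w, space M k (bOm i) w /\ forall t x, curlT (s t) i x = mderiv x (w t).
    by have [om] := choice h; exists om.
  have [|w hw ew] := closed_gradient hopen hcontr hlip hM k2 (bOm12 i) (c1 i); last by exists w.
  by move=> t j; rewrite -curlcurlTE h0 mxE.
have dom t : dvg (om^~ t) = 0.
  rewrite /dvg (eq_bigr (fun i => curlT (s t) i i)); last by move=> i _; rewrite (hom i).2.
  exact: trace_curlT.
pose g x y t := s t y x + skw (om^~ t) y x.
have hg x : space1 M k (bX x) (g x).
  move=> y; apply: (eq_space (fun z => esym (lower_bX x y z))); apply: spaceD; first exact: hPhi.
  (* The entry of [skw] in the place y, x is plus or minus omega_l with l the third direction, and 2
     - e_x - e_y = 1 + e_l. *)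
  rewrite /skw; case: eqP => [->|_].
    apply: eq_space (hom (y + 2)).1 => z; rewrite /bOm /bPhi.
    by case: (ord3 y) => ->; case: (ord3 z) => ->.
  case: eqP => [->|_]; last exact: space0.
  apply/spaceN/(eq_space _ (hom (y + 1)).1) => z; rewrite /bOm /bPhi.
  by case: (ord3 y) => ->; case: (ord3 z) => ->.
have [u hu] : exists u : 'I_3 -> I -> poly3 R, forall x, space M k (bX x) (u x) /\
    forall t y, g x y t = mderiv y (u x t).
  suff h x : exists w, space M k (bX x) w /\ forall t y, g x y t = mderiv y (w t).
    by have [u] := choice h; exists u.
  have [|w hw ew] := closed_gradient hopen hcontr hlip hM k2 (bX12 x) (hg x); last by exists w.
  move=> t i; rewrite (rotD (fun y => s t y x)) rot_skw dom if_same sub0r.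
  by rewrite -curlTE (hom i).2 subrr.
exists (fun t => \row_x u x t).
  by apply/(XhP hM k2) => x; apply: (space_ext _ (hu x).1) => t; rewrite mxE.
(* The skew part drops out of the symmetric gradient. *)
apply/funext => t; apply/matrixP => i j; rewrite /cellwise symgradE !mxE -!(hu _).2 /g.
by rewrite (skw_antisym _ i j) (sC t j i) addrACA addNr addr0 scale_half.
Qed.

Lemma deg_ltC (n : 'I_3 -> nat) (a : R) : (forall i, 0 < n i)%N -> deg_lt n (mpolyC 3 a).
Proof.
move=> h m; rewrite mpoly.msuppC; case: ifP => // _; rewrite inE => /eqP -> i.
by rewrite mpoly.mnm0E.
Qed.

Lemma deg_ltX (n : 'I_3 -> nat) x : (forall i, 1 < n i)%N ->
  deg_lt n (mpolyX R (mnm1 x)).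
Proof.
move=> h m; rewrite mpoly.msuppX inE => /eqP -> i.
by rewrite mpoly.mnm1E; apply: leq_trans (h i); case: eqP.
Qed.

Lemma mderiv_var x j : mderiv j (mpolyX R (mnm1 x)) =
  mpolyC 3 (x == j)%:R.
Proof.
rewrite mpoly.mderivX mpoly.mnm1E; case: (eqVneq x j) => [->|_]; last by rewrite scale0r mpoly.mpolyC0.
rewrite scale1r mpoly.mpolyC1 (_ : mpoly.mnm_sub _ _ = mpoly.mnm0) ?mpoly.mpolyX0 //.
by apply/mpoly.mnmP => i; rewrite mpoly.mnmBE subnn mpoly.mnm0E.
Qed.

Lemma rigidE (a b : 'I_3 -> R) i : rigid_motion a b 0 i =
  mpolyC 3 (a i) + (b (i + 1) *: mpolyX R (mnm1 (i + 2))
                          - b (i + 2) *: mpolyX R (mnm1 (i + 1))).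
Proof. by rewrite /rigid_motion mxE. Qed.

Lemma mderiv_rigid (a b : 'I_3 -> R) i j : mderiv j (rigid_motion a b 0 i) =
  mpolyC 3 (b (i + 1) * (i + 2 == j)%:R - b (i + 2) * (i + 1 == j)%:R).
Proof.
rewrite rigidE mpoly.mderivD mpoly.mderivC add0r mpoly.mderivB !mpoly.mderivZ !mderiv_var.
by rewrite mpoly.mpolyCB !mpoly.mpolyCM !mpoly.mul_mpolyC.
Qed.

Lemma RM_Xh : RM R I `<=` Xh M k.
Proof.
move=> u [a [b hu]]; apply/(XhP hM k2) => i.
apply: (@space_ext _ _ _ _ _ (fun t => rigid_motion a b 0 i)) => [t|]; first by rewrite hu.
split=> [t|]; last exact: Cont_cst.
have h x : (1 < k + bX i x)%N by apply: leq_trans k2 _; exact: leq_addr.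
rewrite rigidE; apply: deg_ltD; first by apply: deg_ltC => x; exact: ltnW.
by apply: deg_ltB; apply/deg_ltZ/deg_ltX.
Qed.

Lemma symgrad_rigid (a b : 'I_3 -> R) : symgrad (rigid_motion a b) = 0.
Proof.
apply/matrixP => i j; rewrite symgradE !mderiv_rigid !mxE -mpoly.mpolyCD.
have [[e1 e2 e3] [e4 e5 e6]] := ord3_add.
rewrite [X in mpolyC 3 X](_ : _ = 0) ?mpoly.mpolyC0 ?scaler0 //.
by case: (ord3 i) => ->; case: (ord3 j) => ->; rewrite ?(e1, e2, e3, e4, e5, e6) /=; ring.
Qed.

Lemma ker_symgrad u : Xh M k u -> (forall t, symgrad (u t) = 0) -> RM R I u.
Proof.
move=> /(XhP hM k2) hu h0.
have anti t i j : mderiv j (u t 0 i) = - mderiv i (u t 0 j).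
  have := congr1 (fun A : mat3 R => A i j + A i j) (h0 t); rewrite /= !symgradE mxE addr0 -scalerDr.
  rewrite scalerDr -scalerDl (_ : (2^-1 + 2^-1 : R) = 1); last by field.
  by rewrite scale1r => /eqP; rewrite addr_eq0 => /eqP.
have two (p : poly3 R) : p = - p -> p = 0.
  by move=> e; rewrite -[p]scale_half {2}e subrr scaler0.
(* Second derivatives are symmetric in j, l and antisymmetric under exchange of i with either; three
   exchanges return the term with the opposite sign. *)
have dd t i j l : mderiv l (mderiv j (u t 0 i)) = 0.
  apply: two; rewrite {1}(anti t i j) mpoly.mderivN (mderivC l i) (anti t j l) mpoly.mderivN.
  by rewrite opprK (mderivC i j) (anti t l i) mpoly.mderivN (mderivC j l).
have diag t i : mderiv i (u t 0 i) = 0 by apply: two; exact: anti.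
have [B hB] : exists B : 'I_3 -> 'I_3 -> R, forall i j t,
    mderiv j (u t 0 i) = mpolyC 3 (B i j).
  suff h i j : exists c : R, forall t, mderiv j (u t 0 i) = mpolyC 3 c.
    by exists (fun i => projT1 (choice (h i))) => i j; exact: (projT2 (choice (h i))).
  (* The diagonal is treated apart because its exponents 2 - 2 e_i include 0, while off the diagonal
     they are all 1 or 2 and [mesh_constant] applies. *)
  have [->|ij] := eqVneq i j; first by exists 0 => t; rewrite diag mpoly.mpolyC0.
  apply: (mesh_constant hopen hcontr hlip hM (b := bPhi i j)) => [x||t l]; last exact: dd.
    by move: ij; rewrite /bPhi; case: (ord3 i) => ->; case: (ord3 j) => -> // _; case: (ord3 x) => ->; auto.
  rewrite bPhiC; apply: (eq_Cont (lower_bX i j)).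
  exact: (space1_grad (bX12 i) (hu i) j).2.
have antiB i j : B i j = - B j i.
  have [p Op _] := hcontr; have : closure Omega p by exact: subset_closure.
  rewrite (mesh_cover hM) => -[t _ _]; have := congr1 (meval (fun=> 0)) (anti t i j).
  by rewrite !hB mpoly.mevalN !mpoly.mevalC.
have [a ha] : exists a : 'I_3 -> R, forall i t,
    u t 0 i - \sum_j B i j *: mpolyX R (mnm1 j) = mpolyC 3 (a i).
  suff h i : exists c : R, forall t, u t 0 i - \sum_j B i j *: mpolyX R (mnm1 j) = mpolyC 3 c.
    by have [a ha] := choice h; exists a.
  apply: (mesh_constant hopen hcontr hlip hM (bX12 i)) => [|t l].
    have [_ c1] := hu i; have c2 : Cont M (bX i) (fun=> - \sum_j B i j *: mpolyX R (mnm1 j)) := @Cont_cst _ _ _ _ _.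
    have := ContP 1 c1 c2; apply: Cont_ext => t; by rewrite scale1r.
  rewrite mpoly.mderivB hB (linear_sum (mderiv l)) /= (bigD1 l) //= big1 => [|x xl].
    by rewrite mpoly.mderivZ mderiv_var eqxx mpoly.mpolyC1 addr0 mpoly.alg_mpolyC subrr.
  by rewrite mpoly.mderivZ mderiv_var (negbTE xl) mpoly.mpolyC0 scaler0.
(* In a rigid motion b_m is the coefficient of x_(m+1) in the component m + 2. *)
exists a, (fun m => B (m + 2) (m + 1)) => t; apply/rowP => i.
have [[e1 e2 e3] [e4 e5 e6]] := ord3_add.
have Bii x : B x x = 0 by apply/eqP; have := antiB x x; move/eqP; rewrite -subr_eq0 opprK -mulr2n mulrn_eq0 => /eqP ->.
rewrite rigidE -(ha i t) sum3.
by case: (ord3 i) => ->; rewrite ?(e1, e2, e3, e4, e5, e6) Bii; [rewrite (antiB 1 0)|rewrite (antiB 2 1)|rewrite (antiB 0 2)]; rewrite !(scale0r, scaleNr); ring.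
Qed.
(** Two matched orders in direction i are one order for v and one for its normal derivative; nothing
    is asked on subcells fixed in another direction. *)
Lemma Cont_raise i (v : I -> poly3 R) : Cont M (fun x => x == i) v ->
  Cont M (fun x => x == i) (fun t => mderiv i (v t)) -> Cont M (bGamma i i) v.
Proof.
move=> c0 c1 t t' s r sub hr.
have hx x : x != i -> s x = None /\ r x = 0%N.
  by move=> xi; have := hr x; rewrite /bGamma (negbTE xi); case: (s x).
case ri: (r i) => [|n].
  apply: (c0 t t' s r sub) => x; have := hr x; case: (eqVneq x i) => [->|xi]; rewrite ?ri.
    by case: (s i).
  by have [-> ->] := hx x xi.
have dE p : dif r p = dif (fun=> 0%N) (mderiv i p).
  rewrite dif_mderiv; apply: eq_dif => x; rewrite /upd; case: (eqVneq x i) => [->|/hx[]//].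
  by rewrite ri; have := hr i; rewrite ri /bGamma eqxx; case: (s i) => // _; case: n {ri}.
rewrite !dE; apply: (c1 t t' s _ sub) => x; have := hr x; case: (eqVneq x i) => [->|xi].
  by case: (s i).
by have [-> _] := hx x xi.
Qed.

Lemma ker_div_reg s : Gammah M k s -> (forall t, div (s t) = 0) -> Gamma_reg s.
Proof.
move=> /(GammahP hM k2) [hs hd ho] h0; split=> // i j.
have [<-{j}|] := eqVneq i j; last exact: ho.
split=> [t|]; first by apply: deg_ltW ((hd i).1 t) => x; rewrite /bGamma /nGamma muln2 addnn.
apply: Cont_raise; first exact: (hd i).2.
apply: (@Cont_ext _ _ _ _ (fun t => - \sum_(j | j != i) mderiv j (s t i j))) => [t|].
  apply/esym/eqP; rewrite -addr_eq0; apply/eqP.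
  by have := congr1 (fun q : vec3 R => q 0 i) (h0 t); rewrite divE mxE /dvg (bigD1 i).
suff h : forall r : seq 'I_3, Cont M (fun x => x == i) (fun t => \sum_(j <- r | j != i) mderiv j (s t i j)).
  have := ContP (-1) (h (index_enum _)) (Cont_cst 0); apply: Cont_ext => t.
  by rewrite scaleN1r addr0.
elim=> [|x r IH]; first by apply: Cont_ext (Cont_cst 0) => t; rewrite big_nil.
have [xi|xi] := eqVneq x i.
  by apply: Cont_ext IH => t; rewrite big_cons xi eqxx.
have hc : Cont M (fun x => x == i) (fun t => mderiv x (s t i x)).
  rewrite eq_sym in xi; apply: Cont_mderiv (ho i x xi).2.
  - by rewrite /bGamma eqxx [x == i]eq_sym (negbTE xi).
  - by move=> y yx; rewrite /bGamma (negbTE yx) addn0.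
  - by right; rewrite eq_sym (negbTE xi).
have := ContP 1 hc IH; apply: Cont_ext => t.
by rewrite big_cons xi scale1r.
Qed.

Lemma ker_div s : Gammah M k s -> (forall t, div (s t) = 0) ->
  exists2 v, Phih M k v & s = cellwise (@curlcurlT R) v.
Proof.
move=> hs h0; have [tr hG] := ker_div_reg hs h0.
have sC t i j : s t i j = s t j i by rewrite -{1}tr mxE.
have [ta hta] : exists ta : 'I_3 -> 'I_3 -> I -> poly3 R, forall i, space1 M k (bOm i) (ta i) /\
    forall t j, s t i j = rot ((ta i)^~ t) j.
  suff h i : exists g, space1 M k (bOm i) g /\ forall t j, s t i j = rot (g^~ t) j.
    by have [ta] := choice h; exists ta.
  have [||g hg eg] := closed_rot hopen hcontr hlip hM k2 (bOm12 i) (f := fun j t => s t i j).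
  - by move=> j; apply: (eq_space (fun x => esym (lower2_bOm i j x))); exact: hG.
  - by move=> t; rewrite -(divE (s t)) h0 mxE.
  - by exists g.
pose trc t := \sum_j ta j j t.
(* Each diagonal entry of tau lies in V(1,1,1), because lowering 1 + e_j in direction j gives 1
   everywhere; the diagonal of psi asks for exactly that space. *)
have htrc : space M k (fun=> 1%N) trc.
  have h j : space M k (fun=> 1%N) (ta j j).
    apply: eq_space ((hta j).1 j) => x; rewrite /lower /upd /bOm eqxx.
    by case: eqP.
  apply: (@space_ext _ _ _ _ _ (fun t => ta 0 0 t + (ta 1 1 t + ta 2 2 t))).
    by move=> t; rewrite /trc sum3.
  by apply: spaceD; [|apply: spaceD]; exact: h.
pose psi x i t := ta i x t - (if i == x then trc t else 0).
have hpsi x : space2 M k (bX x) (psi x).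
  move=> i; apply: spaceB.
    by apply: (eq_space (lower_bOm i x)); exact: (hta i).1.
  case: eqP => [->|_]; last exact: space0.
  by apply: eq_space htrc => y; rewrite /lower2 /bX; case: eqP.
have [phi hphi] : exists phi : 'I_3 -> 'I_3 -> I -> poly3 R, forall x, space1 M k (bX x) (phi x) /\
    forall t i, psi x i t = rot ((phi x)^~ t) i.
  suff h x : exists g, space1 M k (bX x) g /\ forall t i, psi x i t = rot (g^~ t) i.
    by have [phi] := choice h; exists phi.
  have [|g hg eg] := closed_rot hopen hcontr hlip hM k2 (bX12 x) (hpsi x); last by exists g.
  move=> t; apply: (dvg_trace (ta := fun i j => ta i j t)) => i j.
  by rewrite -!(hta _).2 sC.
pose v t : mat3 R := \matrix_(y, x) phi x y t.
have hv y x : space M k (bPhi y x) (fun t => v t y x).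
  apply: (eq_space (lower_bX x y)); apply: (space_ext _ ((hphi x).1 y)) => t.
  by rewrite mxE.
(* The curls of v reproduce s up to the row-wise curl of the trace times the identity. That term is
   antisymmetric, so symmetrizing v removes it. *)
exists (fun t => sym (v t)).
  apply/(PhihP hM k2); split=> [t|i j]; first exact: sym_tr.
  apply: (@space_ext _ _ _ _ _ (fun t => (2^-1 : R) *: (v t i j + v t j i))).
    by move=> t; rewrite symE.
  by apply/spaceZ/spaceD; [|rewrite bPhiC]; exact: hv.
apply/funext => t; apply/matrixP => i j; rewrite /cellwise curlcurlTE.
pose r1 (a : 'I_3 -> 'I_3 -> poly3 R) := rot (fun x => rot (fun y => a y x) i) j.
have -> : rot (curlT (sym (v t)) i) j =
    (2^-1 : R) *: (r1 (fun y x => phi x y t) + r1 (fun y x => phi y x t)).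
  rewrite /r1 -rotD -rotZ; apply: eq_rot => x; rewrite curlTE -rotD -rotZ.
  by apply: eq_rot => y; rewrite symE !mxE.
have key i' j' : rot (fun x => rot ((phi x)^~ t) i') j' =
    s t i' j' - rot (fun x => if i' == x then trc t else 0) j'.
  rewrite (eq_rot _ (fun x => esym ((hphi x).2 t i'))) (hta i').2 -rotN -rotD.
  exact: eq_rot.
rewrite {1}/r1 key /r1 (rotC (fun y x => phi y x t)) key (sC t j i).
have -> : rot (fun x => if j == x then trc t else 0) i = - rot (fun x => if i == x then trc t else 0) j.
  rewrite /rot; have [[e1 e2 e3] [e4 e5 e6]] := ord3_add.
  by case: (ord3 i) => ->; case: (ord3 j) => ->; rewrite ?(e1, e2, e3, e4, e5, e6) /= ?linear0 ?subr0 ?sub0r ?oppr0 ?opprK ?addr0 ?oppr0.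
by rewrite opprK addrACA addNr addr0 scale_half.
Qed.
End Elasticity.

(** * Surjectivity of the divergence *)

Section DivergenceOnto.
Variables (R : realType) (I : finType) (Omega : set (pt3 R)) (M : I -> cuboid R).
Hypothesis hM : cuboid_mesh Omega M.
Variable k : nat.
Hypothesis k2 : (2 <= k)%N.
Implicit Types (t : I) (x y : 'I_3) (a c : R).

Definition prim_from a (p : {poly R}) : {poly R} := prim p - (prim p).[a]%:P.
Lemma prim_from_is_linear a : linear (prim_from a).
Proof.
by move=> c p q; rewrite /prim_from linearP /= hornerD hornerZ polyCD polyCM -!mul_polyC; ring.
Qed.
HB.instance Definition _ a :=
  GRing.isLinear.Build R {poly R} {poly R} _ (prim_from a) (prim_from_is_linear a).

Definition integ_cst a c (p : {poly R}) : {poly R} := (integ a c p)%:P.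
Lemma integ_cst_is_linear a c : linear (integ_cst a c).
Proof. by move=> e p q; rewrite /integ_cst linearP /= polyCD polyCM mul_polyC. Qed.
HB.instance Definition _ a c :=
  GRing.isLinear.Build R {poly R} {poly R} _ (integ_cst a c) (integ_cst_is_linear a c).

Variables (i : 'I_3) (q : I -> poly3 R).

Definition same_column t t' := [forall x, (x != i) ==> (lo (M t) x == lo (M t') x) && (hi (M t) x == hi (M t') x)].

(* Integration of q along the whole column of cells that ends at the face
   below t, whether or not these cells are contiguous. *)
Definition column_prim t : poly3 R := along i (prim_from (lo (M t) i)) (q t) +
  \sum_(t' | same_column t t' && (hi (M t') i <= lo (M t) i))
    along i (integ_cst (lo (M t') i) (hi (M t') i)) (q t').

Lemma same_columnP t t' : reflect (forall x, x != i -> lo (M t) x = lo (M t') x /\ hi (M t) x = hi (M t') x) (same_column t t').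
Proof.
apply: (iffP forallP) => h x; last by apply/implyP => /h[-> ->]; rewrite !eqxx.
by move=> xi; have /implyP/(_ xi)/andP[/eqP ? /eqP ?] := h x.
Qed.

Lemma mderiv_column_prim t : mderiv i (column_prim t) = q t.
Proof.
have d1 a : along i (@deriv R) (along i (prim_from a) (q t)) = q t.
  rewrite along_comp -[RHS](along_id i); apply: eq_along => p /=.
  by rewrite /prim_from derivB derivC subr0 primK.
have d2 a c t' : along i (@deriv R) (along i (integ_cst a c) (q t')) = 0.
  rewrite along_comp (_ : along i _ _ = along i (fun u => 0 * id u) (q t')); last first.
    by apply: eq_along => p /=; rewrite /integ_cst derivC mul0r.
  by rewrite along_embl linear0 mul0r.
rewrite mderiv_along linearD /= d1 linear_sum /= big1 ?addr0 // => t' _; exact: d2.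
Qed.

Lemma deg_column_prim t : (forall t, deg_lt (fun x => k + (x == i))%N (q t)) -> deg_lt (nGamma k i) (column_prim t).
Proof.
move=> h; apply: deg_ltD; last apply: deg_lt_sum => t' _; (apply: deg_lt_along (h _); last by
  move=> x xi; rewrite /nGamma (negbTE xi)) => p; rewrite /nGamma eqxx /= => hp.
- rewrite /prim_from; apply: leq_trans (size_polyD _ _) _; rewrite size_polyN geq_max.
  rewrite (leq_trans (size_prim _)) /=; last by rewrite addn2 ltnS -addn1.
  by apply: leq_trans (size_polyC_leq1 _) _; rewrite addn2.
- by apply: leq_trans (size_polyC_leq1 _) _; rewrite addn2.
Qed.

Lemma meval_column_prim t (z : 'I_3 -> R) : meval z (column_prim t) =
  integ (lo (M t) i) (z i) (uni i z (q t)) +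
  \sum_(t' | same_column t t' && (hi (M t') i <= lo (M t) i))
     integ (lo (M t') i) (hi (M t') i) (uni i z (q t')).
Proof.
rewrite /column_prim mpoly.mevalD meval_along /prim_from hornerD hornerN hornerC; congr (_ + _).
rewrite (linear_sum (meval z)) /=; apply: eq_bigr => t' _.
by rewrite meval_along hornerC.
Qed.

Lemma column_overlap t t' : same_column t t' ->
  Order.max (lo (M t) i) (lo (M t') i) < Order.min (hi (M t) i) (hi (M t') i) -> t = t'.
Proof.
move=> /same_columnP h hi; apply: (overlap_eq hM) => x.
have [->//|/h[-> ->]] := eqVneq x i; by rewrite maxxx minxx lo_lt_hi.
Qed.

(** Seen from the upper cell, the integral over t is one of the summands; the remaining ones are the
    same from both cells, since no other cell of the column fits between or overlaps t. *)
Lemma column_prim_face t t' (z : 'I_3 -> R) : same_column t t' -> hi (M t) i = lo (M t') i ->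
  z i = hi (M t) i -> meval z (column_prim t) = meval z (column_prim t').
Proof.
move=> col e zi; rewrite !meval_column_prim zi -e integ_id add0r.
have /same_columnP c1 := col.
have colC : same_column t' t by apply/same_columnP => x /c1[-> ->].
have trans t1 : same_column t' t1 = same_column t t1.
  by apply/same_columnP/same_columnP => h x xi; have [<- <-] := h x xi; have [-> ->] := c1 x xi.
rewrite [RHS](bigD1 t) ?colC ?lexx //=; congr (_ + _); apply: eq_bigl => t1.
rewrite trans; apply/andP/andP => -[].
  move=> h1 h2; split; first by rewrite h1 (le_trans h2) // ltW // lo_lt_hi.
  by apply/eqP => t1t; move: h2; rewrite t1t leNgt lo_lt_hi.
move=> /andP[h1 h2] t1t; split=> //; rewrite leNgt; apply/negP => h3; move/eqP: t1t; apply.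
apply/esym/column_overlap => //; rewrite gt_max !lt_min !lo_lt_hi h3 /= andbT.
exact: lt_le_trans (lo_lt_hi _ _) h2.
Qed.

Lemma Cont_column_prim : Cont M (fun x => x == i) column_prim.
Proof.
move=> t t' s r sub hr.
have hx x : x != i -> s x = None by move=> xi; have := hr x; rewrite (negbTE xi); case: (s x).
have r0 x : r x = 0%N.
  by have := hr x; case: (s x) => [c|//]; case: (x == i) => //; case: (r x).
have d0 p : dif r p = p by rewrite -[RHS]dif0; exact: eq_dif.
rewrite !d0 => z hz; rewrite mpoly.mevalB; apply/eqP; rewrite subr_eq0; apply/eqP.
have [->//|tt'] := eqVneq t t'; have mt := subcell_match hM sub.
have col : same_column t t' by apply/same_columnP => x xi; have := mt x; rewrite hx.
have colC : same_column t' t by apply/same_columnP => x xi; have /same_columnP/(_ x xi)[-> ->] := col.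
have no : ~ Order.max (lo (M t) i) (lo (M t') i) < Order.min (hi (M t) i) (hi (M t') i).
  by move=> /(column_overlap col) /eqP; rewrite (negbTE tt').
have l1 := lo_lt_hi (M t) i; have l2 := lo_lt_hi (M t') i.
have := mt i; have := hz i; rewrite /plane.
case: (s i) => [c|]; last by move=> _ [e1 e2]; case: no; rewrite e1 e2 maxxx minxx.
(* A common upper end or a common lower end would make the two cells overlap, so the face is the
   upper end of one cell and the lower end of the other. *)
move=> zi [c'] e; move: zi e; rewrite /endpoint; case: c; case: c' => zi e.
- by case: no; rewrite -e minxx gt_max l1 e l2.
- exact: column_prim_face.
- by apply/esym/column_prim_face => //; rewrite zi.
- by case: no; rewrite -e maxxx lt_min l1 e l2.
Qed.
End DivergenceOnto.

Lemma div_onto (R : realType) (I : finType) (Omega : set (pt3 R)) (M : I -> cuboid R) (k : nat)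
    (q : I -> vec3 R) : cuboid_mesh Omega M -> (2 <= k)%N -> Zh R I k q ->
  exists2 s, Gammah M k s & q = cellwise (@div R) s.
Proof.
move=> hM k2 /(ZhP k2) hq.
pose c i := column_prim M i (fun t => q t 0 i).
(* A diagonal matrix decouples the three components, leaving one antiderivative per row, continuous
   across faces normal to x_i. *)
exists (fun t => \matrix_(i, j) if i == j then c i t else 0).
  apply/(GammahP hM k2); split.
  - by move=> t; apply/matrixP => i j; rewrite !mxE eq_sym; case: eqP => // ->.
  - move=> i; have -> : (fun t : I => (\matrix_(i, j) (if i == j then c i t else 0)) i i) = c i.
      by apply/funext => t; rewrite mxE eqxx.
    split=> [t|]; last exact: (Cont_column_prim hM).
    by rewrite mxE eqxx; apply: deg_column_prim => t'; exact: hq.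
  - move=> i j ij; apply: (space_ext _ (@space0 _ _ M k _)) => t.
    by rewrite mxE (negbTE ij).
apply/funext => t; apply/rowP => i; rewrite /cellwise divE /dvg (bigD1 i) //= big1 => [|j ji].
  by rewrite mxE eqxx addr0 mderiv_column_prim.
by rewrite mxE eq_sym (negbTE ji) linear0.
Qed.

Theorem theorem4p2 (R : realType) (k : nat) (hk : (2 <= k)%N)
    (Omega : set 'rV[R]_3)
    (hopen : open Omega) (hconn : connected Omega)
    (hcontr : contractible Omega) (hlip : lipschitz_boundary Omega)
    (I : finType) (M : I -> cuboid R) (hM : cuboid_mesh Omega M) :
  [/\ RM R I `<=` Xh M k,
      cellwise (@symgrad R) @` Xh M k `<=` Phih M k,
      cellwise (@curlcurlT R) @` Phih M k `<=` Gammah M k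
    & cellwise (@div R) @` Gammah M k `<=` Zh R I k]
  /\
  [/\ [set u | Xh M k u /\ forall t, symgrad (u t) = 0] = RM R I,
      [set s | Phih M k s /\ forall t, curlcurlT (s t) = 0]
        = cellwise (@symgrad R) @` Xh M k,
      [set s | Gammah M k s /\ forall t, div (s t) = 0]
        = cellwise (@curlcurlT R) @` Phih M k
    & cellwise (@div R) @` Gammah M k = Zh R I k].
Proof.
have symgradX u : Xh M k u -> Phih M k (cellwise (@symgrad R) u) by exact: (symgrad_Phih hM hk).
have curlcurlX s : Phih M k s -> Gammah M k (cellwise (@curlcurlT R) s).
  by move=> hs; exact: (Gamma_reg_Gammah hM hk (curlcurlT_reg hM hk hs)).
have divX s : Gammah M k s -> Zh R I k (cellwise (@div R) s) by exact: (div_Zh hM hk).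
have RMX := RM_Xh (I := I) hM hk.
split; split.
- exact: RMX.
- by move=> _ [u hu <-]; exact: symgradX.
- by move=> _ [s hs <-]; exact: curlcurlX.
- by move=> _ [s hs <-]; exact: divX.
- apply/seteqP; split=> [u [hu h0]|u hu]; first exact: (ker_symgrad hopen hcontr hlip hM hk).
  split; first exact: RMX.
  by move=> t; case: hu => a [b ->]; exact: symgrad_rigid.
- apply/seteqP; split=> [s [hs h0]|_ [u hu <-]].
    by have [u hu ->] := ker_curlcurlT hopen hcontr hlip hM hk hs h0; exists u.
  split; first exact: symgradX.
  by move=> t; exact: curlcurlT_symgrad.
- apply/seteqP; split=> [s [hs h0]|_ [v hv <-]].
    by have [v hv ->] := ker_div hopen hcontr hlip hM hk hs h0; exists v.
  split; first exact: curlcurlX.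
  by move=> t; exact: div_curlcurlT.
- apply/seteqP; split=> [_ [s hs <-]|q hq]; first exact: divX.
  by have [s hs ->] := div_onto hM hk hq; exists s.
Qed.
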